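(* Let $H$ be a Hilbert space, let $K\geq 4$ be an integer, and let $L_1,L_2,\dots,L_K$ be closed subspaces of $H$. The following statements are equivalent: (i) there exist a starting point $z_0\in H$, a sequence of indices $k_1,k_2,\dots\in [K]$ containing each of the numbers $1,\dots,K$ infinitely often, and, for each $k\in[K]$, a closed subspace $\tilde L_k\subset L_k$, such that the sequence of iterates defined by $z_n=P(\tilde L_{k_n})z_{n-1}$, $n\geq 1$, does not converge in norm; (ii) there exists $V\subset\binom{[K]}{4}$ such that $\bigcup V=[K]$, the graph $G=(V,E)$ with edge set $E=\{\{A,B\}\in\binom{V}{2}: |A\cap B|=3\}$ is connected, and for every $A\in V$, either $\bigcap_{i\in A}L_i$ is infinite dimensional or $\sum_{i\in A}L_i^{\perp}$ is not closed in $H$.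
   Context: $[K]=\{1,\dots,K\}$. For a finite set $V$ and $k\in\mathbb N$, $\binom{V}{k}$ is the set of all $k$-element subsets of $V$; $\bigcup V$ is the union of the members of $V$. For a closed subspace $X$ of $H$, $P(X)$ is the orthogonal projection of $H$ onto $X$, and $X^\perp$ is the orthogonal complement of $X$ in $H$. *)

(* Defs.v *)
From HB Require Import structures.
From mathcomp Require Import all_boot all_order all_algebra.
From mathcomp Require Import complex.
From mathcomp Require Import all_classical all_reals all_analysis.

Set Implicit Arguments.
Unset Strict Implicit.
Unset Printing Implicit Defensive.

Import Order.TTheory GRing.Theory Num.Theory.
Import numFieldNormedType.Exports.

Local Open Scope classical_set_scope.
Local Open Scope ring_scope.

(* A Hilbert space is real or complex: [scalars R s] is R or R[i]. *)
Variant scalar_kind := RealScalars | ComplexScalars.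

Definition scalars (R : realType) (s : scalar_kind) : numFieldType :=
  match s with
  | RealScalars => R
  | ComplexScalars => R[i]
  end.

Definition scalar_conj (R : realType) (s : scalar_kind) :
    scalars R s -> scalars R s :=
  match s with
  | RealScalars => id
  | ComplexScalars => @conjc R
  end.

Definition norm_of_dot (R : realType) (s : scalar_kind)
    (H : completeNormedModType (scalars R s))
    (dot : {dot H for @scalar_conj R s}) : Prop :=
  forall x : H, `|x| ^+ 2 = dot x x.

Section Subspaces.
Variables (F : numFieldType) (H : completeNormedModType F).
Implicit Types (X : set H) (dot : H -> H -> F).

Definition closed_subspace X : Prop := submod_closed [in X] /\ closed X.

Definition finite_dimensional X : Prop :=
  exists (n : nat) (e : 'I_n -> H),
    X = [set \sum_(i < n) a i *: e i | a in [set: 'I_n -> F]].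

Definition orthocomplement dot X : set H :=
  [set y | forall x, X x -> dot x y = 0].

Definition subspace_sum (I : finType) (A : {set I}) (X : I -> set H) : set H :=
  [set \sum_(i in A) v i | v in [set v : I -> H | forall i, i \in A -> X i (v i)]].

(* P(X) x is the component in X of x with respect to the decomposition of the
   space as the direct sum of X and its orthogonal complement; the default
   value 0 is irrelevant when X is a closed subspace. *)
Definition orth_proj dot X (x : H) : H :=
  xget 0 [set y | X y /\ orthocomplement dot X (x - y)].

(* [k n] is the index of the projection applied at step n.+1. *)
Fixpoint iterates dot (I : Type) (L : I -> set H) (k : nat -> I) (z0 : H)
    (n : nat) : H :=
  if n is m.+1 then orth_proj dot (L (k m)) (iterates dot L k z0 m) else z0.

End Subspaces.

(* [V] is a set of vertices and [e] is the adjacency relation. *)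
Definition graph_connected (T : finType) (V : {set T}) (e : rel T) : Prop :=
  {in V &, forall A B : T, connect [rel C D | [&& C \in V, D \in V & e C D]] A B}.

Definition meet_in_three (I : finType) : rel {set I} :=
  fun A B => (A != B) && (#|A :&: B| == 3%N).

(* Main.v *)
(* Complex scalars are restricted to the reals, multiplication by i being kept
   as an isometry [J] under which all subspaces are stable.

   Call a four-element set of indices A good if the intersection Z of the L_i
   (i in A) is finite-dimensional and the sum of their orthogonal complements
   is closed.

   (i) => (ii).  For a good A the distance to Z is bounded by a multiple of the
   sum of the distances to the L_i (by a gliding hump argument).  If iterates
   come arbitrarily close to all L_i (i in A) infinitely often, they therefore
   have a norm cluster point, and since every index recurs, the whole sequence
   converges.  So for a divergent sequence no good set is approached in this
   way.  While only two of the subspaces are used, the orbit moves by no more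
   than its loss of squared norm allows, so a late iterate is close to the last
   three subspaces used.  Adding to these three the next new index gives
   approached, hence not good, sets, and consecutive ones meet in three indices.

   (ii) => (i).  If A is not good, there are unit vectors orthogonal to any given
   finite set and arbitrarily close to all the L_i (i in A).  Follow a
   recurrent walk A_0, A_1, ... in the graph, and fix orthonormal e_m close
   to the L_i (i in A_m).  Three common indices c, t, p of A_m and A_(m+1)
   suffice to move e_m to e_(m+1) at arbitrarily small cost: among orthonormal
   vectors close to the three spaces the space for c consists of all of them,
   the one for p is the plane of e_m and e_(m+1), and the one for t is tilted
   out of the space for c, so that (t c)^s p is a power of a symmetric
   contraction followed by the projection onto the plane.  Products of these
   turn e_m to e_(m+1) in many small steps, each loss being of second order.
   The tilt can be taken as small as desired, with more iterations, so that
   vectors of the tilted space remain close to L_t.  The orbit of e_0 thus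
   stays close to an orthonormal sequence infinitely often. *)

Require Import Defs.
From HB Require Import structures.
From mathcomp Require Import all_boot all_order all_algebra.
From mathcomp Require Import complex.
From mathcomp Require Import all_classical all_reals all_analysis.
From mathcomp Require Import ring lra zify.

Set Implicit Arguments.
Unset Strict Implicit.
Unset Printing Implicit Defensive.

Import Order.TTheory GRing.Theory Num.Theory.
Import numFieldNormedType.Exports.

Local Open Scope classical_set_scope.
Local Open Scope ring_scope.

(** * Real inner product spaces and projections *)

(** The obstacle in the second implication is that a smaller tilt needs more iterations. Errors are
    therefore of two kinds. Those of the order of the tilt [kap] are paid only at projections onto
    the plane and at the end vectors of a block, and the number of these payments is fixed before
    [kap]. A pair of projections [t], [c] costs only a multiple of the tolerance [tau] with which
    the chosen vectors approximate the spaces, and [tau] is chosen last, when the number of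
    iterations is known. One tilted space has to serve all the small turns of a block: its angles
    are spread so widely that suitable powers imitate every member of a chain of nested projections.
    A single subspace of each [L i] also has to serve infinitely many blocks. Their vectors are
    orthogonal except for the end vectors shared by neighbours, and there an index that is tilted in
    one block is neither tilted nor a core index in the next. In the first implication there are
    only finitely many good sets, so one tolerance and one starting time work for all of them. *)

HB.mixin Record isInner (R : realType) V of GRing.Lmodule R V := {
  ip : V -> V -> R;
  ipC : forall x y, ip x y = ip y x;
  ipDl : forall x y z, ip (x + y) z = ip x z + ip y z;
  ipZl : forall (a : R) x y, ip (a *: x) y = a * ip x y;
  ip_ge0 : forall x, 0 <= ip x x;
  ip_eq0 : forall x, ip x x = 0 -> x = 0 }.

#[short(type="innerType")]
HB.structure Definition Inner (R : realType) :=
  {V of isInner R V & GRing.Lmodule R V}.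

HB.mixin Record isHilbert (R : realType) V of Inner R V := {
  ip_complete : forall u : nat -> V,
    (forall e : R, 0 < e -> exists N, forall m n, (N <= m)%N -> (N <= n)%N ->
      Num.sqrt (ip (u m - u n) (u m - u n)) <= e) ->
    exists l, forall e : R, 0 < e -> exists N, forall n, (N <= n)%N ->
      Num.sqrt (ip (u n - l) (u n - l)) <= e }.

#[short(type="hilbertType")]
HB.structure Definition Hilbert (R : realType) :=
  {V of isHilbert R V & Inner R V}.

Section InnerTheory.
Variables (R : realType) (V : innerType R).
Implicit Types (x y z : V) (a : R).

Definition nr x : R := Num.sqrt (ip x x).

Lemma ipDr x y z : ip x (y + z) = ip x y + ip x z.
Proof. by rewrite ipC ipDl !(ipC _ x). Qed.

Lemma ipZr a x y : ip x (a *: y) = a * ip x y.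
Proof. by rewrite ipC ipZl ipC. Qed.

Lemma ipNl x y : ip (- x) y = - ip x y.
Proof. by rewrite -scaleN1r ipZl mulN1r. Qed.

Lemma ipNr x y : ip x (- y) = - ip x y.
Proof. by rewrite ipC ipNl ipC. Qed.

Lemma ipBl x y z : ip (x - y) z = ip x z - ip y z.
Proof. by rewrite ipDl ipNl. Qed.

Lemma ipBr x y z : ip x (y - z) = ip x y - ip x z.
Proof. by rewrite ipDr ipNr. Qed.

Lemma ip0l x : ip 0 x = 0.
Proof. by rewrite -(scale0r (0 : V)) ipZl mul0r. Qed.

Lemma ip0r x : ip x 0 = 0.
Proof. by rewrite ipC ip0l. Qed.

Lemma ip_suml (I : Type) (r : seq I) (P : pred I) (F : I -> V) y :
  ip (\sum_(i <- r | P i) F i) y = \sum_(i <- r | P i) ip (F i) y.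
Proof. by elim/big_rec2: _ => [|i a b _ <-]; rewrite ?ip0l ?ipDl. Qed.

Lemma ip_sumr (I : Type) (r : seq I) (P : pred I) (F : I -> V) y :
  ip y (\sum_(i <- r | P i) F i) = \sum_(i <- r | P i) ip y (F i).
Proof. by elim/big_rec2: _ => [|i a b _ <-]; rewrite ?ip0r ?ipDr. Qed.

Lemma nr_ge0 x : 0 <= nr x. Proof. exact: sqrtr_ge0. Qed.

Lemma nrE x : nr x ^+ 2 = ip x x.
Proof. by rewrite sqr_sqrtr // ip_ge0. Qed.

Lemma nr0 : nr (0 : V) = 0. Proof. by rewrite /nr ip0l sqrtr0. Qed.

Lemma nr_eq0 x : nr x = 0 -> x = 0.
Proof. by move=> h; apply: ip_eq0; rewrite -nrE h expr0n. Qed.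

Lemma nr_gt0 x : x != 0 -> 0 < nr x.
Proof. by rewrite lt_def nr_ge0 andbT; apply: contra_neq; exact: nr_eq0. Qed.

Lemma nrZ a x : nr (a *: x) = `|a| * nr x.
Proof. by rewrite /nr ipZl ipZr mulrA -expr2 sqrtrM ?sqr_ge0 // sqrtr_sqr. Qed.

Lemma nrN x : nr (- x) = nr x.
Proof. by rewrite -scaleN1r nrZ normrN1 mul1r. Qed.

Lemma nrBC x y : nr (x - y) = nr (y - x).
Proof. by rewrite -nrN opprB. Qed.

Lemma nr_sqD x y : nr (x + y) ^+ 2 = nr x ^+ 2 + 2 * ip x y + nr y ^+ 2.
Proof. by rewrite !nrE ipDl !ipDr (ipC y x); ring. Qed.

Lemma nr_sqB x y : nr (x - y) ^+ 2 = nr x ^+ 2 - 2 * ip x y + nr y ^+ 2.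
Proof. by rewrite nr_sqD nrN ipNr; ring. Qed.

Lemma nr_leP x a : 0 <= a -> (nr x <= a) = (ip x x <= a ^+ 2).
Proof. by move=> a0; rewrite -nrE ler_sqr ?nnegrE ?nr_ge0. Qed.

Lemma nr1 x : ip x x = 1 -> nr x = 1.
Proof. by rewrite /nr => ->; rewrite sqrtr1. Qed.

Lemma cauchy x y : `|ip x y| <= nr x * nr y.
Proof.
have [->|y0] := eqVneq y 0; first by rewrite ip0r nr0 mulr0 normr0.
have yp := nr_gt0 y0.
rewrite -ler_sqr ?nnegrE ?mulr_ge0 ?nr_ge0 ?normr_ge0 //.
rewrite real_normK ?num_real // exprMn.
(* This is the component of [x] orthogonal to [y], scaled by [nr y ^+ 2] to avoid a division. *)
have := ip_ge0 (nr y ^+ 2 *: x - ip x y *: y).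
rewrite -nrE nr_sqB !nrZ ipZl ipZr !exprMn !real_normK ?num_real //.
have -> : (nr y ^+ 2) ^+ 2 * nr x ^+ 2 - 2 * (nr y ^+ 2 * (ip x y * ip x y)) +
  ip x y ^+ 2 * nr y ^+ 2 = nr y ^+ 2 * (nr x ^+ 2 * nr y ^+ 2 - ip x y ^+ 2).
  by ring.
by rewrite pmulr_rge0 ?exprn_gt0 // subr_ge0.
Qed.

Lemma ip_le x y : ip x y <= nr x * nr y.
Proof. exact: le_trans (ler_norm _) (cauchy _ _). Qed.

Lemma nrD x y : nr (x + y) <= nr x + nr y.
Proof.
rewrite -ler_sqr ?nnegrE ?addr_ge0 ?nr_ge0 // nr_sqD.
by have := ip_le x y; nra.
Qed.

Lemma nrB x y : nr (x - y) <= nr x + nr y.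
Proof. by rewrite -(nrN y); exact: nrD. Qed.

Lemma nr_tri y x z : nr (x - z) <= nr (x - y) + nr (y - z).
Proof. by have := nrD (x - y) (y - z); rewrite addrA subrK. Qed.

Lemma nr_sub x y : nr x - nr y <= nr (x - y).
Proof. by have := nrD (x - y) y; rewrite subrK; lra. Qed.

Lemma nr_sum (I : Type) (r : seq I) (P : pred I) (F : I -> V) :
  nr (\sum_(i <- r | P i) F i) <= \sum_(i <- r | P i) nr (F i).
Proof.
elim/big_rec2: _ => [|i a b _ h]; first by rewrite nr0.
by apply: le_trans (nrD _ _) _; rewrite lerD2l.
Qed.

Lemma pythag x y : ip x y = 0 -> nr (x + y) ^+ 2 = nr x ^+ 2 + nr y ^+ 2.
Proof. by move=> h; rewrite nr_sqD h mulr0 addr0. Qed.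

Lemma unitize x : x != 0 -> ip ((nr x)^-1 *: x) ((nr x)^-1 *: x) = 1.
Proof.
move=> x0; have xp := nr_gt0 x0.
by rewrite ipZl ipZr -nrE; field; rewrite gt_eqF.
Qed.

End InnerTheory.

Lemma inv_small (R : realType) (e : R) : 0 < e ->
  exists N, forall n, (N <= n)%N -> n.+1%:R^-1 <= e.
Proof.
move=> e0; exists (Num.truncn e^-1) => n Nn.
rewrite invf_ple ?posrE ?ltr0n //.
by move: Nn; rewrite truncn_le_nat => /ltW.
Qed.

Lemma eq0_eps (R : realType) (x : R) : (forall e, 0 < e -> `|x| <= e) -> x = 0.
Proof.
move=> h; apply: normr0_eq0; apply/eqP; rewrite eq_le normr_ge0 andbT.
by apply/ler_addgt0Pr => e e0; rewrite add0r h.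
Qed.

Section Subspaces.
Variables (R : realType) (V : innerType R).
Implicit Types (x y z : V) (a e : R) (X : set V).

Definition subsp X := X 0 /\ forall a x y, X x -> X y -> X (a *: x + y).
(** Closedness is expressed by the norm alone, since [innerType] carries no topology. *)
Definition adh_closed X :=
  forall l, (forall e, 0 < e -> exists2 x, X x & nr (l - x) <= e) -> X l.
Definition csub X := subsp X /\ adh_closed X.
Definition ortho X : set V := [set y | forall x, X x -> ip x y = 0].
Definition proj X x : V :=
  xget 0 [set y | X y /\ forall w, X w -> ip w (x - y) = 0].

Lemma subspD X x y : subsp X -> X x -> X y -> X (x + y).
Proof. by move=> [_ h] xX yX; rewrite -[x]scale1r; exact: h. Qed.

Lemma subspZ X a x : subsp X -> X x -> X (a *: x).
Proof. by move=> [h0 h] xX; rewrite -[a *: x]addr0; exact: h. Qed.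

Lemma subspB X x y : subsp X -> X x -> X y -> X (x - y).
Proof. by move=> h xX yX; rewrite -scaleN1r; exact: (subspD h xX (subspZ (-1) h yX)). Qed.

Lemma subsp_sum X (I : Type) (r : seq I) (P : pred I) (F : I -> V) :
  subsp X -> (forall i, P i -> X (F i)) -> X (\sum_(i <- r | P i) F i).
Proof. by move=> h hF; elim/big_ind: _ => //; [case: h | move=> x y; exact: subspD]. Qed.

Lemma adherent_ip0 x l : (forall e, 0 < e -> exists2 y, ip x y = 0 & nr (l - y) <= e) ->
  ip x l = 0.
Proof.
move=> h; apply: eq0_eps => e e0.
have x1 : 0 < nr x + 1 by rewrite ltr_wpDl // nr_ge0.
have [y xy ly] := h (e / (nr x + 1)) (divr_gt0 e0 x1).
have -> : ip x l = ip x (l - y) by rewrite ipBr xy subr0.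
apply: le_trans (cauchy _ _) _; apply: le_trans (_ : (nr x + 1) * (e / (nr x + 1)) <= _).
  by apply: ler_pM; rewrite ?nr_ge0 // lerDl.
by rewrite mulrC divfK // gt_eqF.
Qed.

Lemma csub_ortho X : csub (ortho X).
Proof.
split; first split; first by move=> x _; rewrite ip0r.
  by move=> a x y hx hy z zX; rewrite ipDr ipZr hx // hy // mulr0 addr0.
by move=> l h x xX; apply: adherent_ip0 => e /h [y yX]; exists y => //; exact: yX.
Qed.

Lemma subset_orthoo X : X `<=` ortho (ortho X).
Proof. by move=> x xX y yX; rewrite ipC yX. Qed.

Lemma proj_unique X x y : subsp X -> X y -> (forall w, X w -> ip w (x - y) = 0) ->
  proj X x = y.
Proof.
move=> sX yX h; rewrite /proj; case: xgetP => [z _ [zX hz]|]; last by move/(_ y); case.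
apply/eqP; rewrite -subr_eq0; apply/eqP/ip_eq0.
have zy : X (z - y) by exact: subspB.
have -> : ip (z - y) (z - y) = ip (z - y) ((x - y) - (x - z)).
  by congr ip; rewrite opprB [RHS]addrC addrA subrK.
by rewrite ipBr h // hz // subr0.
Qed.

End Subspaces.

Section Projection.
Variables (R : realType) (V : hilbertType R).
Implicit Types (x y z : V) (a e : R) (X Y : set V).

Lemma proj_exists X x : csub X -> exists2 y, X y & forall w, X w -> ip w (x - y) = 0.
Proof.
move=> [sX cX]; have X0 : X 0 by case: sX.
pose S : set R := [set nr (x - y) ^+ 2 | y in X].
have hS : has_inf S.
  split; first by exists (nr (x - 0) ^+ 2), 0.
  by exists 0 => _ [y _ <-]; exact: sqr_ge0.
have lb y : X y -> inf S <= nr (x - y) ^+ 2.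
  by move=> yX; apply: ge_inf; [case: hS | exists y].
have approx (n : nat) : exists y, X y /\ nr (x - y) ^+ 2 < inf S + n.+1%:R^-1.
  have e0 : 0 < n.+1%:R^-1 :> R by rewrite invr_gt0 ltr0n.
  by have [_ [y yX <-] h] := inf_adherent e0 hS; exists y.
have [u hu] := choice approx.
(* Variational inequality with slack [e]: the best correction of [y] along [w] cannot undercut the
   infimum, so an approximate minimizer leaves an almost orthogonal residual. *)
have near y e w : X y -> X w -> 0 <= e -> nr (x - y) ^+ 2 <= inf S + e ->
    ip w (x - y) ^+ 2 <= e * nr w ^+ 2.
  move=> yX wX e0 hy; have [->|w0] := eqVneq w 0.
    by rewrite ip0l nr0 !expr0n /= mulr0.
  have wp := exprn_gt0 2 (nr_gt0 w0).
  have := lb (y + (ip w (x - y) / nr w ^+ 2) *: w) (subspD sX yX (subspZ _ sX wX)).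
  rewrite opprD addrA nr_sqB nrZ ipZr exprMn real_normK ?num_real // (ipC (x - y)).
  set p := ip _ _; set q := nr w ^+ 2 in wp *; move=> h.
  have : p ^+ 2 / q <= e.
    have -> : p ^+ 2 / q = 2 * (p / q * p) - (p / q) ^+ 2 * q by field; rewrite gt_eqF.
    by lra.
  by rewrite ler_pdivrMr.
have cauchyu e : 0 < e -> exists N, forall m n, (N <= m)%N -> (N <= n)%N ->
    Num.sqrt (ip (u m - u n) (u m - u n)) <= e.
  move=> e0; have e4 : 0 < e ^+ 2 / 4 by rewrite divr_gt0 ?exprn_gt0.
  have [N hN] := inv_small e4.
  exists N => m n Nm Nn; rewrite -/(nr _) nr_leP ?ltW // -nrE.
  have [[mX hm] [nX hn]] := (hu m, hu n).
  (* The midpoint competes for the infimum too; the parallelogram law then makes [u] a Cauchy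
     sequence. *)
  have := lb (2^-1 *: (u m + u n)) (subspZ _ sX (subspD sX mX nX)).
  have -> : x - 2^-1 *: (u m + u n) = 2^-1 *: ((x - u m) + (x - u n)).
    rewrite addrACA -opprD scalerBr; congr (_ - _).
    by rewrite -[x + x]mulr2n -(scaler_nat 2 x) scalerA mulVf ?pnatr_eq0 // scale1r.
  rewrite nrZ exprMn nr_sqD ger0_norm ?invr_ge0 //.
  have -> : u m - u n = (x - u n) - (x - u m) by rewrite opprB [RHS]addrC addrA subrK.
  rewrite [nr (_ - (x - u m)) ^+ 2]nr_sqB (ipC (x - u n)).
  have := hN _ Nm; have := hN _ Nn; move: hm hn.
  by move: (m.+1%:R^-1) (n.+1%:R^-1) => a b; lra.
have [l hl] := ip_complete u cauchyu.
exists l.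
  by apply: cX => e /hl [N /(_ N (leqnn N))] h; exists (u N);
    [case: (hu N) | rewrite nrBC].
move=> w wX; apply: eq0_eps => e e0.
have w1 : 0 < 2 * (nr w + 1) by rewrite mulr_gt0 // ltr_wpDl // nr_ge0.
have d0 : 0 < e / (2 * (nr w + 1)) by rewrite divr_gt0.
have [N1 h1] := hl _ d0.
have [N2 h2] := inv_small (exprn_gt0 2 d0).
pose n := maxn N1 N2; have [nX hn] := hu n.
have : ip w (x - u n) ^+ 2 <= (e / (2 * (nr w + 1)) * nr w) ^+ 2.
  rewrite exprMn; apply: near => //; first by rewrite exprn_ge0 // ltW.
  by apply: le_trans (ltW hn) _; rewrite lerD2l h2 // leq_maxr.
set d := e / _ in d0 h1 *.
have ed : e = d * (2 * (nr w + 1)) by rewrite /d divfK // gt_eqF.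
have dw : 0 <= d * nr w by rewrite mulr_ge0 ?nr_ge0 ?ltW.
move=> h; have a1 : `|ip w (x - u n)| <= d * nr w.
  by rewrite -ler_sqr ?nnegrE // real_normK ?num_real.
have -> : ip w (x - l) = ip w (x - u n) + ip w (u n - l) by rewrite -ipDr addrA subrK.
apply: le_trans (ler_normD _ _) _.
have := le_trans (cauchy w (u n - l)) (ler_wpM2l (nr_ge0 w) (h1 n (leq_maxl _ _))).
by move: a1 (nr_ge0 w); rewrite ed; nra.
Qed.

Section ProjTheory.
Variables (X : set V) (cX : csub X).
Let sX : subsp X. Proof. by case: cX. Qed.

Lemma projP x : X (proj X x) /\ forall w, X w -> ip w (x - proj X x) = 0.
Proof. by have [y yX h] := proj_exists x cX; rewrite (proj_unique sX yX h). Qed.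

Lemma projX x : X (proj X x). Proof. by case: (projP x). Qed.

Lemma proj_orth x w : X w -> ip w (x - proj X x) = 0.
Proof. by case: (projP x) => _; apply. Qed.

Lemma proj_id x : X x -> proj X x = x.
Proof. by move=> xX; apply: proj_unique => // w _; rewrite subrr ip0r. Qed.

Lemma projD x y : proj X (x + y) = proj X x + proj X y.
Proof.
apply: proj_unique => //; first by apply: subspD => //; exact: projX.
by move=> w wX; rewrite opprD addrACA ipDr !proj_orth // addr0.
Qed.

Lemma projZ a x : proj X (a *: x) = a *: proj X x.
Proof.
apply: proj_unique => //; first by apply: subspZ => //; exact: projX.
by move=> w wX; rewrite -scalerBr ipZr proj_orth // mulr0.
Qed.

Lemma projB x y : proj X (x - y) = proj X x - proj X y.
Proof. by rewrite -scaleN1r projD projZ scaleN1r. Qed.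

Lemma proj0 : proj X 0 = 0.
Proof. by apply: proj_id; case: sX. Qed.

Lemma proj_sum (I : Type) (r : seq I) (P : pred I) (F : I -> V) :
  proj X (\sum_(i <- r | P i) F i) = \sum_(i <- r | P i) proj X (F i).
Proof. by elim/big_rec2: _ => [|i a b _ <-]; rewrite ?proj0 ?projD. Qed.

Lemma proj_sym x y : ip (proj X x) y = ip x (proj X y).
Proof.
have := proj_orth y (projX x); have := proj_orth x (projX y).
by rewrite !ipBr (ipC (proj X y)); move=> /subr0_eq -> /subr0_eq ->; rewrite ipC.
Qed.

Lemma proj_ipl x y : X y -> ip (proj X x) y = ip x y.
Proof. by move=> yX; rewrite proj_sym proj_id. Qed.

Lemma proj_pythag x : nr x ^+ 2 = nr (proj X x) ^+ 2 + nr (x - proj X x) ^+ 2.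
Proof. rewrite -pythag ?proj_orth //; last exact: projX.
by rewrite addrC subrK. Qed.

Lemma proj_le x : nr (proj X x) <= nr x.
Proof.
by rewrite -ler_sqr ?nnegrE ?nr_ge0 // (proj_pythag x) lerDl sqr_ge0.
Qed.

Lemma proj_dist x y : X y -> nr (x - proj X x) <= nr (x - y).
Proof.
move=> yX; rewrite -ler_sqr ?nnegrE ?nr_ge0 //.
have -> : x - y = (x - proj X x) + (proj X x - y) by rewrite addrA subrK.
rewrite [leRHS]pythag; first by rewrite lerDl sqr_ge0.
by rewrite ipC proj_orth //; apply: subspB => //; exact: projX.
Qed.

Lemma proj_lip x y : nr (proj X x - proj X y) <= nr (x - y).
Proof. by rewrite -projB proj_le. Qed.

Lemma ip_res x : ip (x - proj X x) x = nr (x - proj X x) ^+ 2.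
Proof.
rewrite -{3}[x](subrK (proj X x)) ipDr (ipC _ (proj X x)) proj_orth ?addr0 ?nrE //.
exact: projX.
Qed.

Lemma orthooK : ortho (ortho X) = X.
Proof.
apply/seteqP; split; last exact: subset_orthoo.
move=> x h; have hx : ortho X (x - proj X x) by move=> w wX; exact: proj_orth.
have := h _ hx; rewrite ip_res => /eqP; rewrite sqrf_eq0 => /eqP/nr_eq0/eqP.
by rewrite subr_eq0 => /eqP ->; exact: projX.
Qed.

Lemma proj_ortho0 x : ortho X x -> proj X x = 0.
Proof. by move=> h; apply: proj_unique => //; [case: sX | move=> w wX; rewrite subr0 h]. Qed.

End ProjTheory.

End Projection.

(** * Finite orthonormal lists and finite-dimensional subspaces *)

Section FiniteDim.
Variables (R : realType) (V : innerType R).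
Implicit Types (x y z : V) (a e : R) (X : set V) (g D G : seq V).

Fixpoint ON g : Prop :=
  if g is y :: g' then [/\ ip y y = 1, forall z, z \in g' -> ip y z = 0 & ON g'] else True.

(** For an orthonormal [g] this is the orthogonal projection onto its span, available without
    completeness. *)
Definition Eproj g x : V := \sum_(y <- g) ip x y *: y.

Lemma Eproj_nil x : Eproj [::] x = 0. Proof. exact: big_nil. Qed.

Lemma Eproj_cons y g x : Eproj (y :: g) x = ip x y *: y + Eproj g x.
Proof. exact: big_cons. Qed.

Lemma Eproj_ip g x z : (forall y, y \in g -> ip z y = 0) -> ip z (Eproj g x) = 0.
Proof.
move=> h; rewrite ip_sumr big_seq big1 // => y yg.
by rewrite ipZr h // mulr0.
Qed.

Lemma Eproj_orth g x z : ON g -> z \in g -> ip z (x - Eproj g x) = 0.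
Proof.
elim: g => // y g IH [yy yg ong]; rewrite inE Eproj_cons => /orP[/eqP ->|zg].
  by rewrite ipBr ipDr ipZr yy mulr1 Eproj_ip // addr0 (ipC y) subrr.
rewrite opprD addrCA ipDr IH // addr0 ipNr ipZr (ipC z) yg // mulr0 oppr0 //.
Qed.

Lemma Eproj_sym g x y : ip (Eproj g x) y = ip x (Eproj g y).
Proof.
rewrite ip_suml ip_sumr; apply: eq_bigr => z _.
by rewrite ipZl ipZr mulrC (ipC y).
Qed.

Lemma EprojZD g a x y : Eproj g (a *: x + y) = a *: Eproj g x + Eproj g y.
Proof.
rewrite scaler_sumr -big_split /=; apply: eq_bigr => z _.
by rewrite ipDl ipZl scalerDl scalerA.
Qed.

Fixpoint Span D : set V :=
  if D is d :: D' then [set x | exists c, Span D' (x - c *: d)] else [set 0].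

Lemma subsp_Span D : subsp (Span D).
Proof.
elim: D => [|d D [IH0 IH]] /=.
  by split=> // a x y -> ->; rewrite scaler0 addr0.
split; first by exists 0; rewrite scale0r subr0.
move=> a x y [c hc] [c' hc']; exists (a * c + c').
have -> : a *: x + y - (a * c + c') *: d = a *: (x - c *: d) + (y - c' *: d).
  by rewrite scalerBr scalerDl scalerA opprD addrACA.
exact: IH.
Qed.

Lemma SpanD D x y : Span D x -> Span D y -> Span D (x + y).
Proof. exact: (subspD (subsp_Span D)). Qed.

Lemma SpanZ D a x : Span D x -> Span D (a *: x).
Proof. exact: (subspZ a (subsp_Span D)). Qed.

Lemma SpanB D x y : Span D x -> Span D y -> Span D (x - y).
Proof. exact: (subspB (subsp_Span D)). Qed.

Lemma mem_Span D d : d \in D -> Span D d.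
Proof.
elim: D => // d' D IH; rewrite inE => /orP[/eqP ->|dD] /=.
  by exists 1; rewrite scale1r subrr; case: (subsp_Span D).
by exists 0; rewrite scale0r subr0; exact: IH.
Qed.

Lemma Span_min D X : subsp X -> (forall d, d \in D -> X d) -> Span D `<=` X.
Proof.
move=> sX; elim: D => [_ x -> | d D IH h x [c hx]]; first by case: sX.
rewrite -[x](subrK (c *: d)); apply: (subspD sX).
  by apply: IH => // d' d'D; apply: h; rewrite inE d'D orbT.
by apply: (subspZ c sX); apply: h; rewrite inE eqxx.
Qed.

Lemma Span_Eproj G x : Span G (Eproj G x).
Proof.
rewrite /Eproj big_seq; apply: subsp_sum; first exact: subsp_Span.
by move=> y yG; exact/SpanZ/mem_Span.
Qed.

Lemma Span_ortho0 G x : Span G x -> (forall y, y \in G -> ip y x = 0) -> x = 0.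
Proof.
move=> hx h; apply: ip_eq0; have : ortho [set x] x; last exact.
apply: (@Span_min G (ortho [set x])) hx; first by case: (csub_ortho [set x]).
by move=> d dG _ ->; rewrite ipC h.
Qed.

Lemma Span_ONE G x : ON G -> Span G x -> Eproj G x = x.
Proof.
move=> onG hx; apply/eqP; rewrite eq_sym -subr_eq0; apply/eqP.
apply: (@Span_ortho0 G); last by move=> y; exact: Eproj_orth.
exact/SpanB/Span_Eproj.
Qed.

Lemma gram_schmidt D : exists2 G, ON G & Span D = Span G.
Proof.
elim: D => [|d D [G onG eG]]; first by exists [::].
pose q := d - Eproj G d.
have Gq y : y \in G -> ip y q = 0 by move=> yG; exact: Eproj_orth.
have Gd : Span G (d - q) by rewrite /q opprB addrC subrK; exact: Span_Eproj.
have [q0|q0] := eqVneq q 0.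
  exists G => //; apply/seteqP; split; last first.
    by move=> x; rewrite -eG => hx; exists 0; rewrite scale0r subr0.
  rewrite -eG => x [c] hx; rewrite -[x](subrK (c *: d)).
  by move: Gd; rewrite q0 subr0 -eG => Gd; apply: SpanD => //; exact: SpanZ.
pose p := (nr q)^-1 *: q; have qp : q = nr q *: p.
  by rewrite /p scalerA mulfV ?scale1r // gt_eqF // nr_gt0.
exists (p :: G).
  by split=> //; [exact: unitize | move=> z zG; rewrite /p ipZl ipC Gq // mulr0].
apply/seteqP; split; (apply: Span_min; first exact: subsp_Span) => y;
    rewrite inE => /orP[/eqP ->|yD].
- exists (nr q); rewrite -qp.
  exact: Gd.
- have : Span G y by rewrite -eG; exact: mem_Span.
  by move=> h; exists 0; rewrite scale0r subr0.
- rewrite /p; apply: (@SpanZ (d :: D)).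
  by exists 1; rewrite scale1r /q addrC addKr -scaleN1r;
    apply: SpanZ; rewrite eG; exact: Span_Eproj.
- have : Span D y by rewrite eG; exact: mem_Span.
  by move=> h; exists 0; rewrite scale0r subr0.
Qed.

Lemma csub_Span D : csub (Span D).
Proof.
split; first exact: subsp_Span.
have [G onG ->] := gram_schmidt D.
move=> l hl; suff -> : l = Eproj G l by exact: Span_Eproj.
apply/eqP; rewrite -subr_eq0; apply/eqP/ip_eq0.
set z := l - Eproj G l.
have zG y : Span G y -> ip z y = 0.
  move=> hy; suff : ortho [set z] y by apply.
  apply: (@Span_min G (ortho [set z])) hy.
    by case: (csub_ortho [set z]).
  by move=> d dG _ ->; rewrite ipC; exact: Eproj_orth.
by rewrite {2}/z ipBr (zG (Eproj G l)) ?subr0; [apply: adherent_ip0 => e /hl [y yG ?];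
  exists y => //; exact: zG | exact: Span_Eproj].
Qed.

(** Induction on [D]: modulo [Span D] the space [X] has dimension at most one, so a single vector of
    [X] outside [Span D], if there is one, completes a generating list of the intersection. *)
Lemma fdsub X D : subsp X -> X `<=` Span D -> exists D', X = Span D'.
Proof.
elim: D X => [|d D IH] X sX XD.
  exists [::]; apply/seteqP; split => // x -> ; by case: sX.
pose X' := X `&` Span D.
have sX' : subsp X'.
  split; first by split; [case: sX | case: (subsp_Span D)].
  move=> a x y [xX xD] [yX yD].
  by split; [case: sX => _; apply | case: (subsp_Span D) => _; apply].
have [D' eD'] := IH X' sX' (@subIsetr _ _ _).
have [XsD|] := pselect (X `<=` Span D).
  by exists D'; rewrite -eD' /X' setIidl.
move/existsNP => [x0 /not_implyP [x0X x0D]].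
have [c hc] := XD _ x0X.
have c0 : c != 0 by apply/eqP => c0; apply: x0D; move: hc; rewrite c0 scale0r subr0.
exists (x0 :: D'); apply/seteqP; split; last first.
  apply: Span_min => // y; rewrite inE => /orP[/eqP -> //|yD'].
  by have : X' y; [rewrite eD'; exact: mem_Span | case].
move=> x xX; have [c' hc'] := XD _ xX.
exists (c' / c); rewrite -eD'; split; first exact: (subspB sX xX (subspZ (c' / c) sX x0X)).
have -> : x - (c' / c) *: x0 = (x - c' *: d) - (c' / c) *: (x0 - c *: d).
  by rewrite scalerBr scalerA divfK // opprB addrA subrK.
by apply: SpanB => //; exact: SpanZ.
Qed.

Lemma fdsub_closed X D : subsp X -> X `<=` Span D -> csub X.
Proof. by move=> sX /(fdsub sX)[D' ->]; exact: csub_Span. Qed.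

End FiniteDim.

(** A vector of [X] orthogonal to the projections of [D] to [X] is orthogonal to [D] itself, hence
    zero. *)
Lemma fd_of_orth (R : realType) (V : hilbertType R) (X : set V) (D : seq V) :
  csub X -> (forall x, X x -> (forall d, d \in D -> ip d x = 0) -> x = 0) ->
  X = Span [seq proj X d | d <- D].
Proof.
move=> cX h; set S := Span _; have cS : csub S by exact: csub_Span.
have SX : S `<=` X.
  by apply: Span_min; [case: cX | move=> _ /mapP [d _ ->]; exact: projX].
apply/seteqP; split => // x xX.
suff : x - proj S x = 0 by move/eqP; rewrite subr_eq0 => /eqP ->; exact: projX.
have yX : X (x - proj S x) by exact: (subspB cX.1 xX (SX _ (projX cS x))).
apply: h => // d dD; rewrite -(proj_id cX yX) -proj_sym // proj_orth //.
by apply: mem_Span; apply: map_f.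
Qed.

(** * Linear regularity *)

Section Compactness.
Variables (R : realType) (V : innerType R).
Implicit Types (x y z : V) (a e : R).

Definition converges (u : nat -> V) (l : V) :=
  forall e : R, 0 < e -> exists N, forall n, (N <= n)%N -> nr (u n - l) <= e.

Lemma bolzano_weierstrass (a : nat -> R) (C : R) : (forall n, `|a n| <= C) ->
  exists (phi : nat -> nat) (l : R), (forall n, n <= phi n)%N /\
    forall e, 0 < e -> exists N, forall n, (N <= n)%N -> `|a (phi n) - l| <= e.
Proof.
move=> aC; pose S : set R := [set x | exists N, forall n, (N <= n)%N -> a n <= x].
have hS : has_inf S.
  split; first by exists C, 0 => n _; exact: le_trans (ler_norm _) (aC n).
  exists (- C) => x [N h]; apply: le_trans (h N (leqnn N)).
  by have := aC N; rewrite ler_norml => /andP[].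
have cl e N : 0 < e -> exists n, (N <= n)%N /\ `|a n - inf S| <= e.
  move=> e0; have [x [M hM] xe] := inf_adherent e0 hS.
  have : ~ S (inf S - e).
    by move=> h; have := ge_inf (proj2 hS) h; lra.
  move/forallNP/(_ (maxn N M))/existsNP => [n /not_implyP [hn /negP]].
  rewrite -ltNge => lo; move: hn; rewrite geq_max => /andP[Nn Mn].
  exists n; split => //; rewrite ler_norml.
  by have := hM n Mn; lra.
have pos n : 0 < n.+1%:R^-1 :> R by rewrite invr_gt0 ltr0n.
have [phi hphi] := choice (fun n => cl n.+1%:R^-1 n (pos n)).
exists phi, (inf S); split => [n|e /inv_small [N hN]]; first by case: (hphi n).
by exists N => n /hN h; apply: le_trans h; case: (hphi n).
Qed.

Lemma Eproj_cluster (g : seq V) (u : nat -> V) (C : R) : (forall n, nr (u n) <= C) ->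
  exists (phi : nat -> nat) w, (forall n, n <= phi n)%N /\
    forall e, 0 < e -> exists N, forall n, (N <= n)%N -> nr (Eproj g (u (phi n)) - w) <= e.
Proof.
elim: g u => [|y g IH] u uC.
  exists id, 0; split=> // e e0; exists 0%N => n _.
  by rewrite Eproj_nil subr0 nr0 ltW.
have bnd n : `|ip (u n) y| <= C * nr y.
  by apply: le_trans (cauchy _ _) _; rewrite ler_wpM2r ?nr_ge0.
have [psi [l [hpsi hl]]] := bolzano_weierstrass bnd.
have [phi [w [hphi hw]]] := IH (u \o psi) (fun n => uC (psi n)).
exists (psi \o phi), (l *: y + w); split=> [n|e e0].
  exact: leq_trans (hphi n) (hpsi _).
have e2 : 0 < e / 2 by rewrite divr_gt0.
have e3 : 0 < e / 2 / (nr y + 1) by rewrite divr_gt0 // ltr_wpDl // nr_ge0.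
have [N1 h1] := hl _ e3; have [N2 h2] := hw _ e2.
exists (maxn N1 N2) => n; rewrite geq_max => /andP[n1 n2] /=.
rewrite Eproj_cons opprD addrACA -scalerBl.
apply: le_trans (nrD _ _) _; rewrite nrZ.
have := h2 n n2; have := h1 _ (leq_trans n1 (hphi n)).
have y1 : 0 < nr y + 1 by rewrite ltr_wpDl // nr_ge0.
rewrite ler_pdivlMr // /=; have := nr_ge0 y.
by have := normr_ge0 (ip (u (psi (phi n))) y - l); nra.
Qed.

End Compactness.

(** * Uniform boundedness *)

Section UniformBoundedness.
Variables (R : realType) (V : hilbertType R).

(* Gliding hump: the signs are chosen so that the [n]-th step alone makes
   [ip (v n) _] large, and the later steps are too short to undo this. *)
Lemma gliding_hump (v : nat -> V) :
  (forall n, 4 * n%:R * 3 ^+ n <= nr (v n)) ->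
  (forall n, v n != 0) ->
  exists x, forall n, n%:R <= `|ip (v n) x|.
Proof.
move=> hv v0.
pose st n y : V := y + ((if 0 <= ip (v n) y then 1 else -1) / 3 ^+ n / nr (v n)) *: v n.
pose x n := nat_rect (fun _ => V) 0 (fun n y => st n y) n.
have t0 n : 0 < (3 : R) ^+ n by rewrite exprn_gt0.
have big n : nr (v n) / 3 ^+ n <= `|ip (v n) (x n.+1)|.
  rewrite /= -/(x n) /st ipDr ipZr -nrE; have vp := nr_gt0 (v0 n).
  have -> (s : R) : s / 3 ^+ n / nr (v n) * nr (v n) ^+ 2 = s * (nr (v n) / 3 ^+ n).
    by field; rewrite !gt_eqF.
  have q0 : 0 < nr (v n) / 3 ^+ n by rewrite divr_gt0.
  case: ifP => [h|/negbT]; rewrite ?mul1r ?mulN1r.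
    by rewrite ger0_norm; lra.
  by rewrite -ltNge => h; rewrite ltr0_norm; lra.
have step n : nr (x n.+1 - x n) <= (3 ^+ n)^-1.
  rewrite /= -/(x n) /st addrC addKr nrZ !normrM normfV.
  have -> : `|if 0 <= ip (v n) (x n) then 1 else -1| = 1 :> R.
    by case: ifP; rewrite ?normrN normr1.
  rewrite mul1r (normfV (nr _)) (ger0_norm (nr_ge0 _)) (ger0_norm (ltW (t0 n))).
  by rewrite divfK ?gt_eqF ?nr_gt0.
have dist m n : (n <= m)%N -> nr (x m - x n) <= 3 / 2 * ((3 ^+ n)^-1 - (3 ^+ m)^-1).
  elim: m => [|m IH]; first by rewrite leqn0 => /eqP ->; rewrite !subrr nr0 mulr0.
  rewrite leq_eqVlt => /orP[/eqP ->|]; first by rewrite !subrr nr0 mulr0.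
  rewrite ltnS => /IH h; apply: le_trans (nr_tri (x m) _ _) _.
  have -> : (3 ^+ m.+1)^-1 = 3^-1 * (3 ^+ m)^-1 :> R by rewrite exprS invfM.
  have := step m; have : 0 < (3 ^+ m)^-1 :> R by rewrite invr_gt0.
  by lra.
have dist' m n : (n <= m)%N -> nr (x m - x n) <= 3 / 2 * (3 ^+ n)^-1.
  move=> /dist h; apply: le_trans h _.
  by have : 0 < (3 ^+ m)^-1 :> R; [by rewrite invr_gt0|]; lra.
have small e : 0 < e -> exists N, forall n, (N <= n)%N -> (3 ^+ n)^-1 <= e :> R.
  move=> /inv_small [N hN]; exists N => n /hN h; apply: le_trans h.
  rewrite lef_pV2 ?posrE ?ltr0n // -natrX ler_nat.
  by rewrite ltn_expl.
have [l hl] : exists l, converges x l.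
  apply: ip_complete => e e0.
  have [N hN] := small (e / 3) (divr_gt0 e0 (ltr0n _ 3)).
  exists N => m n Nm Nn; rewrite -/(nr _).
  apply: le_trans (nr_tri (x N) _ _) _; rewrite (nrBC (x N)).
  have := dist' _ _ Nm; have := dist' _ _ Nn; have := hN _ (leqnn N); lra.
(* At [n.+1] this is half the length of the [n]-th step, so at least half of the [n]-th hump
   survives in the limit. *)
have lim n : nr (l - x n) <= 3 / 2 * (3 ^+ n)^-1.
  apply/ler_addgt0Pr => e /hl [N hN].
  apply: le_trans (nr_tri (x (maxn N n)) _ _) _; rewrite addrC lerD //.
    by apply: dist'; rewrite leq_maxr.
  by rewrite nrBC hN // leq_maxl.
exists l => n; have -> : l = x n.+1 + (l - x n.+1) by rewrite addrC subrK.
rewrite ipDr; have := le_trans (cauchy (v n) (l - x n.+1)) (ler_wpM2l (nr_ge0 _) (lim n.+1)).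
have := big n; have := hv n; rewrite exprS invfM.
set p := ip (v n) (x n.+1); set r := ip _ (l - _); set k := 3 ^+ n.
have k0 : 0 < k by exact: t0.
have -> : 3 / 2 * (3^-1 * k^-1) = 2^-1 * k^-1 :> R by field; rewrite gt_eqF.
move=> h1 h2 h3.
have h4 : 4 * n%:R <= nr (v n) / k by rewrite ler_pdivlMr.
have := ler_normD (p + r) (- r); rewrite addrK normrN.
have n0 : 0 <= n%:R :> R by [].
lra.
Qed.

End UniformBoundedness.

Section Regularity.
Variables (R : realType) (V : hilbertType R) (I : finType) (L : I -> set V).
Hypothesis cL : forall i, csub (L i).
Implicit Types (x y z : V) (a e : R) (A : {set I}).

Definition meet A : set V := [set x | forall i, i \in A -> L i x].

Definition osum A : set V :=
  [set y | exists2 v : I -> V, forall i, i \in A -> ortho (L i) (v i) &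
    y = \sum_(i in A) v i].

Definition approx_meet A := forall (D : seq V) e, 0 < e ->
  exists x, [/\ ip x x = 1, forall d, d \in D -> ip d x = 0 &
    forall i, i \in A -> nr (x - proj (L i) x) <= e].

Lemma csub_meet A : csub (meet A).
Proof.
split; first split; first by move=> i _; case: (cL i) => -[].
  move=> a x y hx hy i iA; case: (cL i) => -[_ h] _.
  by apply: h; [exact: hx | exact: hy].
move=> l h i iA; case: (cL i) => _; apply=> e /h [x hx lx].
by exists x => //; exact: hx.
Qed.

Lemma subsp_osum A : subsp (osum A).
Proof.
have sO i : subsp (ortho (L i)) by case: (csub_ortho (L i)).
split; first by exists (fun=> 0); [move=> i _; case: (sO i) | rewrite big1].
move=> a x y [v hv ->] [w hw ->]; exists (fun i => a *: v i + w i).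
  by move=> i iA; case: (sO i) => _ h; apply: h; [exact: hv | exact: hw].
by rewrite scaler_sumr -big_split.
Qed.

(** If no constant works, there are vectors orthogonal to [meet A] with residual sum one and norms
    as large as desired. Since [osum A] is closed, every [x] splits into a vector of [meet A] and
    vectors [m i] orthogonal to the [L i]; only the residuals pair with the [m i], so all inner
    products with [x] are bounded, against [gliding_hump]. *)
Lemma regular A : adh_closed (osum A) ->
  exists2 C, 0 < C & forall x, nr (x - proj (meet A) x) <=
    C * \sum_(i in A) nr (x - proj (L i) x).
Proof.
move=> cM; have cZ := csub_meet A.
have cO : csub (osum A) by split; [exact: subsp_osum | ].
apply: contrapT => /forall2NP hn.
(* The growth required by [gliding_hump], plus one to stay positive at [n = 0]. *)
pose C (n : nat) : R := 4 * n%:R * 3 ^+ n + 1.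
have C0 n : 0 < C n by rewrite ltr_wpDl // !mulr_ge0 // exprn_ge0.
pose res x := \sum_(i in A) nr (x - proj (L i) x).
have ex n : exists v, [/\ ortho (meet A) v, res v = 1 & C n <= nr v].
  have [/(_ (C0 n)) //|/existsNP [x /negP]] := hn (C n).
  rewrite -ltNge; set y := x - _ => hy.
  have Zx i : i \in A -> L i (proj (meet A) x) by exact: (projX cZ x).
  have Zy : ortho (meet A) y by move=> w wZ; exact: proj_orth.
  have ey : res y = \sum_(i in A) nr (x - proj (L i) x).
    apply: eq_bigr => i iA; rewrite projB // (proj_id (cL i) (Zx i iA)).
    by rewrite opprB addrA subrK.
  rewrite -ey in hy.
  have r0 : 0 <= res y by apply: sumr_ge0 => i _; exact: nr_ge0.
  have rn0 : res y != 0.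
    apply/eqP => r00; move: hy; rewrite r00 mulr0 => hy.
    suff y0 : y = 0 by move: hy; rewrite y0 nr0 ltxx.
    apply: ip_eq0; apply: Zy => i iA.
    have : nr (y - proj (L i) y) = 0.
      by apply: (psumr_eq0P _ r00) => // j _; exact: nr_ge0.
    by move/nr_eq0/eqP; rewrite subr_eq0 => /eqP ->; exact: projX.
  have rp : 0 < res y by rewrite lt_def rn0.
  exists ((res y)^-1 *: y); split.
  - by move=> w wZ; rewrite ipZr Zy // mulr0.
  - rewrite /res; under eq_bigr => i _ do
      rewrite projZ // -scalerBr nrZ ger0_norm ?invr_ge0 //.
    by rewrite -mulr_sumr mulVf.
  - by rewrite nrZ ger0_norm ?invr_ge0 // mulrC ler_pdivlMr // ltW.
have [v hv] := choice ex.
have [x hx] : exists x, forall n, n%:R <= `|ip (v n) x|.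
  apply: gliding_hump => n; have [_ _] := hv n; rewrite /C.
    by apply: le_trans; rewrite lerDl.
  by apply: contraTneq => ->; rewrite nr0 -ltNge C0.
have [m hm em] := projX cO x.
pose K := \sum_(i in A) nr (m i).
have xm : meet A (x - proj (osum A) x).
  move=> i iA; rewrite -(orthooK (cL i)) => w hw.
  apply: proj_orth => //; exists (fun j => if j == i then w else 0).
    by move=> j _; case: eqP => [-> //|_]; case: (csub_ortho (L j)) => -[].
  by rewrite (bigD1 i) //= eqxx big1 ?addr0 // => j /andP[_ /negbTE ->].
have bound n : `|ip (v n) x| <= K.
  have [hZ r1 _] := hv n.
  rewrite -[x](subrK (proj (osum A) x)) ipDr (ipC (v n)) hZ // add0r em ip_sumr.
  apply: le_trans (ler_norm_sum _ _ _) _; apply: ler_sum => i iA.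
  have -> : ip (v n) (m i) = ip (v n - proj (L i) (v n)) (m i).
    by rewrite ipBl [X in _ = _ - X](hm i iA) ?subr0 //; exact: (projX (cL i)).
  apply: le_trans (cauchy _ _) _; rewrite -[leRHS]mul1r ler_wpM2r ?nr_ge0 //.
  by rewrite -r1 /res (bigD1 i) //= lerDl sumr_ge0 // => j _; exact: nr_ge0.
have := le_trans (hx (Num.truncn K).+1) (bound _).
by rewrite leNgt truncnS_gt.
Qed.

(** Regularity brings the approaching terms close to their projections onto the finite-dimensional
    [meet A], where bounded sequences have cluster points. *)
Lemma cofinal_cluster A (D : seq V) (u : nat -> V) (C : R) :
  adh_closed (osum A) -> meet A = Span D -> (forall n, nr (u n) <= C) ->
  (forall e N, 0 < e -> exists2 n, (N <= n)%N &
     forall i, i \in A -> nr (u n - proj (L i) (u n)) <= e) ->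
  exists w, forall e N, 0 < e -> exists2 n, (N <= n)%N & nr (u n - w) <= e.
Proof.
move=> cM eZ uC happ; have [K K0 reg] := regular cM.
have cZ := csub_meet A.
pose c : R := K * #|A|%:R + 1.
have c0 : 0 < c by rewrite ltr_wpDl // mulr_ge0 // ltW.
have near e N : 0 < e -> exists n, (N <= n)%N /\ nr (u n - proj (meet A) (u n)) <= e.
  move=> e0; have [n Nn hn] := happ (e / c) N (divr_gt0 e0 c0).
  exists n; split => //; apply: le_trans (reg _) _.
  apply: le_trans (_ : K * (#|A|%:R * (e / c)) <= _).
    rewrite ler_wpM2l ?(ltW K0) // mulr_natl -sumr_const.
    by apply: ler_sum => i iA; exact: hn.
  have -> : K * (#|A|%:R * (e / c)) = (K * #|A|%:R / c) * e by field; rewrite gt_eqF.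
  by rewrite -[leRHS]mul1r ler_wpM2r ?(ltW e0) // ler_pdivrMr // mul1r /c lerDl.
have pos n : 0 < n.+1%:R^-1 :> R by rewrite invr_gt0 ltr0n.
have [t ht] := choice (fun n => near n.+1%:R^-1 n (pos n)).
have [G onG eG] := gram_schmidt D.
have bnd n : nr (proj (meet A) (u (t n))) <= C.
  exact: le_trans (proj_le cZ _) (uC _).
have [phi [w [hphi hw]]] := Eproj_cluster G bnd.
exists w => e N e0; have e2 : 0 < e / 2 by rewrite divr_gt0.
have [N1 h1] := hw _ e2; have [N2 h2] := inv_small e2.
pose n := maxn N (maxn N1 N2).
have n1 : (N1 <= n)%N by rewrite !leq_max leqnn orbT.
have n2 : (N2 <= phi n)%N by apply: leq_trans (hphi n); rewrite !leq_max leqnn !orbT.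
have [h3 h4] := ht (phi n).
exists (t (phi n)).
  by apply: leq_trans h3; apply: leq_trans (hphi n); rewrite leq_max leqnn.
apply: le_trans (nr_tri (proj (meet A) (u (t (phi n)))) _ _) _.
have := h1 n n1; rewrite Span_ONE //; last by rewrite -eG -eZ; exact: projX.
by have := le_trans h4 (h2 _ n2); lra.
Qed.

(** The operator [S], the sum of the complementary projections, is positive and is coercive on the
    orthogonal complement [N] of the finite list [D]. Hence the image [B] of [N] is closed, and its
    orthogonal complement meets [N] only in zero, so it is finite-dimensional. As [osum A] contains
    [B], it is [B] plus a finite-dimensional space and therefore closed. The kernel of [S] is
    [meet A], which also meets [N] only in zero. *)
Lemma meet_osum_of_not_approx A : ~ approx_meet A ->
  (exists D, meet A = Span D) /\ adh_closed (osum A).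
Proof.
move=> /existsNP [D] /existsNP [e] /not_implyP [e0] /forallNP hn.
pose S x := \sum_(i in A) (x - proj (L i) x).
have SZD a x y : S (a *: x + y) = a *: S x + S y.
  rewrite scaler_sumr -big_split; apply: eq_bigr => i _ /=.
  by rewrite projD // projZ // scalerBr opprD addrACA.
have SB x y : S (x - y) = S x - S y.
  by rewrite addrC -scaleN1r SZD scaleN1r addrC.
have Sx x : ip (S x) x = \sum_(i in A) nr (x - proj (L i) x) ^+ 2.
  by rewrite ip_suml; apply: eq_bigr => i _; rewrite ip_res.
have Ssym x y : ip (S x) y = ip x (S y).
  rewrite ip_suml ip_sumr; apply: eq_bigr => i _.
  by rewrite ipBl ipBr proj_sym.
have Sle x : nr (S x) <= #|A|%:R * nr x.
  apply: le_trans (nr_sum _ _ _) _; rewrite mulr_natl -sumr_const.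
  apply: ler_sum => i _; rewrite -ler_sqr ?nnegrE ?nr_ge0 //.
  by rewrite (proj_pythag (cL i) x) lerDr sqr_ge0.
pose N : set V := [set x | forall d, d \in D -> ip d x = 0].
have coer x : N x -> e ^+ 2 * nr x ^+ 2 <= ip (S x) x.
  move=> xN; rewrite Sx; have [->|x0] := eqVneq x 0.
    by rewrite nr0 expr0n mulr0 sumr_ge0 // => i _; exact: sqr_ge0.
  have xp := nr_gt0 x0.
  have [i iA hi] : exists2 i, i \in A & e * nr x <= nr (x - proj (L i) x).
    apply: contrapT => /forall2NP h; apply: (hn ((nr x)^-1 *: x)); split.
    - exact: unitize.
    - by move=> d dD; rewrite ipZr xN // mulr0.
    - move=> i iA; rewrite projZ // -scalerBr nrZ ger0_norm ?invr_ge0 ?nr_ge0 //.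
      rewrite ler_pdivrMl // mulrC; have [//|/negP] := h i.
      by rewrite -ltNge => /ltW.
  rewrite (bigD1 i) //= -exprMn; apply: le_trans (_ : nr (x - proj (L i) x) ^+ 2 <= _).
    by rewrite ler_sqr ?nnegrE ?mulr_ge0 ?nr_ge0 ?(ltW e0).
  by rewrite lerDl sumr_ge0 // => j _; exact: sqr_ge0.
have e2 : 0 < e ^+ 2 by rewrite exprn_gt0.
have N0 x : N x -> ip (S x) x = 0 -> x = 0.
  move=> xN h; apply: nr_eq0; have := coer x xN; rewrite h pmulr_rle0 //.
  by move=> h'; apply/eqP; rewrite -sqrf_eq0 eq_le h' sqr_ge0.
have cN : csub N.
  have -> : N = ortho [set` D] by [].
  exact: csub_ortho.
split.
  exists [seq proj (meet A) d | d <- D]; apply: fd_of_orth; first exact: csub_meet.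
  move=> x xZ xD; apply: N0 => //; rewrite Sx big1 // => i iA.
  by rewrite (proj_id (cL i) (xZ i iA)) subrr nr0 expr0n.
have lowS x : N x -> e ^+ 2 * nr x <= nr (S x).
  move=> xN; have [->|x0] := eqVneq x 0; first by rewrite nr0 mulr0 nr_ge0.
  have := le_trans (coer x xN) (ip_le _ _); have := nr_gt0 x0.
  by move=> xp; rewrite expr2 mulrA ler_pM2r.
pose B := S @` N.
have sB : subsp B.
  split; first by exists 0; [case: cN => -[] | have := SB 0 0; rewrite !subrr].
  move=> a _ _ [x xN <-] [y yN <-]; exists (a *: x + y); last by rewrite SZD.
  by case: cN => -[_ h] _; exact: h.
have cB : csub B.
  split => // l hl.
  have pos n : 0 < n.+1%:R^-1 :> R by rewrite invr_gt0 ltr0n.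
  have ex n : exists x, N x /\ nr (l - S x) <= n.+1%:R^-1.
    by have [_ [x xN <-] h] := hl _ (pos n); exists x.
  have [x hx] := choice ex.
  have [y hy] : exists y, converges x y.
    apply: ip_complete => d d0.
    have ed : 0 < e ^+ 2 * d / 2 by rewrite divr_gt0 ?mulr_gt0.
    have [M hM] := inv_small ed.
    exists M => m n Mm Mn; rewrite -/(nr _).
    have [[mN lm] [nN ln]] := (hx m, hx n).
    have := lowS _ (subspB (proj1 cN) mN nN); rewrite SB => h.
    have := nr_tri l (S (x m)) (S (x n)); rewrite (nrBC _ l).
    move: (le_trans lm (hM m Mm)) (le_trans ln (hM n Mn)) => h1 h2 h3.
    by rewrite -(ler_pM2l e2); lra.
  have yN : N y.
    move=> d dD; apply: adherent_ip0 => d' /hy [M /(_ M (leqnn M)) h].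
    by exists (x M); [case: (hx M) => + _; apply | rewrite nrBC].
  exists y => //; apply/eqP; rewrite eq_sym -subr_eq0; apply/eqP/nr_eq0.
  apply: eq0_eps => d d0; rewrite ger0_norm ?nr_ge0 //.
  have d2 : 0 < d / 2 by rewrite divr_gt0.
  have c0 : 0 < (#|A|%:R + 1 : R) by rewrite ltr_wpDl.
  have [M1 h1] := hy _ (divr_gt0 d2 c0); have [M2 h2] := inv_small d2.
  pose n := maxn M1 M2; have [_ h3] := hx n.
  apply: le_trans (nr_tri (S (x n)) _ _) _; rewrite -SB.
  have := le_trans h3 (h2 n (leq_maxr _ _)); have := h1 n (leq_maxl _ _).
  rewrite ler_pdivlMr // => h4 h5.
  by have := Sle (x n - y); have := nr_ge0 (x n - y); nra.
have eB : ortho B = Span [seq proj (ortho B) d | d <- D].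
  apply: fd_of_orth; first exact: csub_ortho.
  by move=> y yB yN; apply: N0 => //; apply: yB; exists y.
have BM : B `<=` osum A.
  move=> _ [x _ <-]; exists (fun i => x - proj (L i) x) => // i iA w wL.
  exact: proj_orth.
have sM := subsp_osum A.
pose M' := osum A `&` ortho B.
have sO := proj1 (csub_ortho B).
have cM' : csub M'.
  apply: (@fdsub_closed _ _ _ [seq proj (ortho B) d | d <- D]).
    split; first by split; [case: sM | case: sO].
    move=> a x y [xM xB] [yM yB].
    by split; [case: sM => _; apply | case: sO => _; apply].
  by rewrite -eB; exact: subIsetr.
move=> l hl; rewrite -[l](subrK (proj B l)); apply: (subspD sM); last first.
  exact: (BM _ (projX cB l)).
suff : M' (l - proj B l) by case.
case: cM' => _; apply=> d /hl [x xM lx]; exists (x - proj B x).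
  split; first exact: (subspB sM xM (BM _ (projX cB x))).
  by move=> w wB; exact: proj_orth.
have -> : l - proj B l - (x - proj B x) = (l - x) - proj B (l - x).
  by rewrite projB // !opprD !opprK addrACA.
apply: le_trans lx; rewrite -ler_sqr ?nnegrE ?nr_ge0 //.
by rewrite (proj_pythag cB (l - x)) lerDr sqr_ge0.
Qed.

End Regularity.

(** The inverse of one plus the sum of the inverses also covers an empty [T]. *)
Lemma finite_lower_bound (R : realType) (T : finType) (f : T -> R) :
  (forall t, 0 < f t) -> exists2 e, 0 < e & forall t, e <= f t.
Proof.
move=> f0; pose s := \sum_t (f t)^-1.
have s0 : 0 <= s by apply: sumr_ge0 => t _; rewrite invr_ge0 ltW.
have s1 : 0 < s + 1 by rewrite ltr_wpDl.
exists (s + 1)^-1 => [|t]; first by rewrite invr_gt0.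
rewrite invf_ple ?posrE // (le_trans _ (_ : s <= _)) ?lerDl //.
by rewrite /s (bigD1 t) //= lerDl sumr_ge0 // => u _; rewrite invr_ge0 ltW.
Qed.

(** * Orbits of projections *)

Section Orbit.
Variables (R : realType) (V : hilbertType R) (I : finType) (M : I -> set V).
Hypothesis cM : forall i, csub (M i).
Variables (k : nat -> I) (z : nat -> V).
Hypothesis zS : forall n, z n.+1 = proj (M (k n)) (z n).
Hypothesis k_inf : forall i N, exists n, (N <= n)%N /\ k n = i.
Implicit Types (m n N : nat) (i : I) (e : R) (T : {set I}).

Definition dist_to i n : R := nr (z n - proj (M i) (z n)).

Lemma orbit_step n : nr (z n - z n.+1) ^+ 2 = nr (z n) ^+ 2 - nr (z n.+1) ^+ 2.
Proof. by rewrite zS (proj_pythag (cM (k n)) (z n)); ring. Qed.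

Lemma orbit_decr m n : (m <= n)%N -> nr (z n) <= nr (z m).
Proof.
elim: n => [|n IH]; first by rewrite leqn0 => /eqP ->.
rewrite leq_eqVlt => /orP[/eqP -> //|/IH h].
by apply: le_trans h; rewrite zS; exact: proj_le.
Qed.

Lemma orbit_decr2 m n : (m <= n)%N -> nr (z n) ^+ 2 <= nr (z m) ^+ 2.
Proof. by move=> h; rewrite ler_sqr ?nnegrE ?nr_ge0 // orbit_decr. Qed.

Lemma orbit_norm_cauchy e : 0 < e -> exists N, forall m n, (N <= m)%N -> (m <= n)%N ->
  nr (z m) ^+ 2 - nr (z n) ^+ 2 <= e.
Proof.
move=> e0; pose S : set R := [set nr (z n) ^+ 2 | n in [set: nat]].
have hS : has_inf S.
  by split; [exists (nr (z 0%N) ^+ 2), 0%N | exists 0 => _ [n _ <-]; exact: sqr_ge0].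
have [_ [N _ <-] hN] := inf_adherent e0 hS.
exists N => m n Nm mn.
have : inf S <= nr (z n) ^+ 2 by apply: ge_inf; [case: hS | exists n].
by have := orbit_decr2 Nm; lra.
Qed.

(* Moving projections from one argument of the inner product to the other
   contracts both ends of the window; this is where having only two
   subspaces matters. *)
Lemma two_spaces_ip a b m n : (m < n)%N ->
  (forall j, (m <= j)%N -> (j < n)%N -> k j = a \/ k j = b) ->
  nr (z n) ^+ 2 <= ip (z m.+1) (z n).
Proof.
move: {2}(n - m.+1)%N (leqnn (n - m.+1)) => d; elim: d m n => [|d IH] m n hd mn hk.
  by have -> : n = m.+1; [lia | rewrite nrE].
have [->|nm] := eqVneq n m.+1; first by rewrite nrE.
have mn' : (m.+1 < n)%N by lia.
have en : n = n.-1.+1 by lia.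
have zn : M (k n.-1) (z n) by rewrite en zS; exact: projX.
have zm : M (k m) (z m.+1) by rewrite zS; exact: projX.
have [e1|e1] := eqVneq (k n.-1) (k m).
  have -> : ip (z m.+1) (z n) = ip (z m.+1) (z n.-1).
    by rewrite {1}en [z n.-1.+1]zS -proj_sym // e1 proj_id.
  apply: le_trans (orbit_decr2 (leq_pred n)) _.
  by apply: IH; [lia..|move=> j j1 j2; apply: hk; lia].
have -> : ip (z m.+1) (z n) = ip (z m.+2) (z n); last first.
  by apply: IH; [lia..|move=> j j1 j2; apply: hk; lia].
have [e2|e2] := eqVneq (k m.+1) (k n.-1).
  by rewrite [z m.+2]zS proj_ipl // e2.
suff e3 : k m.+1 = k m by rewrite [z m.+2]zS e3 proj_id.
have h1 := hk m (leqnn _) mn; have h2 := hk m.+1 (leqnSn _) mn'.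
have h3 := hk n.-1; move: e1 e2 h1 h2 h3.
case=> // e1 e2 h1 h2 h3; have {}h3 : k n.-1 = a \/ k n.-1 = b by apply: h3; lia.
move/eqP: e1; move/eqP: e2.
by case: h1 => ->; case: h2 => ->; case: h3 => ->.
Qed.

(** The first step is treated apart, because [z m] need not lie in either space, unlike [z m.+1].
    Adding the two distances costs the factor 2. *)
Lemma two_spaces_dist a b m n : (m <= n)%N ->
  (forall j, (m <= j)%N -> (j < n)%N -> k j = a \/ k j = b) ->
  nr (z m - z n) ^+ 2 <= 2 * (nr (z m) ^+ 2 - nr (z n) ^+ 2).
Proof.
rewrite leq_eqVlt => /orP[/eqP -> _|mn hk].
  by rewrite !subrr nr0 expr0n mulr0.
have h1 := two_spaces_ip mn hk; have h2 := orbit_step m.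
have h3 : nr (z m.+1 - z n) ^+ 2 <= nr (z m.+1) ^+ 2 - nr (z n) ^+ 2.
  by rewrite nr_sqB; lra.
have h4 := nr_tri (z m.+1) (z m) (z n).
have p1 := nr_ge0 (z m - z m.+1); have p2 := nr_ge0 (z m.+1 - z n).
have p3 := nr_ge0 (z m - z n).
have : nr (z m - z n) ^+ 2 <= (nr (z m - z m.+1) + nr (z m.+1 - z n)) ^+ 2.
  by rewrite ler_sqr ?nnegrE ?addr_ge0.
by have := sqr_ge0 (nr (z m - z m.+1) - nr (z m.+1 - z n)); lra.
Qed.

(** All norms stay above [nr w]. If some projection moved [w], it would shorten it by at least [e];
    an orbit within [e / 2] of [w] stays there while the projections used fix [w], and the first one
    that does not would push the norm below [nr w]. So all projections fix [w], and the distance to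
    [w] never increases. *)
Lemma converges_of_cluster w :
  (forall e N, 0 < e -> exists2 n, (N <= n)%N & nr (z n - w) <= e) -> converges z w.
Proof.
move=> hw.
have wz n : nr w <= nr (z n).
  apply/ler_addgt0Pr => e e0; have [m nm h] := hw e n e0.
  have := orbit_decr nm; have := nr_sub w (z m); rewrite nrBC; lra.
(* The loss of norm at [w]; the value 1 is a placeholder for spaces that contain [w]. *)
pose f i : R := if proj (M i) w == w then 1 else nr w - nr (proj (M i) w).
have f0 i : 0 < f i.
  rewrite /f; case: eqP => // /eqP h; rewrite subr_gt0 lt_neqAle proj_le // andbT.
  apply: contra_neq h => h; have := proj_pythag (cM i) w; rewrite h => h'.
  have : nr (w - proj (M i) w) ^+ 2 = 0 by lra.
  by move/eqP; rewrite sqrf_eq0 => /eqP/nr_eq0/eqP; rewrite subr_eq0 => /eqP.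
have [e e0 he] := finite_lower_bound f0.
have fixw i : proj (M i) w = w.
  apply/eqP/negPn/negP => hi; have [n _ hn] := hw (e / 2) 0%N (divr_gt0 e0 (ltr0n _ 2)).
  have ex : exists m, (n <= m)%N && (proj (M (k m)) w != w).
    by have [m [nm km]] := k_inf i n; exists m; rewrite nm km.
  case: (ex_minnP ex) => m /andP[nm hm] min.
  have near j : (n <= j <= m)%N -> nr (z j - w) <= e / 2.
    elim: j => [|j IH] /andP[nj jm]; first by move: hn; have -> : n = 0%N by lia.
    have [<- //|nj'] := eqVneq n j.+1.
    have fj : proj (M (k j)) w = w.
      have nj2 : (n <= j)%N by lia.
      by apply/eqP/negPn/negP => h; have := min j; rewrite nj2 h => /(_ isT); lia.
    by rewrite zS -{1}fj; apply: le_trans (proj_lip (cM _) _ _) _; apply: IH; lia.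
  have := wz m.+1; rewrite zS => h1.
  have h2 := near m; have {}h2 : nr (z m - w) <= e / 2 by apply: h2; lia.
  have h3 := le_trans (proj_lip (cM (k m)) (z m) w) h2.
  have := he (k m); rewrite /f (negbTE hm) => h4.
  by have := nr_sub (proj (M (k m)) (z m)) (proj (M (k m)) w); lra.
move=> d d0; have [N _ hN] := hw d 0%N d0; exists N.
elim=> [|n IH]; first by rewrite leqn0 => /eqP <-.
rewrite leq_eqVlt => /orP[/eqP <- //|/IH h].
by rewrite zS -{1}(fixw (k n)); apply: le_trans (proj_lip (cM _) _ _) h.
Qed.

Definition used m n : {set I} := [set i | [exists j : 'I_n, (m <= j)%N && (k j == i)]].

Lemma usedP m n i :
  reflect (exists j, [/\ (m <= j)%N, (j < n)%N & k j = i]) (i \in used m n).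
Proof.
rewrite inE; apply: (iffP existsP) => [[j /andP[mj /eqP kj]]|[j [mj jn kj]]].
  by exists j; split.
by exists (Ordinal jn); rewrite mj kj /=.
Qed.

Lemma used_sub m m' n n' : (m' <= m)%N -> (n <= n')%N -> used m n \subset used m' n'.
Proof.
move=> mm nn; apply/fintype.subsetP => i /usedP [j [mj jn kj]]; apply/usedP.
by exists j; split => //; [exact: leq_trans mj | exact: leq_trans nn].
Qed.

Lemma usedS m n : (m <= n)%N -> used m n.+1 = k n |: used m n.
Proof.
move=> mn; apply/setP => i; rewrite in_setU1.
apply/idP/orP => [/usedP [j [mj jn kj]]|[/eqP ->|]].
- move: jn; rewrite ltnS leq_eqVlt => /orP[/eqP ej|jn].
    by left; rewrite -kj ej.
  by right; apply/usedP; exists j.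
- by apply/usedP; exists n.
- exact/fintype.subsetP/used_sub.
Qed.

(** The last three distinct indices before step [n]. The window start [m] is not unique, but [T]
    is. *)
Definition recent N n T := exists m, [/\ (N <= m)%N, (m <= n)%N, T = used m n & #|T| = 3%N].

(** After the last use of [i] only the two other members of [T] occur, so [z n] is still close to an
    iterate that lies in [M i]. The bound [e ^+ 2 / 2] absorbs the factor 2 of [two_spaces_dist]. *)
Lemma recent_near N e : 0 <= e ->
  (forall m n, (N <= m)%N -> (m <= n)%N -> nr (z m) ^+ 2 - nr (z n) ^+ 2 <= e ^+ 2 / 2) ->
  forall n T, recent N n T -> forall i, i \in T -> dist_to i n <= e.
Proof.
move=> e0 hN n T [m [Nm mn eT T3]] i iT.
have ex : exists j, (j < n)%N && (k j == i).
  by move: iT; rewrite eT => /usedP [j [_ jn kj]]; exists j; rewrite jn kj eqxx.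
have bd j : (j < n)%N && (k j == i) -> (j <= n)%N by case/andP => /ltnW.
case: (ex_maxnP ex bd) => j /andP[jn /eqP kj] maxj.
have mj : (m <= j)%N.
  move: iT; rewrite eT => /usedP [j' [mj' jn' kj']].
  by apply: leq_trans mj' (maxj _ _); rewrite jn' kj' eqxx.
have [a [b hab]] : exists a b, forall l, (j.+1 <= l)%N -> (l < n)%N -> k l = a \/ k l = b.
  have h2 : (#|T :\ i| == 2)%N by move: (cardsD1 i T); rewrite iT T3 => /eqP; rewrite eqSS eq_sym.
  case/cards2P: h2 => a [b [_ eab]].
  exists a, b => l jl ln; have : k l \in T :\ i.
    rewrite !inE; apply/andP; split.
      by apply/negP => kl; have := maxj l; rewrite ln kl => /(_ isT); lia.
    by rewrite eT; apply/usedP; exists l; split => //; lia.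
  by rewrite eab !inE => /orP[/eqP|/eqP]; [left | right].
have zj : M i (z j.+1) by rewrite zS kj; exact: projX.
apply: le_trans (proj_dist (cM i) (z n) zj) _; rewrite nrBC.
rewrite -ler_sqr ?nnegrE ?nr_ge0 //.
have Nj : (N <= j.+1)%N by lia.
have := two_spaces_dist jn hab; have := hN _ _ Nj jn; lra.
Qed.

Lemma current_near N e : 0 <= e ->
  (forall m n, (N <= m)%N -> (m <= n)%N -> nr (z m) ^+ 2 - nr (z n) ^+ 2 <= e ^+ 2 / 2) ->
  forall n, (N <= n)%N -> dist_to (k n) n <= e.
Proof.
move=> e0 hN n Nn; rewrite /dist_to -zS -ler_sqr ?nnegrE ?nr_ge0 // orbit_step.
by have := hN _ _ Nn (leqnSn n); have := sqr_ge0 e; lra.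
Qed.

End Orbit.

(** * Combinatorics of recent indices; [S n] stands for the indices whose spaces are close to the
    [n]-th iterate *)

Section RecentIndices.
Variables (I : finType) (k : nat -> I) (S : nat -> {set I}) (N : nat).
Hypothesis k_inf : forall i M, exists n, (M <= n)%N /\ k n = i.
Hypothesis recent_S : forall n T, recent k N n T -> T \subset S n.
Hypothesis current_S : forall n, (N <= n)%N -> k n \in S n.
Implicit Types (A B D T : {set I}) (m n : nat).

Lemma used_nn n : used k n n = finset.set0.
Proof.
by apply/setP => i; rewrite finset.in_set0; apply/usedP => -[j [nj jn _]]; lia.
Qed.

Lemma usedSl m n : (m < n)%N -> used k m n = k m |: used k m.+1 n.
Proof.
move=> mn; apply/setP => i; rewrite in_setU1.
apply/idP/orP => [/usedP [j [mj jn kj]]|[/eqP ->|]].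
- move: mj; rewrite leq_eqVlt => /orP[/eqP ej|mj].
    by left; rewrite -kj ej.
  by right; apply/usedP; exists j.
- by apply/usedP; exists m.
- exact/fintype.subsetP/used_sub.
Qed.

Lemma used_card_exists c m n : (m <= n)%N -> (c <= #|used k m n|)%N ->
  exists m', [/\ (m <= m')%N, (m' <= n)%N & #|used k m' n| = c].
Proof.
move: {2}(n - m)%N (leqnn (n - m)) => d; elim: d m => [|d IH] m hd mn hc.
  have e : m = n by lia.
  by exists m; split=> //; move: hc; rewrite e used_nn cards0; lia.
have [e|ne] := eqVneq m n.
  by exists m; split=> //; move: hc; rewrite e used_nn cards0; lia.
have [ec|nc] := eqVneq c #|used k m n|; first by exists m; split.
have mn' : (m < n)%N by lia.
have [|//||m' [h1 h2 h3]] := IH m.+1; [lia| |by exists m'; split => //; lia].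
move: hc nc; rewrite (usedSl mn') cardsU1; case: (_ \notin _); lia.
Qed.

Lemma recent_unique n T T' : recent k N n T -> recent k N n T' -> T = T'.
Proof.
move=> [m [_ _ eT T3]] [m' [_ _ eT' T3']]; apply/eqP.
have [mm|mm] := leqP m m'.
  by rewrite eq_sym eqEcard T3 T3' eT eT' leqnn andbT used_sub.
by rewrite eqEcard T3 T3' eT eT' leqnn andbT used_sub // ltnW.
Qed.

Lemma all_used : exists n, (N <= n)%N /\ used k N n = finset.setT.
Proof.
have [f hf] := choice (fun i => k_inf i N).
exists (\max_i f i + N).+1; split; first lia.
apply/setP => i; rewrite finset.in_setT; apply/usedP; exists (f i).
have [h1 h2] := hf i; split=> //.
by have := leq_bigmax i (F := f); lia.
Qed.

Section FromStart.
Variable N2 : nat.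
Hypothesis I_ge4 : (4 <= #|I|)%N.
Hypothesis N2N : (N <= N2)%N.
Hypothesis N2T : used k N N2 = finset.setT.

Lemma recent_exists n : (N2 <= n)%N -> exists T, recent k N n T.
Proof.
move=> Nn; have h : (3 <= #|used k N n|)%N.
  apply: leq_trans (subset_leq_card (used_sub k (leqnn N) Nn)).
  by rewrite N2T cardsT; lia.
have [m [h1 h2 h3]] := used_card_exists (leq_trans N2N Nn) h.
by exists (used k m n), m; split.
Qed.

Definition approached : {set {set I}} :=
  [set A : {set I} | (#|A| == 4%N) && `[< exists n, (N2 <= n)%N /\ A \subset S n >]]%SET.

Lemma approachedP A :
  A \in approached <-> #|A| = 4%N /\ exists n, (N2 <= n)%N /\ A \subset S n.
Proof.
rewrite inE; split; first by move=> /andP[/eqP h1 /asboolP h2].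
by move=> [-> h]; rewrite eqxx; apply/asboolP.
Qed.

Let adj : rel {set I} :=
  [rel C D | [&& C \in approached, D \in approached & (C != D) && (#|C :&: D| == 3%N)]].

Lemma adj_sym : connect_sym adj.
Proof.
by apply: sym_connect_sym => C D; rewrite /adj /= andbCA eq_sym finset.setIC.
Qed.

Lemma connect_share T A B : A \in approached -> B \in approached ->
  #|T| = 3%N -> T \subset A -> T \subset B -> connect adj A B.
Proof.
move=> hA hB T3 TA TB; have [->//|nAB] := eqVneq A B.
apply: connect1; rewrite /adj /= hA hB nAB /= eqn_leq; apply/andP; split; last first.
  by rewrite -T3; apply: subset_leq_card; rewrite finset.subsetI TA.
move/approachedP: hA => [A4 _]; move/approachedP: hB => [B4 _].
rewrite leqNgt; apply: contra nAB => h.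
rewrite eqEcard A4 B4 leqnn andbT.
have : (A :&: B) == A by rewrite eqEcard finset.subsetIl A4.
by move/eqP/finset.setIidPl.
Qed.

(** Elements of [A] are exchanged for elements of [T] one at a time. All intermediate sets lie in
    the same [S n], and consecutive ones share three elements. *)
Lemma connect_to_recent n T A : (N2 <= n)%N -> #|T| = 3%N -> T \subset S n ->
  #|A| = 4%N -> A \subset S n ->
  exists B, [/\ B \in approached, T \subset B & connect adj A B].
Proof.
move=> Nn T3 TS; move: {2}#|T :\: A| (leqnn #|T :\: A|) => d.
elim: d A => [|d IH] A hd A4 AS.
  exists A; split=> //; first by apply/approachedP; split=> //; exists n.
  by rewrite -finset.setD_eq0 -cards_eq0 -leqn0.
have [TA|] := boolP (T \subset A).
  by exists A; split=> //; apply/approachedP; split=> //; exists n.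
move=> /subsetPn [x xT xA].
have : (0 < #|A :\: T|)%N.
  by have := cardsID T A; have := subset_leq_card (finset.subsetIr A T); lia.
rewrite card_gt0 => /finset.set0Pn [y]; rewrite finset.in_setD => /andP[yT yA].
pose A' := x |: (A :\ y).
have A'4 : #|A'| = 4%N.
  have := cardsD1 y A; rewrite yA A4.
  by rewrite /A' cardsU1 !inE (negbTE xA) andbF /=; lia.
have A'S : A' \subset S n.
  rewrite finset.subUset finset.sub1set (fintype.subsetP TS) //=.
  by apply: fintype.subset_trans AS; exact: finset.subsetDl.
have hA : A \in approached by apply/approachedP; split=> //; exists n.
have hA' : A' \in approached by apply/approachedP; split=> //; exists n.
have hd' : (#|T :\: A'| <= d)%N.
  have := cardsD1 x (T :\: A); rewrite !inE xT xA => e.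
  suff : (#|T :\: A'| <= #|(T :\: A) :\ x|)%N
    by move: hd; rewrite e add1n ltnS => hd h; exact: leq_trans h hd.
  apply: subset_leq_card; apply/fintype.subsetP => w.
  rewrite !inE negb_or negb_and negbK => /andP[/andP[wx /orP[/eqP wy|wA]] wT].
    by rewrite -wy wT in yT.
  by rewrite wx wA.
have [B [hB TB cB]] := IH A' hd' A'4 A'S.
exists B; split=> //; apply: connect_trans cB; apply: (@connect_share (A :\ y)) => //.
- by move: (cardsD1 y A); rewrite yA A4 add1n => -[<-].
- exact: finset.subsetDl.
- exact: finset.subsetUr.
Qed.

Lemma new_approached n T : (N2 <= n)%N -> recent k N n T -> k n \notin T ->
  (k n |: T) \in approached.
Proof.
move=> Nn rT nT; apply/approachedP; split.
  by rewrite cardsU1 nT; case: rT => m [_ _ _ ->].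
exists n; split=> //; rewrite finset.subUset finset.sub1set current_S ?recent_S //.
exact: leq_trans Nn.
Qed.

(** Induction on time. The recent triple changes only when an index outside it is used, and the
    triple with this index added is an approached set containing both the old and the new triple. *)
Lemma connect_recent n n' T T' A B : (N2 <= n)%N -> (n <= n')%N ->
  recent k N n T -> recent k N n' T' ->
  A \in approached -> B \in approached -> T \subset A -> T' \subset B ->
  connect adj A B.
Proof.
move=> Nn nn' rT rT' hA hB TA; elim: n' nn' T' B rT' hB => [|n' IH] nn' T' B rT' hB T'B.
  have e : n = 0%N by lia.
  move: rT'; rewrite -e => /(recent_unique rT) eT; rewrite -eT in T'B.
  by apply: (@connect_share T) => //; case: rT => m [_ _ _ ->].
have [e|ne] := eqVneq n n'.+1.
  move: rT'; rewrite -e => /(recent_unique rT) eT; rewrite -eT in T'B.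
  by apply: (@connect_share T) => //; case: rT => m [_ _ _ ->].
have nn : (n <= n')%N by lia.
have Nn' := leq_trans Nn nn.
have [T0 rT0] := recent_exists Nn'.
have [m [Nm mn eT0 T03]] := rT0; have [m' [Nm' mn' eT' T'3]] := rT'.
have [kT|kT] := boolP (k n' \in T0).
  have e : T0 = T'.
    apply: (@recent_unique n'.+1) => //; exists m; split=> //; first lia.
    by rewrite usedS // -eT0 (finset.setUidPr _) ?finset.sub1set.
  by apply: (IH nn T0 B); rewrite // e.
have hD := new_approached Nn' rT0 kT.
have cD : connect adj A (k n' |: T0) by apply: (IH nn T0) => //; exact: finset.subsetUr.
apply: connect_trans cD _; apply: (@connect_share T') => //.
rewrite eT0 -usedS // eT'; have [h|h] := leqP m m'; first exact: used_sub.
have := subset_leq_card (used_sub k (ltnW h) (leqnn n'.+1)).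
by rewrite -eT' T'3 usedS // -eT0 cardsU1 kT T03.
Qed.

Lemma approached_connected A B : A \in approached -> B \in approached -> connect adj A B.
Proof.
move=> hA hB; have [A4 [n [Nn An]]] := proj1 (approachedP A) hA.
have [B4 [n' [Nn' Bn']]] := proj1 (approachedP B) hB.
have [T rT] := recent_exists Nn; have [T' rT'] := recent_exists Nn'.
have T3 : #|T| = 3%N by case: rT => m [].
have T'3 : #|T'| = 3%N by case: rT' => m [].
have [A1 [hA1 TA1 c1]] := connect_to_recent Nn T3 (recent_S rT) A4 An.
have [B1 [hB1 TB1 c2]] := connect_to_recent Nn' T'3 (recent_S rT') B4 Bn'.
apply: connect_trans c1 _; rewrite adj_sym; apply: connect_trans c2 _.
have [h|h] := leqP n n'; last exact: (connect_recent Nn' (ltnW h) rT' rT).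
by rewrite adj_sym; exact: (connect_recent Nn h rT rT').
Qed.

(** Start at a time [n] when [i] is used and wait for the first index outside the recent triple [T],
    which occurs since there are at least four indices. Until then [T] stays recent, so [i] is
    either in [T] or is that new index. *)
Lemma approached_cover : finset.cover approached = finset.setT.
Proof.
apply/setP => i; rewrite finset.in_setT; apply/bigcupP.
have [n [Nn kn]] := k_inf i N2; have [T rT] := recent_exists Nn.
have [j jT] : exists j, j \notin T.
  apply/existsP; rewrite -[X in is_true X]negbK negb_exists; apply/negP => /forallP h.
  have : T = finset.setT by apply/setP => j; rewrite finset.in_setT; have := h j; rewrite negbK.
  by move=> e; have [m [_ _ _]] := rT; rewrite e cardsT; lia.
have ex : exists n', (n <= n')%N && (k n' \notin T).
  by have [n' [nn' kn']] := k_inf j n; exists n'; rewrite nn' kn'.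
case: (ex_minnP ex) => n' /andP[nn' kn'] min.
have {}min l : (n <= l)%N -> (l < n')%N -> k l \in T.
  by move=> nl ln; apply/negPn/negP => h; have := min l; rewrite nl h => /(_ isT); lia.
have rT' : recent k N n' T.
  have [m [Nm mn eT T3]] := rT; exists m; split=> //; first lia.
  apply/eqP; rewrite finset.eqEsubset {1}eT used_sub //=.
  apply/fintype.subsetP => w /usedP [l [ml ln' <-]].
  have [nl|ln] := leqP n l; first exact: min.
  by rewrite eT; apply/usedP; exists l.
exists (k n' |: T); first exact: (new_approached (leq_trans Nn nn') rT' kn').
have [e|ne] := eqVneq n n'; first by rewrite -kn e finset.setU11.
by rewrite in_setU1 -kn min ?orbT //; lia.
Qed.

End FromStart.
End RecentIndices.

Lemma necessity (R : realType) (V : hilbertType R) (I : finType) (L M : I -> set V)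
    (k : nat -> I) (z : nat -> V) :
  (4 <= #|I|)%N -> (forall i, csub (L i)) -> (forall i, csub (M i)) ->
  (forall i, M i `<=` L i) ->
  (forall n, z n.+1 = proj (M (k n)) (z n)) ->
  (forall i N, exists n, (N <= n)%N /\ k n = i) ->
  ~ (exists l, converges z l) ->
  exists W : {set {set I}},
    [/\ forall A, A \in W -> #|A| = 4%N, finset.cover W = finset.setT,
        {in W &, forall A B, connect
          [rel C D | [&& C \in W, D \in W & (C != D) && (#|C :&: D|%SET == 3%N)]] A B}
      & forall A, A \in W -> ~ (exists D, meet L A = Span D) \/ ~ adh_closed (osum L A)].
Proof.
move=> I4 cL cM ML zS k_inf ncv.
pose good (A : {set I}) := (exists D, meet L A = Span D) /\ adh_closed (osum L A).
pose nearL (A : {set I}) (e : R) (n : nat) := forall i, i \in A -> nr (z n - proj (L i) (z n)) <= e.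
(* A tolerance and a starting time for every set, with dummies for the bad ones, so that a minimum
   and a maximum can be taken over all sets. *)
have ex A : exists eN : R * nat, 0 < eN.1 /\
    (good A -> forall n, (eN.2 <= n)%N -> ~ nearL A eN.1 n).
  have [gA|bA] := pselect (good A); last by exists (1, 0%N); split.
  apply: contrapT => /forallNP h; apply: ncv.
  have [[D eD] cO] := gA.
  have [w hw] : exists w, forall e N, 0 < e -> exists2 n, (N <= n)%N & nr (z n - w) <= e.
    apply: (cofinal_cluster cL (C := nr (z 0%N)) cO eD).
      by move=> n; exact: (orbit_decr cM zS (leq0n n)).
    move=> e N e0; apply: contrapT => /forall2NP h'.
    apply: (h (e, N)); split => //= _ n Nn hn.
    by have [/(_ Nn)|] := h' n.
  by exists w; exact: (converges_of_cluster cM zS k_inf hw).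
have [f hf] := choice ex.
have [e e0 he] := finite_lower_bound (fun A => proj1 (hf A)).
have e2 : 0 < e ^+ 2 / 2 by rewrite divr_gt0 ?exprn_gt0.
have [N0 hN0] := orbit_norm_cauchy cM zS e2.
pose N := (N0 + \max_A (f A).2)%N.
have hN m n : (N <= m)%N -> (m <= n)%N -> nr (z m) ^+ 2 - nr (z n) ^+ 2 <= e ^+ 2 / 2.
  by move=> Nm; apply: hN0; apply: leq_trans Nm; exact: leq_addr.
pose S n := [set i | dist_to M z i n <= e]%SET.
have recS n T : recent k N n T -> T \subset S n.
  move=> rT; apply/fintype.subsetP => i iT; rewrite inE.
  exact: (recent_near cM zS (ltW e0) hN rT iT).
have curS n : (N <= n)%N -> k n \in S n.
  by move=> Nn; rewrite inE; exact: (current_near cM zS (ltW e0) hN Nn).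
have [N2 [NN2 hN2]] := all_used N k_inf.
exists (approached S N2); split.
- by move=> A /approachedP [].
- exact: (approached_cover k_inf recS curS I4 NN2 hN2).
- by move=> A B hA hB; exact: (approached_connected recS curS I4 NN2 hN2 hA hB).
- move=> A /approachedP [_ [n [Nn An]]].
  apply: contrapT => /not_orP [/contrapT hm /contrapT hs].
  have Nfn : ((f A).2 <= n)%N.
    apply: leq_trans Nn; apply: leq_trans NN2; rewrite /N.
    by apply: leq_trans (leq_addl _ _); exact: (leq_bigmax A (F := fun A => (f A).2)).
  apply: (proj2 (hf A) (conj hm hs) n Nfn) => i iA.
  have /fintype.subsetP /(_ i iA) := An; rewrite inE => h.
  apply: le_trans (he A); apply: le_trans h.
  by apply: proj_dist => //; apply: ML; exact: projX.
Qed.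

(** * Turning a vector by projections and one symmetric operator *)

Section ModelBlock.
Variables (R : realType) (V : innerType R).
Implicit Types (x y w : V) (e : R) (g fs hs : seq V) (m : nat -> R).

Lemma Eproj_idem g x : ON g -> Eproj g (Eproj g x) = Eproj g x.
Proof. by move=> ong; apply: Span_ONE => //; exact: Span_Eproj. Qed.

Lemma Eproj_norm g x : ON g -> nr (Eproj g x) ^+ 2 = ip x (Eproj g x).
Proof. by move=> ong; rewrite nrE Eproj_sym Eproj_idem. Qed.

Lemma Eproj_le g x : ON g -> nr (Eproj g x) <= nr x.
Proof.
move=> ong; have h := Eproj_norm x ong; have h2 := ip_le x (Eproj g x).
have := nr_ge0 (Eproj g x); rewrite le_eqVlt => /orP[/eqP <-|p]; first exact: nr_ge0.
by rewrite -(ler_pM2r p) -expr2 h.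
Qed.

Lemma EprojB g x y : Eproj g (x - y) = Eproj g x - Eproj g y.
Proof. by rewrite addrC -scaleN1r EprojZD scaleN1r addrC. Qed.

Lemma EprojZ g (a : R) x : Eproj g (a *: x) = a *: Eproj g x.
Proof.
have := EprojZD g a x 0; rewrite !addr0 => ->.
have -> : Eproj g 0 = 0 by rewrite /Eproj big1 // => y _; rewrite ip0l scale0r.
by rewrite addr0.
Qed.

(** The errors of single steps add up without amplification, because [T] is nonexpansive and [T0]
    does not increase norms. *)
Lemma iter_close (T T0 : V -> V) (X : set V) (d : R) :
  (forall x, X x -> X (T x)) -> (forall x, X x -> X (T0 x)) ->
  (forall x, X x -> nr (T0 x) <= nr x) ->
  (forall x y, X x -> X y -> nr (T x - T y) <= nr (x - y)) ->
  (forall x, X x -> nr (T x - T0 x) <= d * nr x) -> 0 <= d ->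
  forall r x, X x -> nr (iter r T x - iter r T0 x) <= r%:R * d * nr x.
Proof.
move=> XT XT0 T0le Tlip hd d0 r x xX.
have iX n : X (iter n T x) by elim: n => //= n; exact: XT.
have iX0 n : X (iter n T0 x) by elim: n => //= n; exact: XT0.
have le0 n : nr (iter n T0 x) <= nr x.
  by elim: n => //= n IH; exact: le_trans (T0le _ (iX0 n)) IH.
elim: r => [|r IH] /=; first by rewrite subrr nr0 !mul0r.
apply: le_trans (nr_tri (T (iter r T0 x)) _ _) _.
have h1 := Tlip _ _ (iX r) (iX0 r); have h2 := hd _ (iX0 r).
have h3 := ler_wpM2l d0 (le0 r).
by rewrite -natr1; lra.
Qed.

Variables (u v : V).
Hypotheses (uu : ip u u = 1) (vv : ip v v = 1) (uv : ip u v = 0).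

Definition Pl x : V := ip x u *: u + ip x v *: v.

Lemma PlE x : Pl x = Eproj [:: u; v] x.
Proof. by rewrite !Eproj_cons Eproj_nil addr0. Qed.

Lemma ON_uv : ON [:: u; v].
Proof. by split=> // z; rewrite inE => /eqP ->. Qed.

Lemma PlK x : Pl (Pl x) = Pl x.
Proof. by rewrite !PlE Eproj_idem //; exact: ON_uv. Qed.

Lemma Pl_le x : nr (Pl x) <= nr x.
Proof. by rewrite PlE Eproj_le //; exact: ON_uv. Qed.

Lemma PlB x y : Pl (x - y) = Pl x - Pl y.
Proof. by rewrite !PlE EprojB. Qed.

Lemma PlZD (a : R) x y : Pl (a *: x + y) = a *: Pl x + Pl y.
Proof. by rewrite !PlE EprojZD. Qed.

Lemma PlZ (a : R) x : Pl (a *: x) = a *: Pl x.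
Proof. by rewrite !PlE EprojZ. Qed.

Lemma Pl_sym x y : ip (Pl x) y = ip x (Pl y).
Proof. by rewrite !PlE Eproj_sym. Qed.

Lemma Pl_u : Pl u = u.
Proof. by rewrite /Pl uu uv scale1r scale0r addr0. Qed.

Lemma Pl_v : Pl v = v.
Proof. by rewrite /Pl vv ipC uv scale1r scale0r add0r. Qed.

Lemma plane_perp x w : ip w u = 0 -> ip w v = 0 -> Pl x = x -> ip w x = 0.
Proof. by move=> wu wv <-; rewrite ipDr !ipZr wu wv !mulr0 addr0. Qed.

Definition transverse g := forall x, Pl x = x -> Eproj g x = x -> x = 0.

(* With [E0] the projection onto [g] enlarged by [h], the plane meets the range
   of [E0] exactly in the line of [h], so powers of [Pl \o E0] tend to the
   projection onto [h]; tilting the added vector slightly towards [f] restores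
   transversality and hardly changes a fixed power. *)
Lemma chain_step g h f e : ON g -> transverse g -> Pl h = h -> ip h h = 1 ->
  ip f f = 1 -> ip f u = 0 -> ip f v = 0 -> (forall y, y \in g -> ip f y = 0) -> 0 < e ->
  exists r y, [/\ ON (y :: g), transverse (y :: g),
    forall w, ip w u = 0 -> ip w v = 0 -> ip w f = 0 ->
      (forall z, z \in g -> ip w z = 0) -> ip w y = 0 &
    forall x, Pl x = x ->
      nr (iter r (Pl \o Eproj (y :: g)) x - ip x h *: h) <= e * nr x].
Proof.
move=> ong tg Ph hh ff fu fv fg e0.
pose q := h - Eproj g h.
have q0 : q != 0.
  apply/eqP => /eqP; rewrite subr_eq0 => /eqP q0; have := tg h Ph (esym q0).
  by move=> h0; move: hh; rewrite h0 ip0l => /eqP; rewrite eq_sym oner_eq0.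
have qp := nr_gt0 q0.
pose p := (nr q)^-1 *: q.
have pp : ip p p = 1 by exact: unitize.
have gq z : z \in g -> ip z q = 0 by move=> zg; exact: Eproj_orth.
have gp z : z \in g -> ip p z = 0 by move=> zg; rewrite ipZl ipC gq // mulr0.
have onp : ON (p :: g) by split.
have hp : ip h p = nr q.
  have : ip h q = nr q ^+ 2.
    rewrite nrE {2}/q ipBl (ipC (Eproj g h)) Eproj_ip ?subr0 // => z zg.
    by rewrite ipC gq.
  by rewrite ipZr => ->; rewrite expr2 mulKf // gt_eqF.
have hq : nr q *: p + Eproj g h = h.
  by rewrite /p scalerA mulfV ?gt_eqF // scale1r subrK.
have wp w : ip w u = 0 -> ip w v = 0 -> (forall z, z \in g -> ip w z = 0) ->
    ip w p = 0.
  by move=> wu wv wg; rewrite ipZr ipBr (plane_perp wu wv Ph) Eproj_ip // subr0 mulr0.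
have fp := wp f fu fv fg.
clearbody p.
pose E0 := Eproj (p :: g).
have E0h : E0 h = h by rewrite /E0 Eproj_cons hp.
(* [h] turned by a right angle in the plane: [Pl \o E0] is diagonal on the plane in this basis, with
   eigenvalues 1 and [mu]. *)
pose h' := ip h u *: v - ip h v *: u.
have hE : h = ip h u *: u + ip h v *: v by rewrite -{1}Ph.
have hn : ip h u ^+ 2 + ip h v ^+ 2 = 1.
  by have := congr1 (ip h) hE; rewrite ipDr !ipZr hh -!expr2 => <-.
have h'u : ip h' u = - ip h v.
  by rewrite ipBl !ipZl uu (ipC v) uv; ring.
have h'v : ip h' v = ip h u by rewrite ipBl !ipZl vv uv; ring.
have hh' : ip h h' = 0 by rewrite ipC hE ipDr !ipZr h'u h'v; ring.
have h'h' : ip h' h' = 1.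
  by rewrite {2}/h' ipBr !ipZr h'u h'v -hn; ring.
have Ph' : Pl h' = h' by rewrite /Pl h'u h'v scaleNr addrC.
have planeE x : Pl x = x -> x = ip x h *: h + ip x h' *: h'.
  move=> Px; rewrite -{1}Px /Pl {2}hE /h' ipBr !ipZr {1}hE ipDr !ipZr.
  move: hn; set a := ip h u; set b := ip h v; set c := ip x u; set d := ip x v => hn.
  rewrite scalerDr scalerBr !scalerA [X in _ = _ + X]addrC addrACA -scalerDl -scaleNr -scalerDl.
  by congr (_ *: _ + _ *: _); rewrite -[LHS]mulr1 -hn; ring.
(* Otherwise [E0] would fix the whole plane, and the plane vector orthogonal to [p] would be fixed
   by [Eproj g], against transversality. *)
have E0h' : E0 h' != h'.
  apply/eqP => eh'; pose x := ip h' p *: h - ip h p *: h'.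
  have xp : ip x p = 0 by rewrite ipBl !ipZl; ring.
  have Px : Pl x = x by rewrite /x PlB !PlZ Ph Ph'.
  have Ex : Eproj g x = x.
    have : E0 x = x by rewrite /E0 EprojB !EprojZ -/(E0 h) -/(E0 h') E0h eh'.
    by rewrite /E0 Eproj_cons xp scale0r add0r.
  have := congr1 (fun y => ip y h') (tg x Px Ex).
  rewrite ipBl !ipZl hh' h'h' hp ip0l mulr0 mulr1 sub0r => /eqP.
  by rewrite oppr_eq0 gt_eqF.
pose mu := ip (E0 h') h'.
have mu0 : 0 <= mu by rewrite /mu ipC -Eproj_norm // sqr_ge0.
have mu1 : mu < 1.
  have E0n : nr (E0 h') ^+ 2 = mu by rewrite /mu ipC Eproj_norm.
  have : nr (h' - E0 h') ^+ 2 = 1 - mu.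
    by rewrite nr_sqB E0n nrE h'h' (ipC h') -/mu; ring.
  have : 0 < nr (h' - E0 h').
    by apply: nr_gt0; rewrite subr_eq0 eq_sym.
  by move=> /(exprn_gt0 2) => + eq; rewrite eq subr_gt0.
have E0h'h : ip (E0 h') h = 0 by rewrite Eproj_sym -/(E0 h) E0h ipC hh'.
pose T0 := Pl \o E0.
have T0x x : Pl x = x -> T0 x = ip x h *: h + (mu * ip x h') *: h'.
  move=> Px; rewrite /T0 /= (planeE (Pl (E0 x))) ?PlK // !Pl_sym Ph Ph'.
  rewrite !Eproj_sym -/(E0 h) -/(E0 h') E0h.
  congr (_ + _ *: _); rewrite {1}(planeE x Px) ipDl !ipZl (ipC h') -/mu (ipC h) E0h'h.
  by rewrite mulr0 add0r mulrC.
have iT0 r x : Pl x = x -> iter r T0 x = ip x h *: h + (mu ^+ r * ip x h') *: h'.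
  move=> Px; elim: r => [|r IH] /=; first by rewrite expr0 mul1r -planeE.
  rewrite -/(T0 _) IH T0x; last first.
    by rewrite PlZD Ph PlZ Ph'.
  rewrite !ipDl !ipZl hh hh' h'h' (ipC h') hh'; congr (_ *: _ + _ *: _); rewrite ?exprS; ring.
have e2 : 0 < e / 2 by rewrite divr_gt0.
have [r hr] : exists r, mu ^+ r <= e / 2.
  have m1 : 0 < 1 - mu by rewrite subr_gt0.
  have bern n : mu ^+ n * (1 + n%:R * (1 - mu)) <= 1.
    elim: n => [|n IH]; first by rewrite expr0; lra.
    apply: le_trans IH; rewrite exprS -natr1.
    rewrite (mulrC mu) -mulrA ler_wpM2l ?exprn_ge0 //.
    have n0 : 0 <= n%:R :> R by [].
    by have := mulr_ge0 n0 (sqr_ge0 (1 - mu)); nra.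
  have [N /(_ N (leqnn _)) hN] := inv_small (mulr_gt0 m1 e2).
  exists N.+1; have := bern N.+1; have n0 : 0 < N.+1%:R :> R by rewrite ltr0n.
  have t0 : 0 <= mu ^+ N.+1 by rewrite exprn_ge0.
  move: (ler_wpM2l (ltW n0) hN); rewrite mulfV ?gt_eqF //.
  move: (mu ^+ N.+1) (N.+1%:R : R) t0 n0 => t n t0 n0 h1 h2.
  have h3 : t * n * (1 - mu) <= 1 by nra.
  have h4 : t * (n * ((1 - mu) * (e / 2))) <= e / 2 by nra.
  by apply: le_trans h4; rewrite -[leLHS]mulr1 ler_wpM2l.
(* The sine of the tilt: [r] perturbed steps cost at most [e / 2], and the bound by one half keeps
   [1 - s ^+ 2] nonnegative. *)
pose s := Num.min (2^-1) (e / 2 / r.+1%:R).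
have r1 : 0 < r.+1%:R :> R by rewrite ltr0n.
have s0 : 0 < s by rewrite lt_min invr_gt0 divr_gt0 ?ltr0n.
have s1 : s <= 2^-1 by rewrite ge_min lexx.
have sr : r%:R * s <= e / 2.
  have : s <= e / 2 / r.+1%:R by rewrite ge_min lexx orbT.
  rewrite ler_pdivlMr // -natr1 => h1.
  by have : 0 <= r%:R :> R by []; nra.
pose c := Num.sqrt (1 - s ^+ 2).
have c2 : c ^+ 2 = 1 - s ^+ 2 by rewrite sqr_sqrtr //; nra.
have c0 : 0 <= c by exact: sqrtr_ge0.
pose y := c *: p + s *: f.
have onf : ip p f = 0 by rewrite ipC.
have ony : ON (y :: g).
  split=> // [|z zg].
    by rewrite ipDl !ipDr !ipZl !ipZr pp ff fp onf -[RHS](subrK (s ^+ 2)) -c2; ring.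
  by rewrite ipDl !ipZl gp // fg // !mulr0 addr0.
have xf x : Pl x = x -> ip x f = 0 by move=> Px; rewrite ipC; exact: plane_perp.
have xy x : Pl x = x -> ip x y = c * ip x p.
  by move=> Px; rewrite ipDr !ipZr xf // mulr0 addr0.
exists r, y; split=> //.
(* A plane vector sees [y] only through [c *: p], and [c ^+ 2 < 1]; if it is fixed, it must be
   orthogonal to [p], and then [Eproj g] fixes it. *)
- move=> x Px; rewrite Eproj_cons => Ex.
  have h1 : ip x y ^+ 2 + ip x (Eproj g x) = ip x x.
    by have := congr1 (ip x) Ex; rewrite ipDr ipZr -expr2.
  have h2 : ip x p ^+ 2 + ip x (Eproj g x) <= ip x x.
    have e1 : nr (Eproj (p :: g) x) ^+ 2 = ip x p ^+ 2 + ip x (Eproj g x).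
      by rewrite Eproj_norm // Eproj_cons ipDr ipZr -expr2.
    by rewrite -e1 -nrE ler_sqr ?nnegrE ?nr_ge0 // Eproj_le.
  have h3 : ip x p = 0.
    suff le0 : ip x p ^+ 2 <= 0.
      by apply/eqP; rewrite -sqrf_eq0; apply/eqP/le_anti; rewrite le0 sqr_ge0.
    move: h1 h2; rewrite xy // exprMn c2 => h1 h2.
    have s2 : 0 < s ^+ 2 by rewrite exprn_gt0.
    rewrite -(pmulr_rle0 _ s2) -subr_ge0; move: h2; rewrite -h1 -subr_ge0.
    by move=> h3; apply: le_trans h3 _; rewrite le_eqVlt; apply/orP; left; apply/eqP; ring.
  by apply: tg => //; move: Ex; rewrite xy // h3 mulr0 scale0r add0r.
- by move=> w wu wv wf wg; rewrite ipDr !ipZr wf wp // !mulr0 addr0.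
- move=> x Px; apply: le_trans (nr_tri (iter r T0 x) _ _) _.
  have close : nr (iter r (Pl \o Eproj (y :: g)) x - iter r T0 x) <= r%:R * s * nr x.
    apply: (@iter_close _ _ [set x | Pl x = x]) => //; last exact: ltW.
    + by move=> z _; exact: PlK.
    + by move=> z _; exact: PlK.
    + by move=> z _; apply: le_trans (Pl_le _) _; exact: Eproj_le.
    + move=> z z' _ _; rewrite /= -PlB -EprojB.
      by apply: le_trans (Pl_le _) _; exact: Eproj_le.
    + move=> z Pz; rewrite /= -PlB; apply: le_trans (Pl_le _) _.
      rewrite /E0 !Eproj_cons opprD addrACA subrr addr0 xy //.
      have -> : (c * ip z p) *: y - ip z p *: p = ip z p *: (c *: y - p).
        by rewrite scalerBr scalerA mulrC.
      have : nr (c *: y - p) ^+ 2 = s ^+ 2.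
        rewrite nrE ipBl !ipBr !ipZl !ipZr (ipC y p) pp.
        have -> : ip y y = 1 by case: ony.
        have -> : ip p y = c by rewrite ipDr !ipZr pp onf; ring.
        by rewrite -[RHS](subKr 1) -c2; ring.
      move/eqP; rewrite eqrXn2 ?nr_ge0 ?(ltW s0) // => /eqP eqs.
      rewrite nrZ eqs mulrC ler_wpM2l ?(ltW s0) //.
      by have := cauchy z p; rewrite (nr1 pp) mulr1.
  have tail : nr (iter r T0 x - ip x h *: h) <= e / 2 * nr x.
    rewrite iT0 // addrC addKr nrZ (nr1 h'h') mulr1 normrM ger0_norm ?exprn_ge0 //.
    have := cauchy x h'; rewrite (nr1 h'h') mulr1 => hc.
    by apply: ler_pM; rewrite ?exprn_ge0 ?normr_ge0.
  have := ler_wpM2r (nr_ge0 x) sr; lra.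
Qed.

End ModelBlock.

(** * Operators diagonal on an orthonormal list *)

Section Diagonal.
Variables (R : realType) (V : innerType R).
Implicit Types (x y : V) (m : nat -> R).

Lemma ON_nth (g : seq V) i j : ON g -> (i < size g)%N -> (j < size g)%N ->
  ip (nth 0 g i) (nth 0 g j) = (i == j)%:R.
Proof.
elim: g i j => // y g IH [|i] [|j] //= [yy yg ong]; rewrite ?ltnS => hi hj //.
- by rewrite yg // mem_nth.
- by rewrite ipC yg // mem_nth.
- exact: IH.
Qed.

Variable g : seq V.
Hypothesis ong : ON g.

(* The operator with eigenvalue [m i.+1] on the [i]-th vector of [g] and
   [m 0] on the orthogonal complement of [g]. *)
Definition diag m x : V :=
  m 0 *: x + \sum_(i < size g) ((m i.+1 - m 0) * ip x (nth 0 g i)) *: nth 0 g i.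

Lemma diag_ip m x (j : 'I_(size g)) : ip (diag m x) (nth 0 g j) = m j.+1 * ip x (nth 0 g j).
Proof.
rewrite ipDl ipZl ip_suml (bigD1 j) //= ipZl ON_nth // eqxx mulr1 big1 ?addr0.
  by ring.
move=> i /negbTE ij; rewrite ipZl ON_nth //.
by have -> : (i == j :> nat) = false; [exact: ij | rewrite mulr0].
Qed.

Lemma diag_comp m m' x : diag m (diag m' x) = diag (fun i => m i * m' i) x.
Proof.
rewrite {1}/diag; under eq_bigr => i _ do rewrite diag_ip.
rewrite {1}/diag scalerDr scalerA -addrA scaler_sumr -big_split /=; congr (_ + _).
apply: eq_bigr => i _; rewrite scalerA -scalerDl; congr (_ *: _); ring.
Qed.

Lemma diagZD m a x y : diag m (a *: x + y) = a *: diag m x + diag m y.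
Proof.
rewrite /diag [in RHS]scalerDr addrACA !scalerDr !scalerA scaler_sumr -big_split /=.
rewrite (mulrC a); congr (_ + _); apply: eq_bigr => i _.
by rewrite scalerA -scalerDl ipDl ipZl; congr (_ *: _); ring.
Qed.

Lemma diagB m x y : diag m (x - y) = diag m x - diag m y.
Proof. by rewrite addrC -scaleN1r diagZD scaleN1r addrC. Qed.

Lemma diag_sym m x y : ip (diag m x) y = ip x (diag m y).
Proof.
rewrite ipDl ipDr ipZl ipZr ip_suml ip_sumr; congr (_ + _).
by apply: eq_bigr => i _; rewrite ipZl ipZr (ipC y); ring.
Qed.

Lemma diag_sub m m' x : diag m x - diag m' x = diag (fun i => m i - m' i) x.
Proof.
rewrite /diag opprD addrACA -scalerBl -sumrB; congr (_ + _).
by apply: eq_bigr => i _; rewrite -scalerBl; congr (_ *: _); ring.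
Qed.

Lemma eq_diag m m' x : (forall i, m i = m' i) -> diag m x = diag m' x.
Proof. by move=> h; rewrite /diag h; under eq_bigr => i _ do rewrite h. Qed.

Lemma diag1 x : diag (fun=> 1) x = x.
Proof.
by rewrite /diag scale1r big1 ?addr0 // => i _; rewrite subrr mul0r scale0r.
Qed.

Lemma diagD m m' x : diag m x + diag m' x = diag (fun i => m i + m' i) x.
Proof.
rewrite /diag addrACA -scalerDl -big_split; congr (_ + _).
by apply: eq_bigr => i _ /=; rewrite -scalerDl; congr (_ *: _); ring.
Qed.

Lemma bessel x : \sum_(i < size g) ip x (nth 0 g i) ^+ 2 <= ip x x.
Proof.
(* With these eigenvalues [diag] is the projection onto the orthogonal complement of [g]. *)
have := ip_ge0 (diag (fun i => (i == 0)%:R) x).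
rewrite diag_sym diag_comp /diag ipDr ipZr ip_sumr /= => h.
rewrite -subr_ge0; apply: le_trans h _; rewrite mulr1 mul1r lerD2l -sumrN.
by apply: ler_sum => i _; rewrite !mul0r sub0r mulN1r ipZr expr2 mulNr.
Qed.

Lemma diag_le m x b : (forall i, `|m i| <= b) -> nr (diag m x) <= b * nr x.
Proof.
move=> hb; have b0 : 0 <= b by exact: le_trans (normr_ge0 _) (hb 0).
rewrite -ler_sqr ?nnegrE ?mulr_ge0 ?nr_ge0 // exprMn !nrE diag_sym diag_comp.
have hb2 i : m i * m i <= b ^+ 2.
  by rewrite -expr2 -(real_normK (num_real (m i))) ler_sqr ?nnegrE.
rewrite ipDr ipZr ip_sumr.
have -> : b ^+ 2 * ip x x = m 0 * m 0 * ip x x + (b ^+ 2 - m 0 * m 0) * ip x x by ring.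
rewrite lerD2l; apply: le_trans (ler_wpM2l _ (bessel x)); last by rewrite subr_ge0.
rewrite mulr_sumr; apply: ler_sum => i _; rewrite ipZr -mulrA -expr2.
by rewrite ler_wpM2r ?sqr_ge0 // lerD2r hb2.
Qed.

Lemma iter_diag m s x : iter s (diag m) x = diag (fun i => m i ^+ s) x.
Proof.
elim: s => [|s IH] /=; first by rewrite (@eq_diag _ (fun=> 1)) ?diag1.
by rewrite IH diag_comp; apply: eq_diag => i; rewrite exprS.
Qed.

(** The strict inequality comes from the shift in [diag], where eigenvalue 0 belongs to the
    complement of [g]. *)
Lemma diag_drop p x : Eproj (drop p g) x = diag (fun i => (p < i)%:R) x.
Proof.
rewrite /diag ltn0 scale0r add0r /Eproj.
rewrite (big_nth 0) big_mkord size_drop.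
have [gp|pg] := leqP (size g) p.
  have -> : (size g - p = 0)%N by lia.
  rewrite big_ord0 big1 // => i _.
  have -> : (p < i.+1)%N = false by have := ltn_ord i; lia.
  by rewrite subrr mul0r scale0r.
rewrite -(big_mkord xpredT (fun i => ip x (nth 0 (drop p g) i) *: nth 0 (drop p g) i)).
rewrite -(big_mkord xpredT (fun i => (((p < i.+1)%:R - 0) * ip x (nth 0 g i)) *: nth 0 g i)).
rewrite (big_cat_nat (leq0n p) (ltnW pg)) /=.
rewrite [X in _ = X + _]big_nat_cond [X in _ = X + _]big1 ?add0r; last first.
  move=> i; rewrite andbT => /andP[_ ilp]; rewrite ltnS leqNgt ilp /=.
  by rewrite subrr mul0r scale0r.
rewrite [RHS](big_addn 0 (size g) p); apply: eq_bigr => i _.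
by rewrite nth_drop addnC ltnS leq_addl subr0 mul1r.
Qed.

End Diagonal.

Section Exponents.
Variable R : realType.

Lemma bernoulli_ge (mu : R) n : 0 <= mu -> mu <= 1 -> 1 - n%:R * mu <= (1 - mu) ^+ n.
Proof.
move=> m0 m1; elim: n => [|n IH]; first by rewrite mul0r subr0 expr0.
rewrite exprS -natr1; apply: le_trans (ler_wpM2l _ IH); last by rewrite subr_ge0.
have n0 : 0 <= n%:R :> R by [].
by have := mulr_ge0 n0 (sqr_ge0 mu); lra.
Qed.

Lemma power_small (l t : R) : 0 <= l -> l < 1 -> 0 < t ->
  exists N, forall n, (N <= n)%N -> l ^+ n <= t.
Proof.
move=> l0 l1 t0; have m1 : 0 < 1 - l by rewrite subr_gt0.
have bern n : l ^+ n * (1 + n%:R * (1 - l)) <= 1.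
  elim: n => [|n IH]; first by rewrite expr0; lra.
  apply: le_trans IH; rewrite exprS -natr1.
  rewrite (mulrC l) -mulrA ler_wpM2l ?exprn_ge0 //.
  have n0 : 0 <= n%:R :> R by [].
  by have := mulr_ge0 n0 (sqr_ge0 (1 - l)); have := sqr_ge0 (1 - l); lra.
have [N hN] := inv_small (mulr_gt0 m1 t0).
exists N.+1 => -[//|n] Nn; have := bern n.+1; have := hN n Nn.
have n0 : 0 < n.+1%:R :> R by rewrite ltr0n.
move=> h; have := ler_wpM2l (ltW n0) h; rewrite mulfV ?gt_eqF //.
have t1 : 0 <= l ^+ n.+1 by rewrite exprn_ge0.
move: (l ^+ n.+1) (n.+1%:R : R) t1 n0 => a b a0 b0 h1 h2.
have h3 : a * (b * ((1 - l) * t)) <= t.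
  by have := ler_wpM2r (ltW t0) h2; have := mulr_ge0 a0 (ltW t0); lra.
by apply: le_trans h3; rewrite -[leLHS]mulr1 ler_wpM2l.
Qed.

(** The power [s p] of the one operator [diag g l] thereby approximates the projection onto
    [drop p g], for every [p] at once, although all eigenvalues lie within [kap] of 1. *)
Lemma separating_exponents (tau kap : R) : 0 < tau -> 0 < kap -> kap <= 1 ->
  exists (l : nat -> R) (s : nat -> nat),
    [/\ forall i, 1 - kap <= l i <= 1, forall i j, (i <= j)%N -> l i ^+ s j <= tau &
      forall i j, (j < i)%N -> 1 - tau <= l i ^+ s j].
Proof.
move=> t0 k0 k1.
have [f hf] : exists f : R -> nat, forall l, 0 <= l -> l < 1 -> forall n, (f l <= n)%N ->
    l ^+ n <= tau.
  have /choice [f hf] : forall l : R, exists N, 0 <= l -> l < 1 -> forall n, (N <= n)%N ->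
      l ^+ n <= tau.
    move=> l; have [l0|l0] := leP 0 l; last by exists 0%N; lra.
    have [l1|l1] := ltP l 1; last by exists 0%N; lra.
    by have [N hN] := power_small l0 l1 t0; exists N.
  by exists f.
(* Eigenvalues and exponents are chosen alternately: the next eigenvalue is so close to 1 that the
   current exponent hardly lowers it, the next exponent so large that it nearly kills that
   eigenvalue. *)
pose nl (ls : R * nat) : R := 1 - Num.min (1 - ls.1) (tau / ls.2.+1%:R).
pose st ls := (nl ls, maxn ls.2 (f (nl ls))).
pose q i := iter i st (1 - kap, f (1 - kap)).
pose l i := (q i).1; pose s i := (q i).2.
have lS i : l i.+1 = 1 - Num.min (1 - l i) (tau / (s i).+1%:R) by [].
have sS i : s i.+1 = maxn (s i) (f (l i.+1)) by [].
have pos i : 0 < tau / (s i).+1%:R by rewrite divr_gt0 ?ltr0n.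
have l1 i : 1 - kap <= l i < 1.
  elim: i => [|i /andP[h1 h2]]; first by rewrite /l /=; lra.
  rewrite lS; apply/andP; split.
    have : Num.min (1 - l i) (tau / (s i).+1%:R) <= 1 - l i by rewrite ge_min lexx.
    lra.
  have : 0 < Num.min (1 - l i) (tau / (s i).+1%:R) by rewrite lt_min pos subr_gt0 h2.
  lra.
have lmono i j : (i <= j)%N -> l i <= l j.
  elim: j => [|j IH]; first by rewrite leqn0 => /eqP ->.
  rewrite leq_eqVlt => /orP[/eqP -> //|/IH h]; apply: le_trans h _; rewrite lS.
  have : Num.min (1 - l j) (tau / (s j).+1%:R) <= 1 - l j by rewrite ge_min lexx.
  lra.
have smono i j : (i <= j)%N -> (s i <= s j)%N.
  elim: j => [|j IH]; first by rewrite leqn0 => /eqP ->.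
  rewrite leq_eqVlt => /orP[/eqP -> //|/IH h]; apply: leq_trans h _.
  by rewrite sS leq_maxl.
have l0 i : 0 <= l i by have := l1 i; lra.
exists l, s; split.
- by move=> i; have := l1 i; lra.
- move=> i j ij; apply: le_trans (_ : l j ^+ s j <= tau).
    by apply: lerXn2r; rewrite ?nnegrE // lmono.
  apply: hf => //; first by have := l1 j; lra.
  by case: j {ij} => // j; rewrite sS leq_maxr.
- move=> i j ji; apply: (@le_trans _ _ (l j.+1 ^+ s j)); last first.
    by apply: lerXn2r; rewrite ?nnegrE // lmono.
  have := l1 j.+1; rewrite lS; set mu := Num.min _ _ => hmu.
  apply: le_trans (bernoulli_ge _ _ _); [|lra|lra].
  have : mu <= tau / (s j).+1%:R by rewrite ge_min lexx orbT.
  rewrite ler_pdivlMr ?ltr0n // -natr1 => h.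
  have s0 : 0 <= (s j)%:R :> R by [].
  have mu0 : 0 <= mu by lra.
  by lra.
Qed.

End Exponents.

Section Chain.
Variables (R : realType) (V : innerType R).
Implicit Types (x y w h f : V) (e : R) (g fs hs : seq V) (ws ss : seq nat).
Variables (u v : V).
Hypotheses (uu : ip u u = 1) (vv : ip v v = 1) (uv : ip u v = 0).
Let P := Pl u v.

Definition chain_word g x ws := foldl (fun x p => Pl u v (Eproj (drop p g) x)) x ws.

(** The length left after projecting [u] successively onto the lines of [hs], whose last line comes
    first in the list. *)
Fixpoint ip_path hs : R := if hs is h :: hs' then ip_path hs' * ip (head u hs') h else 1.

Lemma Pl_word_plane (T : nat -> V -> V) x ws :
  P x = x -> P (foldl (fun x p => P (T p x)) x ws) = foldl (fun x p => P (T p x)) x ws.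
Proof. by elim: ws x => //= p ws IH x _; apply: IH; exact: PlK. Qed.

Lemma Pl_word_le (T : nat -> V -> V) x ws : (forall p x, nr (T p x) <= nr x) ->
  nr (foldl (fun x p => P (T p x)) x ws) <= nr x.
Proof.
move=> hT; elim: ws x => //= p ws IH x; apply: le_trans (IH _) _.
exact: le_trans (Pl_le uu vv uv _) (hT _ _).
Qed.

Lemma ON_drop p g : ON g -> ON (drop p g).
Proof. by elim: g p => [|y g IH] [|p] //= [_ _ /IH]. Qed.

(** [chain_step] once for each [h], with a fresh direction from [fs]. The third conclusion says that
    [g] uses only the plane and [fs], which keeps the next direction orthogonal to [g]. *)
Lemma chain hs fs e : size fs = size hs -> (forall h, h \in hs -> P h = h /\ ip h h = 1) ->
  ON fs -> (forall f, f \in fs -> ip f u = 0 /\ ip f v = 0) -> 0 < e ->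
  exists g ws, [/\ ON g, transverse u v g,
    forall w, ip w u = 0 -> ip w v = 0 -> (forall f, f \in fs -> ip w f = 0) ->
      forall y, y \in g -> ip w y = 0 &
    nr (chain_word g u ws - ip_path hs *: head u hs) <= (size hs)%:R * e].
Proof.
move=> + + + + e0; elim: hs fs => [|h hs IH] [|f fs] //= => [_ _ _ _|].
  exists [::], [::]; split=> //; first by move=> x _; rewrite Eproj_nil.
  by rewrite /= scale1r subrr nr0 mul0r.
move=> [szf] hhs [ff ffs onfs] hfs.
have hhs' h' : h' \in hs -> P h' = h' /\ ip h' h' = 1.
  by move=> h'hs; apply: hhs; rewrite inE h'hs orbT.
have hfs' f' : f' \in fs -> ip f' u = 0 /\ ip f' v = 0.
  by move=> f'fs; apply: hfs; rewrite inE f'fs orbT.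
have [g [ws [ong tg gfs hw]]] := IH fs szf hhs' onfs hfs'.
have [Ph hh] := hhs h (mem_head _ _); have [fu fv] := hfs f (mem_head _ _).
have [r [y [ony ty yf hr]]] := chain_step uu vv uv ong tg Ph hh ff fu fv
  (gfs f fu fv ffs) e0.
(* Adding [y] in front shifts the positions of the older word by one; position 0 is the whole new
   list. *)
exists (y :: g), ([seq p.+1 | p <- ws] ++ nseq r 0); split=> //.
  move=> w wu wv wf z; rewrite inE => /orP[/eqP ->|zg].
    apply: yf => //; first by apply: wf; rewrite mem_head.
    by apply: gfs => // f' f'fs; apply: wf; rewrite inE f'fs orbT.
  by apply: gfs zg => // f' f'fs; apply: wf; rewrite inE f'fs orbT.
rewrite /chain_word foldl_cat.
have -> : forall x, foldl (fun x p => Pl u v (Eproj (drop p (y :: g)) x)) x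
    [seq p.+1 | p <- ws] = chain_word g x ws.
  by elim: (ws) => //= p ws' IH' x; rewrite IH'.
set x1 := chain_word g u ws in hw *.
have -> : forall x, foldl (fun x p => Pl u v (Eproj (drop p (y :: g)) x)) x (nseq r 0) =
    iter r (Pl u v \o Eproj (y :: g)) x.
  by elim: (r) => //= n IHn x; rewrite IHn -iterSr.
have Px1 : P x1 = x1 by apply: Pl_word_plane; exact: Pl_u.
have x1le : nr x1 <= 1.
  rewrite -(nr1 uu); apply: Pl_word_le => p x; apply: Eproj_le.
  exact: ON_drop.
apply: le_trans (nr_tri (ip x1 h *: h) _ _) _; rewrite -natr1.
have h1 := le_trans (hr x1 Px1) (ler_wpM2l (ltW e0) x1le).
have : nr (ip x1 h *: h - (ip_path hs * ip (head u hs) h) *: h) <= (size hs)%:R * e.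
  rewrite -scalerBl nrZ (nr1 hh) mulr1 -ipZl -ipBl.
  by apply: le_trans (cauchy _ _) _; rewrite (nr1 hh) mulr1.
lra.
Qed.

(** Equidistant points of the chord from [k u] to [k v] rather than of the arc, so that all inner
    products are polynomials in the indices. *)
Definition segment k j : V := (k%:R - j%:R) *: u + j%:R *: v.
Definition zigzag k j : V := (nr (segment k j))^-1 *: segment k j.

Lemma segment_ip k i j : ip (segment k i) (segment k j) =
  (k%:R - i%:R) * (k%:R - j%:R) + i%:R * j%:R.
Proof. by rewrite ipDl !ipDr !ipZl !ipZr uu vv uv (ipC v) uv; ring. Qed.

Lemma segment_plane k j : P (segment k j) = segment k j.
Proof. by rewrite /P /segment (PlZD u v) (PlZ u v) Pl_u // Pl_v. Qed.

Lemma segment_norm k j : k%:R ^+ 2 / 2 <= nr (segment k j) ^+ 2.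
Proof.
rewrite nrE segment_ip; have := sqr_ge0 (k%:R - j%:R - j%:R : R); lra.
Qed.

Lemma segment_gt0 k j : (0 < k)%N -> 0 < nr (segment k j).
Proof.
move=> k0; have := segment_norm k j; have k1 : 0 < k%:R :> R by rewrite ltr0n.
rewrite lt_def nr_ge0 andbT => h; apply/eqP => e; move: h; rewrite e expr0n /=.
by have := exprn_gt0 2 k1; lra.
Qed.

Lemma zigzag_unit k j : (0 < k)%N -> ip (zigzag k j) (zigzag k j) = 1.
Proof.
move=> k0; apply: unitize; apply/eqP => e; have := segment_gt0 j k0.
by rewrite e nr0 ltxx.
Qed.

Lemma zigzag0 k : (0 < k)%N -> zigzag k 0 = u.
Proof.
move=> k0; rewrite /zigzag /segment subr0 scale0r addr0 nrZ (nr1 uu) mulr1.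
by rewrite ger0_norm // scalerA mulVf ?scale1r // pnatr_eq0 -lt0n.
Qed.

Lemma zigzagk k : (0 < k)%N -> zigzag k k = v.
Proof.
move=> k0; rewrite /zigzag /segment subrr scale0r add0r nrZ (nr1 vv) mulr1.
by rewrite ger0_norm // scalerA mulVf ?scale1r // pnatr_eq0 -lt0n.
Qed.

(** Two consecutive points span a parallelogram of area [k], and their norms are at least [k] over
    the square root of 2; so the squared sine of the angle is at most [4 / k ^+ 2], and the cosine
    is at least its own square. *)
Lemma zigzag_ip k j : (0 < k)%N -> (j < k)%N ->
  1 - 4 / k%:R ^+ 2 <= ip (zigzag k j) (zigzag k j.+1) <= 1.
Proof.
move=> k0 jk; apply/andP; split; last first.
  apply: le_trans (ip_le _ _) _.
  by rewrite (nr1 (zigzag_unit j k0)) (nr1 (zigzag_unit j.+1 k0)) mulr1.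
have k1 : 0 < k%:R :> R by rewrite ltr0n.
have j1 : j%:R + 1 <= k%:R :> R by rewrite natr1 ler_nat.
have j0 : 0 <= j%:R :> R by [].
have a0 := segment_gt0 j k0; have b0 := segment_gt0 j.+1 k0.
have a1 := segment_norm k j; have b1 := segment_norm k j.+1.
have := ip_le (segment k j) (segment k j.+1).
have : nr (segment k j) ^+ 2 * nr (segment k j.+1) ^+ 2 -
    ip (segment k j) (segment k j.+1) ^+ 2 = k%:R ^+ 2.
  by rewrite !nrE !segment_ip -natr1; ring.
have : 0 <= ip (segment k j) (segment k j.+1).
  by rewrite segment_ip -natr1; apply: addr_ge0; apply: mulr_ge0; lra.
rewrite ipZl ipZr mulrA -invfM.
move: (nr (segment k j)) (nr (segment k j.+1)) (ip _ _) a0 b0 a1 b1.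
move=> a b p a0 b0 a1 b1 p0 eq pab; have ab0 : 0 < a * b by exact: mulr_gt0.
rewrite [leRHS]mulrC ler_pdivlMr //.
have k2 : 0 < k%:R ^+ 2 :> R by exact: exprn_gt0.
set q := k%:R ^+ 2 in a1 b1 eq k2 *.
have ab2 : q ^+ 2 / 4 <= a ^+ 2 * b ^+ 2.
  apply: le_trans (_ : (q / 2) * (q / 2) <= _); first by lra.
  by apply: ler_pM => //; rewrite divr_ge0 // ltW.
have h1 : q * (4 / q * (a * b) ^+ 2) >= q * q.
  have -> : q * (4 / q * (a * b) ^+ 2) = 4 * (a ^+ 2 * b ^+ 2) by field; rewrite gt_eqF.
  by lra.
have {}h1 : q <= 4 / q * (a * b) ^+ 2 by rewrite -(ler_pM2l k2).
have h2 : (1 - 4 / q) * (a * b) * (a * b) <= p * (a * b).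
  apply: le_trans (_ : p * p <= _); last by rewrite ler_wpM2l.
  by move: h1 eq; rewrite exprMn; lra.
by rewrite -(ler_pM2r ab0).
Qed.

Fixpoint zigzags k j := if j is j'.+1 then zigzag k j :: zigzags k j' else [::].

Lemma head_zigzags k j : (0 < k)%N -> head u (zigzags k j) = zigzag k j.
Proof. by case: j => //= k0; rewrite zigzag0. Qed.

Lemma size_zigzags k j : size (zigzags k j) = j.
Proof. by elim: j => //= j ->. Qed.

Lemma mem_zigzags k j h : (0 < k)%N -> h \in zigzags k j -> P h = h /\ ip h h = 1.
Proof.
move=> k0; elim: j => // j IH; rewrite inE => /orP[/eqP ->|/IH //].
by split; [rewrite /P (PlZ u v) [Pl u v _]segment_plane | exact: zigzag_unit].
Qed.

Lemma ip_path_zigzags k j : (4 <= k)%N -> (j <= k)%N ->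
  1 - j%:R * (4 / k%:R ^+ 2) <= ip_path (zigzags k j) <= 1.
Proof.
move=> k4; have k0 : (0 < k)%N by lia.
have k1 : 4 <= k%:R :> R by rewrite ler_nat.
elim: j => [_|j IH jk] /=; first by rewrite mul0r subr0 lexx.
rewrite head_zigzags //; have /andP[h1 h2] := IH (ltnW jk).
have /andP[h3 h4] := zigzag_ip k0 jk.
have d0 : 0 < k%:R ^+ 2 :> R by rewrite exprn_gt0 ?ltr0n.
have a0 : 0 <= 4 / k%:R ^+ 2 :> R by rewrite divr_ge0 // ltW.
have p0 : 0 <= ip_path (zigzags k j).
  apply: le_trans h1; rewrite subr_ge0 mulrA ler_pdivrMr // mul1r expr2.
  have jk' : j%:R <= k%:R :> R by rewrite ler_nat ltnW.
  apply: ler_pM => //.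
move: (4 / _) (ip_path _) (ip _ _) a0 p0 h1 h2 h3 h4 => a p c a0 p0 h1 h2 h3 h4.
have q1 : p * (1 - a) <= p * c by rewrite ler_wpM2l.
have q2 : p * c <= p by rewrite -[leRHS]mulr1 ler_wpM2l.
have q3 : p * a <= a by rewrite -[leRHS]mul1r ler_wpM2r.
by rewrite -natr1; apply/andP; split; lra.
Qed.

End Chain.

(** The order of the quantifiers is the point: the number [N] of projections onto the plane is fixed
    before the tilt bound [kap], and only the exponents [ss] depend on it. The three thirds of [e]
    pay for the chain, for the length lost on the zigzag, and for replacing projections by
    powers. *)
Lemma block (R : realType) (e : R) : 0 < e -> exists k : nat, (0 < k)%N /\
  forall (V : innerType R) (u v : V) (fs : seq V), size fs = k ->
  ip u u = 1 -> ip v v = 1 -> ip u v = 0 ->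
  ON fs -> (forall f, f \in fs -> ip f u = 0 /\ ip f v = 0) ->
  exists (g : seq V) (N : nat), ON g /\
  forall kap, 0 < kap -> kap <= 1 ->
  exists (l : nat -> R) (ss : seq nat), [/\ size ss = N,
    forall i, 1 - kap <= l i <= 1 &
    nr (foldl (fun x s => Pl u v (iter s (diag g l) x)) u ss - v) <= e].
Proof.
move=> e0; have e3 : 0 < e / 3 by rewrite divr_gt0.
have [N hN] := inv_small (divr_gt0 e3 (ltr0n _ 4)).
pose k := (N + 4)%N; have k0 : (0 < k)%N by rewrite /k; lia.
have kp : 0 < k%:R :> R by rewrite ltr0n.
exists k; split=> // V u v fs szf uu vv uv onfs hfs.
have sz : size fs = size (zigzags u v k k) by rewrite size_zigzags.
have zz h : h \in zigzags u v k k -> Pl u v h = h /\ ip h h = 1 by exact: mem_zigzags.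
have [g [ws [ong _ _ hw]]] := chain uu vv uv sz zz onfs hfs (divr_gt0 e3 kp).
move: hw; rewrite size_zigzags head_zigzags // zigzagk // mulrC divfK ?gt_eqF // => hw.
have hv : nr (chain_word u v g u ws - v) <= 2 * (e / 3).
  apply: le_trans (nr_tri (ip_path u (zigzags u v k k) *: v) _ _) _.
  have -> : 2 * (e / 3) = e / 3 + e / 3 by ring.
  apply: lerD hw _; rewrite -[X in _ - X]scale1r -scalerBl nrZ (nr1 vv) mulr1.
  have k4 : (4 <= k)%N by rewrite /k; lia.
  have /andP[h1 h2] := ip_path_zigzags uu vv uv k4 (leqnn k).
  rewrite distrC ger0_norm ?subr_ge0 //.
  have h3 : k%:R * (4 / k%:R ^+ 2) <= e / 3.
    have -> : k%:R * (4 / k%:R ^+ 2) = 4 * k%:R^-1 :> R by field; rewrite gt_eqF.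
    have := hN k.-1; rewrite prednK // => /(_ _).
    rewrite (mulrC 4) -ler_pdivlMr //; apply; rewrite /k; lia.
  lra.
exists g, (size ws); split=> // kap kap0 kap1.
pose tau := e / 3 / (size ws).+1%:R.
have tau0 : 0 < tau by rewrite divr_gt0 ?ltr0n.
have [l [s [hl hlo hhi]]] := separating_exponents tau0 kap0 kap1.
exists l, [seq s p | p <- ws]; split=> //; first by rewrite size_map.
have l0 i : 0 <= l i by have := hl i; lra.
have T_le p x : nr (iter p (diag g l) x) <= nr x.
  rewrite iter_diag // -[leRHS]mul1r; apply: diag_le => // i.
  by rewrite ger0_norm ?exprn_ge0 // exprn_ile1 //; have := hl i; lra.
have close p x : nr (iter (s p) (diag g l) x - Eproj (drop p g) x) <= tau * nr x.
  rewrite iter_diag // diag_drop diag_sub; apply: diag_le => // i.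
  have pw0 : 0 <= l i ^+ s p by rewrite exprn_ge0.
  have pw1 : l i ^+ s p <= 1 by rewrite exprn_ile1 //; have := hl i; lra.
  have [pi|ip'] := ltnP p i.
    by have := hhi i p pi; rewrite /= mulr1n distrC ger0_norm ?subr_ge0 //; lra.
  by rewrite subr0 ger0_norm // hlo.
have main x y us : nr (foldl (fun x s => Pl u v (iter s (diag g l) x)) x [seq s p | p <- us] -
    chain_word u v g y us) <= nr (x - y) + (size us)%:R * tau * nr y.
  elim: us x y => [|p us IH] x y /=; first by rewrite !mul0r addr0.
  apply: le_trans (IH _ _) _; rewrite -PlB.
  have h1 : nr (Pl u v (Eproj (drop p g) y)) <= nr y.
    by apply: le_trans (Pl_le uu vv uv _) _; apply: Eproj_le; exact: ON_drop.
  have h2 := Pl_le uu vv uv (iter (s p) (diag g l) x - Eproj (drop p g) y).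
  have h3 := nr_tri (iter (s p) (diag g l) y) (iter (s p) (diag g l) x) (Eproj (drop p g) y).
  have h4 := close p y.
  have h5 : nr (iter (s p) (diag g l) x - iter (s p) (diag g l) y) <= nr (x - y).
    by rewrite !iter_diag // -diagB -iter_diag //; exact: T_le.
  have h6 : (size us)%:R * tau * nr (Pl u v (Eproj (drop p g) y)) <= (size us)%:R * tau * nr y.
    by rewrite ler_wpM2l // mulr_ge0 // ltW.
  by rewrite -natr1; lra.
apply: le_trans (nr_tri (chain_word u v g u ws) _ _) _.
have := main u u ws; rewrite subrr nr0 add0r (nr1 uu) mulr1 => h.
have : (size ws)%:R * tau <= e / 3.
  rewrite /tau mulrA ler_pdivrMr ?ltr0n // mulrC ler_wpM2l ?(ltW e3) //.
  by rewrite ler_nat.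
lra.
Qed.

(** * The coordinate model of a block *)

Section RowInner.
Variables (R : realType) (n : nat).
Implicit Types x y z : 'rV[R]_n.

Definition row_ip x y : R := \sum_i x 0 i * y 0 i.

Lemma row_ipC x y : row_ip x y = row_ip y x.
Proof. by apply: eq_bigr => i _; rewrite mulrC. Qed.

Lemma row_ipDl x y z : row_ip (x + y) z = row_ip x z + row_ip y z.
Proof. by rewrite -big_split; apply: eq_bigr => i _; rewrite mxE mulrDl. Qed.

Lemma row_ipZl (a : R) x y : row_ip (a *: x) y = a * row_ip x y.
Proof. by rewrite mulr_sumr; apply: eq_bigr => i _; rewrite mxE mulrA. Qed.

Lemma row_ip_ge0 x : 0 <= row_ip x x.
Proof. by apply: sumr_ge0 => i _; rewrite -expr2 sqr_ge0. Qed.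

Lemma row_ip_eq0 x : row_ip x x = 0 -> x = 0.
Proof.
move=> h; apply/rowP => i; rewrite mxE.
have : x 0 i * x 0 i = 0.
  by apply: (psumr_eq0P _ h) => // j _; rewrite -expr2 sqr_ge0.
by move/eqP; rewrite mulf_eq0 orbb => /eqP.
Qed.

HB.instance Definition _ := isInner.Build R 'rV[R]_n
  row_ipC row_ipDl row_ipZl row_ip_ge0 row_ip_eq0.

Lemma row_ipE x y : ip x y = \sum_i x 0 i * y 0 i.
Proof. by []. Qed.

Lemma ip_delta x (j : 'I_n) : ip x (delta_mx 0 j) = x 0 j.
Proof.
rewrite row_ipE (bigD1 j) //= big1 ?addr0 => [|i /negbTE ij]; rewrite mxE !eqxx /=.
  by rewrite mulr1.
by rewrite ij mulr0.
Qed.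

Lemma row_coord_le x i : `|x 0 i| <= nr x.
Proof.
rewrite -ler_sqr ?nnegrE ?nr_ge0 // real_normK ?num_real // nrE row_ipE.
rewrite (bigD1 i) //= -expr2 lerDl; apply: sumr_ge0 => j _.
by rewrite -expr2 sqr_ge0.
Qed.

End RowInner.

Lemma ON_map (R : realType) (V : innerType R) (T : eqType) (f : T -> V) (s : seq T) :
  uniq s -> (forall i j, ip (f i) (f j) = (i == j)%:R) -> ON (map f s).
Proof.
move=> + hf; elim: s => //= t s IH /andP[ts us]; split; last exact: IH.
  by rewrite hf eqxx.
move=> _ /mapP [t' t's ->]; rewrite hf.
by case: eqP t's ts => // <- ->.
Qed.

(* [a |-> (A a, B a)] is an isometry onto a space close to the first factor;
   projecting the first factor onto this space and back is [A \o A]. *)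
Record tilt (R : realType) (V : innerType R) (kap : R) (A B : V -> V) : Prop := {
  tiltA_lin : forall a x y, A (a *: x + y) = a *: A x + A y;
  tiltB_lin : forall a x y, B (a *: x + y) = a *: B x + B y;
  tiltA_sym : forall x y, ip (A x) y = ip x (A y);
  tiltB_sym : forall x y, ip (B x) y = ip x (B y);
  tilt_comm : forall x, A (B x) = B (A x);
  tilt_sum : forall x, A (A x) + B (B x) = x;
  tiltA_near : forall x, nr (A x - x) <= kap * nr x;
  tiltB_small : forall x, nr (B x) <= kap * nr x }.

Section TiltModel.
Variable R : realType.

(** The [l i] are squared cosines of the tilt angles; [1 - kap ^+ 2] bounds the sines by [kap]. *)
Lemma tilt_diag (V : innerType R) (g : seq V) (kap : R) (l : nat -> R) :
  ON g -> 0 < kap -> kap <= 1 -> (forall i, 1 - kap ^+ 2 <= l i <= 1) ->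
  tilt kap (diag g (fun i => Num.sqrt (l i))) (diag g (fun i => Num.sqrt (1 - l i))).
Proof.
move=> ong k0 k1 hl.
have kk : kap ^+ 2 <= 1 by rewrite expr_le1 // ltW.
have l0 i : 0 <= l i by have := hl i; lra.
have l1 i : 0 <= 1 - l i by have := hl i; lra.
have s1 i : Num.sqrt (l i) <= 1.
  by rewrite -sqrtr1 ler_sqrt //; have := hl i; lra.
split.
- exact: diagZD.
- exact: diagZD.
- exact: diag_sym.
- exact: diag_sym.
- by move=> x; rewrite !diag_comp //; apply: eq_diag => i; rewrite mulrC.
- move=> x; rewrite !diag_comp // diagD -[RHS](diag1 g); apply: eq_diag => i.
  by rewrite -!expr2 !sqr_sqrtr //; ring.
- move=> x; rewrite -[X in _ - X](diag1 g) diag_sub; apply: diag_le => // i.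
  rewrite distrC ger0_norm ?subr_ge0 //.
  have := sqr_sqrtr (l0 i); have := sqrtr_ge0 (l i); have := s1 i; have := hl i.
  move: (l i) (Num.sqrt (l i)) => m s /andP[h1 h2] h3 h4 h5.
  have h6 : s ^+ 2 <= s by rewrite expr2 ler_piMr.
  have h7 : kap ^+ 2 <= kap by rewrite expr2 ler_piMr // ltW.
  lra.
- move=> x; apply: diag_le => // i; rewrite ger0_norm ?sqrtr_ge0 //.
  rewrite -[leRHS]ger0_norm ?(ltW k0) // -sqrtr_sqr ler_sqrt ?sqr_ge0 //.
  by have := hl i; lra.
Qed.

Definition ord1' n : 'I_n.+2 := lift ord0 ord0.

(** Coordinates 0 and 1 play the two vectors of [block], the remaining [n] its fresh directions. *)
Lemma tilt_model (e : R) : 0 < e -> exists n N : nat,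
  forall kap, 0 < kap -> kap <= 1 -> exists (A B : 'rV[R]_n.+2 -> 'rV[R]_n.+2) (ss : seq nat),
    [/\ size ss = N, tilt kap A B &
      nr (foldl (fun x s => Pl (delta_mx 0 ord0) (delta_mx 0 (ord1' n)) (iter s (A \o A) x))
        (delta_mx 0 ord0) ss - delta_mx 0 (ord1' n)) <= e].
Proof.
move=> /block [n [n0 hn]]; exists n.
have dd (i j : 'I_n.+2) : ip (delta_mx 0 i) (delta_mx 0 j : 'rV[R]_n.+2) = (i == j)%:R.
  by rewrite ip_delta mxE eqxx eq_sym.
have d00 : ip (delta_mx 0 ord0) (delta_mx 0 ord0 : 'rV[R]_n.+2) = 1 by rewrite dd.
have d11 : ip (delta_mx 0 (ord1' n)) (delta_mx 0 (ord1' n) : 'rV[R]_n.+2) = 1.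
  by rewrite dd eqxx.
have d01 : ip (delta_mx 0 ord0) (delta_mx 0 (ord1' n) : 'rV[R]_n.+2) = 0 by rewrite dd.
pose f (i : 'I_n) : 'rV[R]_n.+2 := delta_mx 0 (lift ord0 (lift ord0 i)).
have szf : size [seq f i | i <- enum 'I_n] = n by rewrite size_map size_enum_ord.
have onf : ON [seq f i | i <- enum 'I_n].
  apply: ON_map; first exact: enum_uniq.
  by move=> i j; rewrite dd !(inj_eq (@lift_inj _ _)).
have fuv y : y \in [seq f i | i <- enum 'I_n] ->
    ip y (delta_mx 0 ord0) = 0 /\ ip y (delta_mx 0 (ord1' n)) = 0.
  by move=> /mapP [i _ ->]; rewrite !dd.
have [g [N [ong hg]]] := hn _ _ _ _ szf d00 d11 d01 onf fuv.
exists N => kap k0 k1.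
have kk : kap ^+ 2 <= 1 by rewrite expr_le1 // ltW.
have [l [ss [hss hl hw]]] := hg _ (exprn_gt0 2 k0) kk.
have hT := tilt_diag ong k0 k1 hl.
pose A := diag g (fun i => Num.sqrt (l i)).
have AA y : (A \o A) y = diag g l y.
  rewrite /A /= diag_comp //; apply: eq_diag => i.
  by rewrite -expr2 sqr_sqrtr //; have := hl i; lra.
exists A, (diag g (fun i => Num.sqrt (1 - l i))), ss; split; [exact: hss | exact: hT |].
have -> // : forall us x,
    foldl (fun x s => Pl (delta_mx 0 ord0) (delta_mx 0 (ord1' n)) (iter s (A \o A) x)) x us =
    foldl (fun x s => Pl (delta_mx 0 ord0) (delta_mx 0 (ord1' n)) (iter s (diag g l) x)) x us.
by elim=> //= s us IH x; rewrite IH (eq_iter AA).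
Qed.

End TiltModel.

(** * Recurrent walks and roles *)

Section Walk.
Variables (T : finType) (W : {set T}) (e : rel T).
Hypothesis e_conn : {in W &, forall x y, connect e x y}.

Lemma covering_closed_walk x (s : seq T) : x \in W -> {subset s <= W} ->
  exists p, [/\ path e x p, last x p = x & {subset s <= x :: p}].
Proof.
move=> xW; elim: s => [|y s IH] sW; first by exists [::].
have yW : y \in W by apply: sW; rewrite mem_head.
have [|p [ep lp sp]] := IH; first by move=> z zs; apply: sW; rewrite inE zs orbT.
have [p1 ep1 lp1] := connectP (e_conn xW yW).
have [p2 ep2 lp2] := connectP (e_conn yW xW).
exists (p1 ++ p2 ++ p); split.
- by rewrite !cat_path ep1 -lp1 ep2 -lp2 ep.
- by rewrite !last_cat -lp1 -lp2.
- move=> z; rewrite inE => /orP[/eqP ->|/sp].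
    by rewrite -cat_cons mem_cat lp1 mem_last.
  by rewrite !inE !mem_cat => /orP[->//|->]; rewrite !orbT.
Qed.

Lemma recurrent_walk : (exists x, x \in W) -> (forall x y, e x y -> x \in W -> y \in W) ->
  exists A : nat -> T, [/\ forall m, A m \in W, forall m, A m = A m.+1 \/ e (A m) (A m.+1) &
    forall x N, x \in W -> exists m, (N <= m)%N /\ A m = x].
Proof.
move=> [x xW] eW.
have [|p [ep lp Wp]] := @covering_closed_walk x (enum W) xW.
  by move=> y; rewrite mem_enum.
pose r : rel T := fun y z => (y == z) || e y z.
(* Closing with one extra stay at [x] makes the period positive even if the walk [p] is empty. *)
pose q := rcons p x.
have rq : path r x q.
  rewrite rcons_path lp; apply/andP; split; last by rewrite /r eqxx.
  by apply: sub_path ep => y z h; rewrite /r h orbT.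
have lq : last x q = x by rewrite last_rcons.
have q0 : (0 < size q)%N by rewrite size_rcons.
pose A m := nth x (x :: q) (m %% size q).
have step i : (i < size q)%N -> r (nth x (x :: q) i) (nth x q i) by move/(pathP x): rq; apply.
have AS m : r (A m) (A m.+1).
  have mq : (m %% size q < size q)%N by rewrite ltn_mod.
  have := step _ mq; rewrite -/(A m).
  suff -> : nth x q (m %% size q) = A m.+1 by [].
  rewrite /A -addn1 -modnDml addn1.
  have [h|h] := eqVneq (m %% size q).+1 (size q).
    rewrite h modnn /= -[RHS]lq -nth_last; congr nth.
    by rewrite -[X in _ = X.-1]h.
  have h2 : ((m %% size q).+1 < size q)%N by rewrite ltn_neqAle h.
  by rewrite (modn_small h2).
exists A; split.
- elim=> [|m IH]; first by rewrite /A mod0n.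
  by have /orP[/eqP <- //|/eW] := AS m; apply.
- by move=> m; have /orP[/eqP ->|h] := AS m; [left | right].
- move=> y N yW; have : y \in x :: p by apply: Wp; rewrite mem_enum.
  rewrite -index_mem => yp; pose i := index y (x :: p).
  have iq : (i < size q)%N by rewrite size_rcons.
  exists (N * size q + i)%N; split.
    by apply: leq_trans (leq_addr _ _); rewrite leq_pmulr.
  rewrite /A modnMDl modn_small //.
  rewrite -rcons_cons nth_rcons.
  have -> : (i < size (x :: p))%N by [].
  by rewrite nth_index // -index_mem.
Qed.

End Walk.

(** Three elements suffice if they are picked in the order [t], [c], [p], since each choice has only
    two values to avoid. The last three conditions keep the tilted spaces undisturbed by
    neighbouring blocks. *)
Lemma choose_roles (I : finType) (X : nat -> {set I}) : (forall m, 3 <= #|X m|)%N ->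
  exists c t p : nat -> I,
    [/\ forall m, [/\ c m \in X m, t m \in X m & p m \in X m],
        forall m, [/\ c m != t m, c m != p m & t m != p m],
        forall m, t m.+1 != t m, forall m, t m.+1 != c m & forall m, c m.+1 != t m].
Proof.
move=> X3.
have ex m (c t : I) : exists r : I * I * I,
    [/\ [/\ r.1.1 \in X m, r.1.2 \in X m & r.2 \in X m],
        [/\ r.1.1 != r.1.2, r.1.1 != r.2 & r.1.2 != r.2],
        r.1.2 != t, r.1.2 != c & r.1.1 != t].
  have pick (Y : {set I}) : (0 < #|Y|)%N -> exists y, y \in Y.
    by rewrite card_gt0 => /finset.set0Pn.
  have h1 := X3 m.
  have [|t' ht'] := pick (X m :\ t :\ c).
    by have := cardsD1 t (X m); have := cardsD1 c (X m :\ t); lia.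
  have [|c' hc'] := pick (X m :\ t' :\ t).
    by have := cardsD1 t' (X m); have := cardsD1 t (X m :\ t'); lia.
  have [|p' hp'] := pick (X m :\ t' :\ c').
    by have := cardsD1 t' (X m); have := cardsD1 c' (X m :\ t'); lia.
  move: ht' hc' hp'; rewrite !inE => /and3P[h2 h3 h4] /and3P[h5 h6 h7] /and3P[h8 h9 h10].
  by exists (c', t', p'); split=> //=; split=> //; rewrite eq_sym.
have [f hf] := choice (fun mct : nat * I * I => ex mct.1.1 mct.1.2 mct.2).
have [i _] : exists i, i \in X 0%N.
  by apply/finset.set0Pn; rewrite -card_gt0; have := X3 0%N; lia.
pose q m := nat_rect (fun _ => (I * I * I)%type) (f (0%N, i, i))
  (fun m r => f (m.+1, r.1.1, r.1.2)) m.
have hq m : exists c t, q m = f (m, c, t) by case: m => [|m]; [exists i, i | do 2!eexists].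
exists (fun m => (q m).1.1), (fun m => (q m).1.2), (fun m => (q m).2); split => m.
- by have [c [t ->]] := hq m; case: (hf (m, c, t)).
- by have [c [t ->]] := hq m; case: (hf (m, c, t)).
- by case: (hf (m.+1, (q m).1.1, (q m).1.2)).
- by case: (hf (m.+1, (q m).1.1, (q m).1.2)).
- by case: (hf (m.+1, (q m).1.1, (q m).1.2)).
Qed.

(** As no word is empty, the letter at position [n] lies within the first [n.+1] words. *)
Lemma concat_words (I : Type) (w : nat -> seq I) : (forall m, 0 < size (w m))%N ->
  exists (k : nat -> I) (off : nat -> nat), [/\ off 0%N = 0%N,
    forall m, off m.+1 = (off m + size (w m))%N &
    forall m j x0, (j < size (w m))%N -> k (off m + j)%N = nth x0 (w m) j].
Proof.
move=> w0; have [i0 _] : exists i0 : I, True by have := w0 0%N; case: (w 0%N) => // i; exists i.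
pose off m := size (flatten (mkseq w m)).
have offS m : off m.+1 = (off m + size (w m))%N.
  by rewrite /off mkseqS flatten_rcons size_cat.
have off_ge m : (m <= off m)%N by elim: m => // m IH; rewrite offS; have := w0 m; lia.
exists (fun n => nth i0 (flatten (mkseq w n.+1)) n), off; split=> // m j x0 jm.
set n := (off m + j)%N; have mn : (m <= n)%N by have := off_ge m; rewrite /n; lia.
have -> : mkseq w n.+1 = mkseq w m ++ w m :: [seq w i | i <- iota m.+1 (n - m)].
  rewrite /mkseq -map_cons -map_cat; congr map.
  have -> : n.+1 = (m + (n - m).+1)%N by lia.
  by rewrite iotaD.
rewrite flatten_cat nth_cat -/(off m) ltnNge leq_addr /= addKn nth_cat jm.
exact: set_nth_default.
Qed.

Lemma orbit_word (X I : Type) (P : I -> X -> X) (k : nat -> I) (z : nat -> X) n (w : seq I) :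
  (forall n, z n.+1 = P (k n) (z n)) ->
  (forall j x0, (j < size w)%N -> k (n + j)%N = nth x0 w j) ->
  z (n + size w)%N = foldl (fun x i => P i x) (z n) w.
Proof.
move=> zS; elim: w n => [|i w IH] n hw /=; first by rewrite addn0.
rewrite addnS -addSn IH ?zS; last first.
  by move=> j x0 jw; rewrite addSn -addnS (hw j.+1 x0).
by have := hw 0%N i; rewrite addn0 => ->.
Qed.

(** * Diverging orbits *)

(* Either [sg = om = 1] and [J] is the identity, or [sg = -1], [om = 0] and [J]
   is multiplication by i. *)
Record scalar_isometry (R : realType) (V : innerType R) (J : V -> V) (sg om : R) : Prop := {
  J_lin : forall a x y, J (a *: x + y) = a *: J x + J y;
  J_iso : forall x y, ip (J x) (J y) = ip x y;
  J_sq : forall x, J (J x) = sg *: x;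
  J_sg : sg * sg = 1;
  J_om : forall x, ip x (J x) = om * ip x x }.

Section ScalarIsometry.
Variables (R : realType) (V : innerType R) (J : V -> V) (sg om : R).
Hypothesis hJ : scalar_isometry J sg om.
Implicit Types (x y : V) (G : set V).

(** Orthogonality for the original scalars, in real terms. *)
Definition jorth x y := ip x y = 0 /\ ip x (J y) = 0.

Lemma J_adj x y : ip (J x) y = sg * ip x (J y).
Proof. by rewrite -(J_iso hJ x) (J_sq hJ) ipZr mulrA (J_sg hJ) mul1r. Qed.

Lemma J0 : J 0 = 0.
Proof. by apply: ip_eq0; rewrite (J_iso hJ) ip0l. Qed.

Lemma JD x y : J (x + y) = J x + J y.
Proof. by rewrite -{1}[x]scale1r (J_lin hJ) scale1r. Qed.

Lemma JZ a x : J (a *: x) = a *: J x.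
Proof. by rewrite -[a *: x]addr0 (J_lin hJ) J0 addr0. Qed.

Lemma J_sum (T : Type) (r : seq T) (P : pred T) (F : T -> V) :
  J (\sum_(i <- r | P i) F i) = \sum_(i <- r | P i) J (F i).
Proof. by elim/big_rec2: _ => [|i a b _ <-]; rewrite ?J0 ?JD. Qed.

Lemma jorth_sym x y : jorth x y -> jorth y x.
Proof. by move=> [h1 h2]; split; [rewrite ipC | rewrite ipC J_adj h2 mulr0]. Qed.

Lemma jorthZl a x y : jorth x y -> jorth (a *: x) y.
Proof. by move=> [h1 h2]; split; rewrite ipZl ?h1 ?h2 mulr0. Qed.

Lemma jorthZr a x y : jorth x y -> jorth x (a *: y).
Proof. by move=> /jorth_sym h; apply: jorth_sym; exact: jorthZl. Qed.

Lemma jorthDl x x' y : jorth x y -> jorth x' y -> jorth (x + x') y.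
Proof. by move=> [h1 h2] [h3 h4]; split; rewrite ipDl ?h1 ?h2 ?h3 ?h4 addr0. Qed.

Lemma jorth_suml (T : Type) (r : seq T) (P : pred T) (F : T -> V) y :
  (forall i, P i -> jorth (F i) y) -> jorth (\sum_(i <- r | P i) F i) y.
Proof.
move=> h; elim/big_ind: _ => //; last by move=> x x'; exact: jorthDl.
by split; rewrite ip0l.
Qed.

(* The closed [J]-stable subspace generated by [G]. *)
Definition jspan G : set V := ortho [set y | forall x, G x -> jorth x y].

Lemma csub_jspan G : csub (jspan G).
Proof. exact: csub_ortho. Qed.

Lemma sub_jspan G : G `<=` jspan G.
Proof. by move=> x Gx y /(_ x Gx) [h _]; rewrite ipC. Qed.

Lemma J_jspan G x : jspan G x -> jspan G (J x).
Proof.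
move=> h y hy; rewrite ipC J_adj ipC h ?mulr0 // => z Gz; have [h1 h2] := hy z Gz.
by split=> //; rewrite (J_sq hJ) ipZr h1 mulr0.
Qed.

End ScalarIsometry.

(** * Orthonormal families close to several subspaces *)

Section NearFamily.
Variables (R : realType) (V : hilbertType R) (J : V -> V) (sg om : R).
Hypothesis hJ : scalar_isometry J sg om.
Variables (I : finType) (L : I -> set V).
Hypothesis cL : forall i, csub (L i).
Hypothesis JL : forall i x, L i x -> L i (J x).

Lemma jspan_min (G X : set V) : csub X -> (forall x, X x -> X (J x)) -> G `<=` X ->
  jspan J G `<=` X.
Proof.
move=> cX JX GX x h; rewrite -(orthooK cX) => y hy; apply: h => z Gz; split.
  exact/hy/GX.
rewrite -[ip _ _]mul1r -(J_sg hJ) -mulrA -(J_adj hJ) hy ?mulr0 //.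
exact/JX/GX.
Qed.

(** Reduces the computation of a projection to an orthogonality check on generators. *)
Lemma proj_jspan (G : set V) x y : jspan J G y -> (forall w, G w -> jorth J w (x - y)) ->
  proj (jspan J G) x = y.
Proof.
move=> hy h; apply: proj_unique => //; first by case: (csub_jspan J G).
by move=> w hw; rewrite ipC; exact: hw.
Qed.

Lemma near_family (S : nat * nat -> {set I}) (tol : nat * nat -> R) :
  (forall q, approx_meet L (S q)) -> (forall q, 0 < tol q) ->
  exists (b : nat * nat -> V) (bi : I -> nat * nat -> V),
    [/\ forall q q', ip (b q) (b q') = (q == q')%:R,
        forall i q, i \in S q -> L i (bi i q),
        forall i q, i \in S q -> nr (bi i q - b q) <= tol q,
        forall i q, i \in S q -> ip (bi i q) (bi i q) = 1 &
        forall i q q', i \in S q -> i \in S q' -> q != q' -> jorth J (bi i q) (bi i q')].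
Proof.
move=> hS tol0.
pose qn n := odflt (0%N, 0%N) (unpickle n) : nat * nat.
(* One half keeps the projections of [b q] away from zero; the other bound pays once for projecting
   and once for normalising. *)
pose eta q := Num.min (2^-1) (tol q / 2).
have eta0 q : 0 < eta q by rewrite lt_min invr_gt0 divr_gt0 ?ltr0n.
(* New vectors are taken orthogonal to these for every earlier [y]: moving a projection across the
   inner product, the projections to a common [L i] become [jorth] too. *)
pose clo y : seq V := y :: [seq proj (L i) y | i <- enum I] ++
  [seq J (proj (L i) y) | i <- enum I].
pose good n (D : seq V) x := [/\ ip x x = 1, forall d, d \in D -> ip d x = 0 &
    forall i, i \in S (qn n) -> nr (x - proj (L i) x) <= eta (qn n)].
have /choice [f hf] : forall nD : nat * seq V, exists x, good nD.1 nD.2 x.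
  by move=> [n D]; exact: (hS (qn n) D _ (eta0 _)).
pose hist := fix hist n := if n is n'.+1 then f (n', flatten [seq clo y | y <- hist n']) :: hist n'
  else [::].
pose c n := f (n, flatten [seq clo y | y <- hist n]).
have hc n : good n (flatten [seq clo y | y <- hist n]) (c n) by exact: hf.
have histS n : hist n.+1 = c n :: hist n by [].
have mem_hist m n : (m < n)%N -> c m \in hist n.
  elim: n => // n IH; rewrite ltnS leq_eqVlt histS inE => /orP[/eqP ->|/IH ->].
    by rewrite eqxx.
  by rewrite orbT.
have perp m n y : (m < n)%N -> y \in clo (c m) -> ip y (c n) = 0.
  move=> mn hy; have [_ h _] := hc n; apply: h; apply/flattenP.
  by exists (clo (c m)) => //; apply: map_f; exact: mem_hist.
have clo1 y : y \in clo y by rewrite mem_head.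
have clo2 i y : proj (L i) y \in clo y.
  by rewrite inE mem_cat (map_f (fun i => proj (L i) y)) ?mem_enum ?orbT.
have clo3 i y : J (proj (L i) y) \in clo y.
  by rewrite inE mem_cat orbC (map_f (fun i => J (proj (L i) y))) ?mem_enum ?orbT.
pose b (q : nat * nat) := c (pickle q).
have qK (q : nat * nat) : qn (pickle q) = q by rewrite /qn pickleK.
have near i q : i \in S q -> nr (b q - proj (L i) (b q)) <= eta q.
  by move=> iS; have [_ _ h] := hc (pickle q); move: h; rewrite qK; apply.
have bb q : ip (b q) (b q) = 1 by case: (hc (pickle q)).
have half i q : i \in S q -> 2^-1 <= nr (proj (L i) (b q)).
  move=> /near h; have := nr_sub (b q) (proj (L i) (b q)); rewrite (nr1 (bb q)).
  have : eta q <= 2^-1 by rewrite ge_min lexx.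
  lra.
have Pn0 i q : i \in S q -> proj (L i) (b q) != 0.
  by move=> /half h; apply/eqP => e; move: h; rewrite e nr0; lra.
exists b, (fun i q => (nr (proj (L i) (b q)))^-1 *: proj (L i) (b q)); split.
- move=> q q'; have [->|qq] := eqVneq q q'; first exact: bb.
  have [h|h|h] := ltngtP (pickle q) (pickle q').
  + exact: (perp _ _ _ h (clo1 _)).
  + by rewrite ipC; exact: (perp _ _ _ h (clo1 _)).
  + by move: qq; rewrite (pcan_inj pickleK h) eqxx.
- by move=> i q _; apply: (subspZ _ (proj1 (cL i))); exact: (projX (cL i)).
- move=> i q iS; have h := half i q iS; have h1 := near i q iS.
  apply: le_trans (nr_tri (proj (L i) (b q)) _ _) _.
  have -> : nr ((nr (proj (L i) (b q)))^-1 *: proj (L i) (b q) - proj (L i) (b q)) =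
      1 - nr (proj (L i) (b q)).
    have p0 : 0 < nr (proj (L i) (b q)) by lra.
    have p1 : nr (proj (L i) (b q)) <= 1 by rewrite -(nr1 (bb q)); exact: (proj_le (cL i)).
    rewrite -[X in _ - X]scale1r -scalerBl nrZ ger0_norm.
      by rewrite mulrBl mul1r mulVf // gt_eqF.
    by rewrite subr_ge0 invf_ge1.
  have := nr_sub (b q) (proj (L i) (b q)); rewrite (nr1 (bb q)) (nrBC _ (b q)).
  have : eta q <= tol q / 2 by rewrite ge_min lexx orbT.
  lra.
- by move=> i q iS; apply: unitize; exact: Pn0.
- have lt i q q' : (pickle q < pickle q')%N ->
      jorth J (proj (L i) (b q')) (proj (L i) (b q)).
    move=> h; have LP := projX (cL i) (b q); have JP := JL LP.
    split; rewrite (proj_sym (cL i)); [rewrite (proj_id (cL i) LP)|rewrite (proj_id (cL i) JP)].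
    + by rewrite ipC; exact: (perp _ _ _ h (clo2 _ _)).
    + by rewrite ipC; exact: (perp _ _ _ h (clo3 _ _)).
  move=> i q q' _ _ qq; apply: (jorthZl); apply: (jorthZr hJ).
  have [h|h|h] := ltngtP (pickle q) (pickle q').
  + by apply: (jorth_sym hJ); exact: lt.
  + exact: lt.
  + by move: qq; rewrite (pcan_inj pickleK h) eqxx.
Qed.

End NearFamily.

Section Combination.
Variables (R : realType) (V : innerType R) (k : nat).
Implicit Types (a : 'rV[R]_k) (beta : 'I_k -> V).

Definition comb beta a : V := \sum_l a 0 l *: beta l.

Lemma combZD beta (r : R) a a' : comb beta (r *: a + a') = r *: comb beta a + comb beta a'.
Proof.
rewrite scaler_sumr -big_split; apply: eq_bigr => l _.
by rewrite !mxE scalerDl scalerA.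
Qed.

Lemma combB beta a a' : comb beta (a - a') = comb beta a - comb beta a'.
Proof. by rewrite addrC -scaleN1r combZD scaleN1r addrC. Qed.

Lemma comb_delta beta l : comb beta (delta_mx 0 l) = beta l.
Proof.
rewrite /comb (bigD1 l) //= mxE !eqxx scale1r big1 ?addr0 // => i /negbTE il.
by rewrite mxE il andbF scale0r.
Qed.

(** The weight [w] is 1 for the inner product of two families, and [om] when the second one is the
    image under [J] of the first. *)
Lemma comb_ip beta (gamma : 'I_k -> V) (w : R) a a' :
  (forall l l', ip (beta l) (gamma l') = w * (l == l')%:R) ->
  ip (comb beta a) (comb gamma a') = w * ip a a'.
Proof.
move=> h; rewrite row_ipE mulr_sumr ip_suml; apply: eq_bigr => l _.
rewrite ip_sumr (bigD1 l) //= big1 ?addr0 => [|l' /negbTE ll].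
  by rewrite ipZl ipZr h eqxx /= mulr1n; ring.
by rewrite ipZl ipZr h eq_sym ll /= mulr0n !mulr0.
Qed.

Lemma comb_nr beta a : (forall l l', ip (beta l) (beta l') = (l == l')%:R) ->
  nr (comb beta a) = nr a.
Proof.
by move=> h; rewrite /nr (comb_ip (w := 1)) ?mul1r // => l l'; rewrite h mul1r.
Qed.

Lemma comb_close beta (gamma : 'I_k -> V) (d : R) a :
  (forall l, nr (beta l - gamma l) <= d) ->
  nr (comb beta a - comb gamma a) <= k%:R * d * nr a.
Proof.
move=> h; rewrite -sumrB; apply: le_trans (nr_sum _ _ _) _.
rewrite -mulrA mulr_natl -[X in _ *+ X]card_ord -sumr_const.
apply: ler_sum => l _; rewrite -scalerBr nrZ mulrC.
by apply: ler_pM; rewrite ?nr_ge0 ?normr_ge0 // row_coord_le.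
Qed.

Lemma subsp_comb (X : set V) beta a : subsp X -> (forall l, X (beta l)) -> X (comb beta a).
Proof. by move=> sX h; apply: subsp_sum => // l _; exact: subspZ. Qed.

Lemma jorth_combl J beta a y : (forall l, jorth J (beta l) y) -> jorth J (comb beta a) y.
Proof. by move=> h; apply: jorth_suml => l _; exact: jorthZl. Qed.

End Combination.

(** * Geometry of the blocks and the errors of their projections *)

Section BlockGeometry.
Variables (R : realType) (V : hilbertType R) (J : V -> V) (sg om : R).
Hypothesis hJ : scalar_isometry J sg om.
Variables (I : finType) (A : nat -> {set I}) (c t p : nat -> I).
Let T m := A m :&: A m.+1.
Hypothesis cT : forall m, c m \in T m.
Hypothesis tT : forall m, t m \in T m.
Hypothesis pT : forall m, p m \in T m.
Hypothesis ct : forall m, c m != t m.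
Hypothesis cp : forall m, c m != p m.
Hypothesis tp : forall m, t m != p m.
Hypothesis tt : forall m, t m.+1 != t m.
Hypothesis tc : forall m, t m.+1 != c m.
Hypothesis cct : forall m, c m.+1 != t m.
Variables (n : nat -> nat) (kap tau : nat -> R).
Variables (TA TB : forall m, 'rV[R]_(n m).+2 -> 'rV[R]_(n m).+2).
Hypothesis hT : forall m, tilt (kap m) (@TA m) (@TB m).

(** A pair [(m, 0)] names the end vector shared by the blocks [m.-1] and [m], which must be close to
    all of [A m] and meet the tolerances of both blocks. *)
Definition near_set (q : nat * nat) : {set I} := if q.2 is 0%N then A q.1 else T q.1.
Definition near_tol (q : nat * nat) : R :=
  if q.2 is 0%N then Num.min (tau q.1) (tau q.1.-1) else tau q.1.

(* The block [m] is spanned by [b (m, 0)], [b (m.+1, 0)], which it shares with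
   the neighbouring blocks, and by the [b (m, l)] with [l] odd; the [b (m, l)]
   with [l > 0] even are the directions into which it is tilted. *)
Definition coreq m (l : 'I_(n m).+2) : nat * nat :=
  if l == 0%N :> nat then (m, 0%N) else if l == 1%N :> nat then (m.+1, 0%N)
  else (m, l.*2.+1).
Definition auxq m (l : 'I_(n m).+2) : nat * nat := (m, l.*2.+2).
Arguments coreq : clear implicits.
Arguments auxq : clear implicits.

Lemma coreqP m l : [\/ coreq m l = (m, 0%N) /\ l = 0%N :> nat,
  coreq m l = (m.+1, 0%N) /\ l = 1%N :> nat |
  exists2 l', coreq m l = (m, l'.*2.+1) & l = l' :> nat /\ (1 < l')%N].
Proof.
rewrite /coreq; case: eqP => [|/eqP h0]; first by constructor 1.
case: eqP => [|/eqP h1]; first by constructor 2.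
by constructor 3; exists l => //; split => //; lia.
Qed.

Lemma coreq_inj m : injective (@coreq m).
Proof.
move=> l l' e; apply: val_inj => /=; move: e.
case: (coreqP l) => [[-> e1]|[-> e1]|[k -> [e1 h]]];
  case: (coreqP l') => [[-> e2]|[-> e2]|[k' -> [e2 h']]];
  by move=> e; have /= e3 := congr1 fst e; have /= e4 := congr1 snd e; lia.
Qed.

Lemma auxq_inj m : injective (@auxq m).
Proof. by move=> l l' e; apply: val_inj => /=; have /= := congr1 snd e; lia. Qed.

Lemma core_aux m m' l l' : coreq m l != auxq m' l'.
Proof.
apply/eqP; rewrite /auxq.
by case: (coreqP l) => [[-> e1]|[-> e1]|[k -> [e1 h]]] e;
  have /= e3 := congr1 fst e; have /= e4 := congr1 snd e; lia.
Qed.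

Lemma aux_aux m m' l l' : m != m' -> auxq m l != auxq m' l'.
Proof. by apply: contra_neq => e; have /= := congr1 fst e. Qed.

Lemma core_core m m' l l' : m' != m -> m' != m.+1 -> m'.+1 != m -> coreq m l != coreq m' l'.
Proof.
move=> h1 h2 h3; apply/eqP.
case: (coreqP l) => [[-> e1]|[-> e1]|[k -> [e1 h]]];
  case: (coreqP l') => [[-> e2]|[-> e2]|[k' -> [e2 h']]];
  by move=> e; have /= e3 := congr1 fst e; have /= e4 := congr1 snd e; lia.
Qed.

Lemma mem_near_core m l i : i \in T m -> i \in near_set (coreq m l).
Proof.
move=> iT; have := iT; rewrite inE => /andP[h1 h2].
by case: (coreqP l) => [[-> _]|[-> _]|[k -> _]].
Qed.

Lemma mem_near_aux m l i : i \in T m -> i \in near_set (auxq m l).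
Proof. by []. Qed.

Lemma tol_core m l : near_tol (coreq m l) <= tau m.
Proof.
case: (coreqP l) => [[-> _]|[-> _]|[k -> _]] //=; rewrite /near_tol /= ge_min lexx //.
by rewrite orbT.
Qed.

Variables (b : nat * nat -> V) (bi : I -> nat * nat -> V).
Hypothesis bb : forall q q', ip (b q) (b q') = (q == q')%:R.
Hypothesis bib : forall i q, i \in near_set q -> nr (bi i q - b q) <= near_tol q.
Hypothesis bi1 : forall i q, i \in near_set q -> ip (bi i q) (bi i q) = 1.
Hypothesis bij : forall i q q', i \in near_set q -> i \in near_set q' -> q != q' ->
  jorth J (bi i q) (bi i q').

Definition core m := comb (fun l => b (coreq m l)).
Definition corei i m := comb (fun l => bi i (coreq m l)).
Definition auxi i m := comb (fun l => bi i (auxq m l)).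
Arguments core : clear implicits.
Arguments corei : clear implicits.
Arguments auxi : clear implicits.
Definition tilti i m a := corei i m (TA a) + auxi i m (TB a).

Arguments tilti : clear implicits.

(* In block [m], the space for [c m] contains all the core vectors, the space
   for [t m] their tilts, and the space for [p m] only the two end vectors. *)
Inductive gen (i : I) : set V :=
| GenJunction m : i \in A m -> t m != i -> t m.-1 != i -> gen i (bi i (m, 0%N))
| GenCore m l : c m = i -> gen i (bi i (coreq m l))
| GenTilt m (a : 'rV[R]_(n m).+2) : t m = i -> gen i (tilti i m a).

Definition Lsub i := jspan J (gen i).
Let d m : R := (n m).+2%:R * tau m.
Let sL i : subsp (Lsub i). Proof. by case: (csub_jspan J (gen i)). Qed.
Let cL i : csub (Lsub i). Proof. exact: csub_jspan. Qed.

Lemma core_nr m a : nr (core m a) = nr a.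
Proof. by apply: comb_nr => l l'; rewrite bb (inj_eq (@coreq_inj m)). Qed.

Lemma bi_ip i (q q' : nat * nat) : i \in near_set q -> i \in near_set q' ->
  ip (bi i q) (bi i q') = 1 * (q == q')%:R /\ ip (bi i q) (J (bi i q')) = om * (q == q')%:R.
Proof.
move=> h h'; have [->|qq] := eqVneq q q'.
  by rewrite (J_om hJ) bi1 // !mulr1.
by rewrite !mulr0; exact: bij.
Qed.

Lemma corei_ip i m a a' : i \in T m -> ip (corei i m a) (corei i m a') = ip a a' /\
  ip (corei i m a) (J (corei i m a')) = om * ip a a'.
Proof.
move=> iT; split.
  rewrite -[RHS]mul1r; apply: comb_ip => l l'.
  by rewrite (bi_ip (mem_near_core l iT) (mem_near_core l' iT)).1 (inj_eq (@coreq_inj m)).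
have -> : J (corei i m a') = comb (fun l => J (bi i (coreq m l))) a'.
  by rewrite /corei /comb (J_sum hJ); apply: eq_bigr => l _; rewrite (JZ hJ).
apply: comb_ip => l l'.
by rewrite (bi_ip (mem_near_core l iT) (mem_near_core l' iT)).2 (inj_eq (@coreq_inj m)).
Qed.

Lemma auxi_ip i m a a' : i \in T m -> ip (auxi i m a) (auxi i m a') = ip a a' /\
  ip (auxi i m a) (J (auxi i m a')) = om * ip a a'.
Proof.
move=> iT; split.
  rewrite -[RHS]mul1r; apply: comb_ip => l l'.
  by rewrite (bi_ip (mem_near_aux l iT) (mem_near_aux l' iT)).1 (inj_eq (@auxq_inj m)).
have -> : J (auxi i m a') = comb (fun l => J (bi i (auxq m l))) a'.
  by rewrite /auxi /comb (J_sum hJ); apply: eq_bigr => l _; rewrite (JZ hJ).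
apply: comb_ip => l l'.
by rewrite (bi_ip (mem_near_aux l iT) (mem_near_aux l' iT)).2 (inj_eq (@auxq_inj m)).
Qed.

Lemma auxi_nr i m a : i \in T m -> nr (auxi i m a) = nr a.
Proof. by move=> iT; rewrite /nr (auxi_ip _ _ iT).1. Qed.

Lemma corei_close i m a : i \in T m -> nr (corei i m a - core m a) <= d m * nr a.
Proof.
move=> iT; apply: comb_close => l; apply: le_trans (tol_core l).
by apply: bib; exact: mem_near_core.
Qed.

Lemma auxi_close i j m a : i \in T m -> j \in T m ->
  nr (auxi i m a - auxi j m a) <= 2 * (d m * nr a).
Proof.
move=> iT jT; have -> : 2 * (d m * nr a) = (n m).+2%:R * (2 * tau m) * nr a.
  by rewrite /d; ring.
apply: comb_close => l; apply: le_trans (nr_tri (b (auxq m l)) _ _) _.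
rewrite (nrBC (b _)); have := @bib i (auxq m l) iT; have := @bib j (auxq m l) jT.
by rewrite /near_tol /=; lra.
Qed.

Lemma tilt_pythag m a : nr (@TA m a) ^+ 2 + nr (@TB m a) ^+ 2 = nr a ^+ 2.
Proof.
rewrite !nrE (tiltA_sym (hT m)) (tiltB_sym (hT m)) -ipDr (tilt_sum (hT m)) //.
Qed.

Lemma TA_le m a : nr (@TA m a) <= nr a.
Proof.
by rewrite -ler_sqr ?nnegrE ?nr_ge0 // -(tilt_pythag a) lerDl sqr_ge0.
Qed.

Lemma TB_le m a : nr (@TB m a) <= nr a.
Proof.
by rewrite -ler_sqr ?nnegrE ?nr_ge0 // -(tilt_pythag a) lerDr sqr_ge0.
Qed.

Lemma gen_jorth i x : (forall w, gen i w -> jorth J x w) -> forall w, gen i w -> jorth J w x.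
Proof. by move=> h w /h; exact: (jorth_sym hJ). Qed.

Lemma proj_core m a a' :
  proj (Lsub (c m)) (corei (c m) m a + auxi (c m) m a') = corei (c m) m a.
Proof.
apply: proj_jspan.
  by apply: subsp_comb; [exact: (sL (c m)) | move=> l; apply: sub_jspan; exact: GenCore].
rewrite [_ + auxi _ _ _]addrC addrK; apply: gen_jorth => w gw; apply: jorth_combl => l.
case: gw => [m' iA _ _|m' l' e|m' a0 e].
- by apply: (bij (mem_near_aux l (cT m))) => //; rewrite xpair_eqE andbF.
- have iT' : c m \in T m' by rewrite -e.
  apply: (bij (mem_near_aux l (cT m)) (mem_near_core l' iT')).
  by rewrite eq_sym core_aux.
- have mm : m != m' by apply: contraTneq (ct m) => em; move: e; rewrite -em => ->; rewrite eqxx.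
  have iT' : c m \in T m' by rewrite -e.
  apply: (jorth_sym hJ); apply: jorthDl; apply: jorth_combl => l'.
    exact: (bij (mem_near_core l' iT') (mem_near_aux l (cT m)) (core_aux _ _)).
  apply: (bij (mem_near_aux l' iT') (mem_near_aux l (cT m))).
  by apply: aux_aux; rewrite eq_sym.
Qed.

(** Only the neighbouring blocks share vectors with block [m], and by the choice of roles [t m] is
    neither a tilted nor a core index there. *)
Lemma proj_tilt m a : proj (Lsub (t m)) (corei (t m) m a) = tilti (t m) m (TA a).
Proof.
set i := t m; have iT : i \in T m by exact: tT.
apply: proj_jspan; first by apply: sub_jspan; exact: GenTilt.
(* As [A] and [B] commute, the residual is the pair [(B, - A)] applied to [B a], which is orthogonal
   to every tilted vector [(A a', B a')]. *)
have -> : corei i m a - tilti i m (TA a) = corei i m (TB (TB a)) - auxi i m (TB (TA a)).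
  rewrite opprD addrA -combB; congr (corei i m _ - _).
  by apply/eqP; rewrite subr_eq addrC (tilt_sum (hT m)).
have far m' : m' != m -> m' != m.+1 -> m'.+1 != m -> i \in T m' ->
    forall a0 a1 l, jorth J (corei i m a0 - auxi i m a1) (bi i (coreq m' l)) /\
      jorth J (corei i m a0 - auxi i m a1) (bi i (auxq m' l)).
  move=> h1 h2 h3 iT' a0 a1 l; rewrite -scaleN1r.
  split; apply: jorthDl; try (apply: jorthZl); apply: jorth_combl => l'.
  - exact: (bij (mem_near_core l' iT) (mem_near_core l iT') (core_core _ _ h1 h2 h3)).
  - apply: (bij (mem_near_aux l' iT) (mem_near_core l iT')).
    by rewrite eq_sym core_aux.
  - exact: (bij (mem_near_core l' iT) (mem_near_aux l iT') (core_aux _ _)).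
  - apply: (bij (mem_near_aux l' iT) (mem_near_aux l iT')).
    by apply: aux_aux; rewrite eq_sym.
apply: gen_jorth => w; case=> [m' iA h1 h2|m' l e|m' a' e].
- have mm : m' != m by apply: contraNneq h1 => ->.
  have mm1 : m' != m.+1 by apply: contraNneq h2 => ->.
  rewrite -scaleN1r; apply: jorthDl; try (apply: jorthZl); apply: jorth_combl => l.
    apply: (bij (mem_near_core l iT)) => //.
    by apply/eqP; case: (coreqP l) => [[-> _]|[-> _]|[k -> _]] e;
      have /= e1 := congr1 fst e; have /= e2 := congr1 snd e; move: mm mm1; lia.
  apply: (bij (mem_near_aux l iT)) => //.
  by apply/eqP => e; have /= := congr1 snd e.
- have iT' : i \in T m' by rewrite -e.
  apply: (far m' _ _ _ iT' _ _ l).1.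
  + by apply: contraTneq (ct m) => e'; move: e; rewrite e' => ->; rewrite eqxx.
  + by apply: contraTneq (cct m) => e'; move: e; rewrite e' => ->; rewrite eqxx.
  + by apply: contraTneq (tc m') => e'; rewrite e' e eqxx.
- have [e'|mm] := eqVneq m' m.
    move: a' e; rewrite e' => a' _.
    have key : ip (TB (TB a)) (TA a') = ip (TB (TA a)) (TB a').
      rewrite [LHS](tiltB_sym (hT m)) -(tilt_comm (hT m) a) (tiltA_sym (hT m)).
      by rewrite (tilt_comm (hT m)).
    have co l l' : jorth J (bi i (coreq m l)) (bi i (auxq m l')).
      exact: (bij (mem_near_core l iT) (mem_near_aux l' iT) (core_aux _ _)).
    have cx x y : jorth J (corei i m x) (auxi i m y).
      apply: jorth_combl => l; apply: (jorth_sym hJ); apply: jorth_combl => l'.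
      by apply: (jorth_sym hJ).
    have [cx1 cx2] := cx (TB (TB a)) (TB a').
    have [cx3 cx4] := jorth_sym hJ (cx (TA a') (TB (TA a))).
    split.
      by rewrite ipBl !ipDr cx1 cx3 (corei_ip _ _ iT).1 (auxi_ip _ _ iT).1 key; ring.
    rewrite (JD hJ) ipBl !ipDr cx2 cx4 (corei_ip _ _ iT).2 (auxi_ip _ _ iT).2 key; ring.
  have iT' : i \in T m' by rewrite -e.
  have mm1 : m' != m.+1 by apply: contraTneq (tt m) => e'; move: e; rewrite e' => ->; rewrite eqxx.
  have mm2 : m'.+1 != m by apply: contraTneq (tt m') => e'; rewrite e' e eqxx.
  apply: (jorth_sym hJ); apply: jorthDl; apply: jorth_combl => l; apply: (jorth_sym hJ).
    exact: (far m' mm mm1 mm2 iT' _ _ l).1.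
  exact: (far m' mm mm1 mm2 iT' _ _ l).2.
Qed.

Lemma proj_plane_core m (l : 'I_(n m).+2) : (1 < l)%N ->
  proj (Lsub (p m)) (bi (p m) (coreq m l)) = 0.
Proof.
move=> l1; have pl := mem_near_core l (pT m).
apply: proj_ortho0 => //; suff h : forall w, gen (p m) w -> jorth J w (bi (p m) (coreq m l)).
  by move=> y yL; rewrite ipC; apply: yL.
have [l0 el [_ l2]] : exists2 l', coreq m l = (m, l'.*2.+1) & l = l' :> nat /\ (1 < l')%N.
  by case: (coreqP l) => [[_ e]|[_ e]|//]; move: l1; rewrite e.
have far m' : m' != m -> p m \in T m' ->
    forall l', jorth J (bi (p m) (coreq m l)) (bi (p m) (coreq m' l')).
  move=> mm iT' l'; apply: (bij pl (mem_near_core l' iT')); rewrite el; apply/eqP.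
  by case: (coreqP l') => [[-> _]|[-> _]|[k -> _]] e;
    have /= e1 := congr1 fst e; have /= e2 := congr1 snd e; move: mm; lia.
apply: gen_jorth => w; case=> [m' iA _ _|m' l' e|m' a e].
- by apply: (bij pl) => //; rewrite el; apply/eqP => e; have /= := congr1 snd e.
- apply: far; last by rewrite -e.
  by apply: contraTneq (cp m) => e'; move: e; rewrite e' => ->; rewrite eqxx.
- have mm : m' != m by apply: contraTneq (tp m) => e'; move: e; rewrite e' => ->; rewrite eqxx.
  have iT' : p m \in T m' by rewrite -e.
  apply: (jorth_sym hJ); apply: jorthDl; apply: jorth_combl => l'; apply: (jorth_sym hJ).
    exact: far.
  exact: (bij pl (mem_near_aux l' iT') (core_aux _ _)).
Qed.

(** One summand for each of the two blocks in which the end vector may have been replaced by a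
    tilted one. *)
Definition jct m : R := 2 * kap m + d m + (2 * kap m.-1 + d m.-1).

Hypothesis tau0 : forall m, 0 < tau m.
Hypothesis kap0 : forall m, 0 < kap m.

Let d0 m : 0 <= d m. Proof. by rewrite mulr_ge0 // ltW. Qed.

Lemma tilti_near i m (l : 'I_(n m).+2) : t m = i ->
  exists2 y, Lsub i y & nr (b (coreq m l) - y) <= 2 * kap m + d m.
Proof.
move=> e; have iT : i \in T m by rewrite -e.
pose a : 'rV[R]_(n m).+2 := delta_mx 0 l.
have a1 : nr a = 1 by apply: nr1; rewrite ip_delta mxE !eqxx.
exists (tilti i m a); first by apply: sub_jspan; exact: GenTilt.
have -> : b (coreq m l) = core m a by rewrite /core comb_delta.
rewrite opprD addrA; apply: le_trans (nrB _ _) _.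
rewrite auxi_nr //; have := tiltB_small (hT m) a; rewrite a1 mulr1 => h1.
have h2 := nr_tri (core m (TA a)) (core m a) (corei i m (TA a)).
have h3 : nr (core m a - core m (TA a)) <= kap m.
  by rewrite -combB core_nr nrBC; have := tiltA_near (hT m) a; rewrite a1 mulr1.
have h4 := corei_close (TA a) iT; rewrite nrBC in h4.
have h5 : d m * nr (TA a) <= d m by rewrite -[leRHS]mulr1 ler_wpM2l // -a1 TA_le.
lra.
Qed.

(** Either [i] is a tilted index of one of the two blocks, and the tilted end vector is close, or
    the approximation of the end vector in [L i] is itself a generator. *)
Lemma junction i m : i \in A m -> nr (proj (Lsub i) (b (m, 0%N)) - b (m, 0%N)) <= jct m.
Proof.
move=> iA; rewrite nrBC.
have k1 := kap0 m; have k2 := kap0 m.-1; have d1 := d0 m; have d2 := d0 m.-1.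
suff [y yL hy] : exists2 y, Lsub i y & nr (b (m, 0%N) - y) <= jct m.
  exact: le_trans (proj_dist (cL i) _ yL) hy.
have [e|h1] := eqVneq (t m) i.
  have [y yL hy] := tilti_near ord0 e; exists y => //; apply: le_trans hy _.
  by rewrite /jct; lra.
have [e|h2] := eqVneq (t m.-1) i.
  case: m => [|m] /= in iA h1 e k1 k2 d1 d2 *; first by rewrite e eqxx in h1.
  have [y yL hy] := tilti_near (ord1' (n m)) e; exists y => //; apply: le_trans hy _.
  by rewrite /jct /=; lra.
exists (bi i (m, 0%N)); first by apply: sub_jspan; exact: GenJunction.
rewrite nrBC; apply: le_trans (bib _) _ => //.
rewrite /near_tol /jct /=; apply: le_trans (_ : tau m <= _); first by rewrite ge_min lexx.
have : tau m <= d m by rewrite /d ler_peMl ?ler1n // ltW.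
lra.
Qed.

(** The bound is free of [kap], so these steps may be repeated as often as the tilt requires. Of the
    6, four come from exchanging the approximating vectors of [t m] for those of [c m], and one each
    from entering and leaving the model. *)
Lemma core_tilt_step m a :
  nr (proj (Lsub (c m)) (proj (Lsub (t m)) (core m a)) - core m (TA (TA a))) <=
  6 * d m * nr a.
Proof.
have tTm := tT m; have cTm := cT m.
pose i := t m; pose j := c m.
have h1 : nr (proj (Lsub i) (core m a) - tilti i m (TA a)) <= d m * nr a.
  rewrite -proj_tilt; apply: le_trans (proj_lip (cL _) _ _) _.
  by rewrite nrBC corei_close.
have h2 : nr (tilti i m (TA a) - tilti j m (TA a)) <= 4 * d m * nr a.
  rewrite /tilti opprD addrACA; apply: le_trans (nrD _ _) _.
  have g1 := auxi_close (TB (TA a)) tTm cTm.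
  have g2 := nr_tri (core m (TA (TA a))) (corei i m (TA (TA a))) (corei j m (TA (TA a))).
  have g3 := corei_close (TA (TA a)) tTm.
  have g4 := corei_close (TA (TA a)) cTm; rewrite nrBC in g4.
  have g5 : d m * nr (TB (TA a)) <= d m * nr a.
    by rewrite ler_wpM2l // (le_trans (TB_le _)) // TA_le.
  have g6 : d m * nr (TA (TA a)) <= d m * nr a.
    by rewrite ler_wpM2l // (le_trans (TA_le _)) // TA_le.
  rewrite -/i -/j in g1 g3 g4 *; lra.
have h3 : nr (corei j m (TA (TA a)) - core m (TA (TA a))) <= d m * nr a.
  apply: le_trans (corei_close _ cTm) _.
  by rewrite ler_wpM2l // (le_trans (TA_le _)) // TA_le.
apply: le_trans (nr_tri (proj (Lsub j) (tilti j m (TA a))) _ _) _.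
rewrite [X in _ + nr (X - _)]proj_core.
have h4 := proj_lip (cL j) (proj (Lsub i) (core m a)) (tilti j m (TA a)).
have h5 := nr_tri (tilti i m (TA a)) (proj (Lsub i) (core m a)) (tilti j m (TA a)).
rewrite -/i -/j in h4 h5 *; lra.
Qed.

(** The end coordinates move by the junction errors; all others are almost annihilated. *)
Lemma core_plane_step m a :
  nr (proj (Lsub (p m)) (core m a) - core m (Pl (delta_mx 0 ord0) (delta_mx 0 (ord1' (n m))) a)) <=
  (jct m + jct m.+1 + d m) * nr a.
Proof.
have pA : p m \in A m /\ p m \in A m.+1 by have := pT m; rewrite inE => /andP[].
have j0 k : 0 <= jct k.
  have := kap0 k; have := kap0 k.-1; have := d0 k; have := d0 k.-1.
  by rewrite /jct => h1 h2 h3 h4; lra.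
pose E l := proj (Lsub (p m)) (b (coreq m l)).
have -> : proj (Lsub (p m)) (core m a) = \sum_l a 0 l *: E l.
  by rewrite proj_sum //; apply: eq_bigr => l _; rewrite projZ.
have -> : core m (Pl (delta_mx 0 ord0) (delta_mx 0 (ord1' (n m))) a) =
    a 0 ord0 *: b (m, 0%N) + a 0 (ord1' (n m)) *: b (m.+1, 0%N).
  rewrite /Pl !ip_delta /core combZD comb_delta; congr (_ + _).
  by rewrite -[X in comb _ X]addr0 combZD comb_delta -(subrr (0 : 'rV[R]_(n m).+2)) combB
    subrr addr0.
rewrite big_ord_recl big_ord_recl.
have ac (l : 'I_(n m).+2) : `|a 0 l| <= nr a by exact: row_coord_le.
have -> : lift ord0 ord0 = ord1' (n m) by [].
set rest := \sum_(l < n m) _.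
have e1 : nr (a 0 ord0 *: E ord0 - a 0 ord0 *: b (m, 0%N)) <= jct m * nr a.
  rewrite -scalerBr nrZ mulrC ler_pM ?nr_ge0 ?normr_ge0 //; exact: junction pA.1.
have e2 : nr (a 0 (ord1' (n m)) *: E (ord1' (n m)) - a 0 (ord1' (n m)) *: b (m.+1, 0%N)) <=
    jct m.+1 * nr a.
  rewrite -scalerBr nrZ mulrC ler_pM ?nr_ge0 ?normr_ge0 //; exact: junction pA.2.
have e3 : nr rest <= d m * nr a.
  apply: le_trans (nr_sum _ _ _) _; rewrite /d.
  apply: le_trans (_ : (n m)%:R * (tau m * nr a) <= _); last first.
    rewrite mulrA ler_wpM2r ?nr_ge0 // ler_wpM2r ?ler_nat //; [exact: ltW | lia].
  rewrite mulr_natl -[X in _ *+ X]card_ord -sumr_const; apply: ler_sum => l _.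
  set l' := lift ord0 (lift ord0 l).
  rewrite nrZ mulrC ler_pM ?nr_ge0 ?normr_ge0 //.
  have pl := mem_near_core l' (pT m).
  have := proj_lip (cL (p m)) (b (coreq m l')) (bi (p m) (coreq m l')).
  rewrite proj_plane_core // subr0 => h; apply: le_trans h _.
  by rewrite nrBC; apply: le_trans (bib pl) _; exact: tol_core.
have -> : a 0 ord0 *: E ord0 + (a 0 (ord1' (n m)) *: E (ord1' (n m)) + rest) -
    (a 0 ord0 *: b (m, 0%N) + a 0 (ord1' (n m)) *: b (m.+1, 0%N)) =
    (a 0 ord0 *: E ord0 - a 0 ord0 *: b (m, 0%N)) +
    ((a 0 (ord1' (n m)) *: E (ord1' (n m)) - a 0 (ord1' (n m)) *: b (m.+1, 0%N)) + rest).
  by rewrite opprD addrACA; congr (_ + _); rewrite addrAC.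
apply: le_trans (nrD _ _) _.
have := nrD (a 0 (ord1' (n m)) *: E (ord1' (n m)) - a 0 (ord1' (n m)) *: b (m.+1, 0%N)) rest.
lra.
Qed.

Let Pl01 m := Pl (delta_mx 0 ord0 : 'rV[R]_(n m).+2) (delta_mx 0 (ord1' (n m))).
Let step (x : V) (i : I) := proj (Lsub i) x.

Lemma TA_TA_le m a : nr (@TA m (TA a)) <= nr a.
Proof. by apply: le_trans (TA_le _) _; exact: TA_le. Qed.

Lemma Pl01_le m a : nr (@Pl01 m a) <= nr a.
Proof. by apply: Pl_le; rewrite ip_delta mxE ?eqxx. Qed.

Lemma tilt_turns s m a x : nr a <= 1 ->
  nr (foldl step x (flatten (nseq s [:: t m; c m])) - core m (iter s (@TA m \o @TA m) a)) <=
  nr (x - core m a) + s%:R * (6 * d m).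
Proof.
elim: s x a => [|s IH] x a a1; first by rewrite /= mul0r addr0.
rewrite iterSr; apply: le_trans (IH _ _ _) _.
  by apply: le_trans (TA_TA_le _) a1.
have h1 := core_tilt_step a.
have h2 : nr (step (step x (t m)) (c m) - proj (Lsub (c m)) (proj (Lsub (t m)) (core m a))) <=
    nr (x - core m a).
  by apply: le_trans (proj_lip (cL _) _ _) _; exact: (proj_lip (cL _)).
have h3 := nr_tri (proj (Lsub (c m)) (proj (Lsub (t m)) (core m a)))
  (step (step x (t m)) (c m)) (core m (TA (TA a))).
have h4 : 6 * d m * nr a <= 6 * d m.
  by rewrite -[leRHS]mulr1 ler_wpM2l // mulr_ge0.
rewrite /= -natr1; lra.
Qed.

Definition block_word m (ss : seq nat) : seq I :=
  flatten [seq flatten (nseq s [:: t m; c m]) ++ [:: p m] | s <- ss].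

Lemma block_word_close ss m a x : nr a <= 1 ->
  nr (foldl step x (block_word m ss) -
      core m (foldl (fun a s => Pl01 (iter s (@TA m \o @TA m) a)) a ss)) <=
  nr (x - core m a) + (sumn ss)%:R * (6 * d m) + (size ss)%:R * (jct m + jct m.+1 + d m).
Proof.
elim: ss x a => [|s ss IH] x a a1; first by rewrite /= !mul0r !addr0.
rewrite /block_word /= -/(block_word m ss) foldl_cat foldl_cat /=.
set y := foldl step x _; set a' := iter s _ a.
have a'1 : nr a' <= 1.
  rewrite /a'; elim: (s) => //= s' h.
  exact: le_trans (TA_TA_le _) h.
have hy : nr (y - core m a') <= nr (x - core m a) + s%:R * (6 * d m) by exact: tilt_turns.
have a2 : nr (Pl01 a') <= 1 by apply: le_trans (Pl01_le _) a'1.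
apply: le_trans (IH _ _ a2) _.
have h1 := core_plane_step a'.
have h2 : nr (step y (p m) - proj (Lsub (p m)) (core m a')) <= nr (y - core m a').
  exact: (proj_lip (cL _)).
have h3 := nr_tri (proj (Lsub (p m)) (core m a')) (step y (p m)) (core m (Pl01 a')).
have j0 k : 0 <= jct k.
  by have := kap0 k; have := kap0 k.-1; have := d0 k; have := d0 k.-1;
    rewrite /jct => g1 g2 g3 g4; lra.
have jd : 0 <= jct m + jct m.+1 + d m by have := j0 m; have := j0 m.+1; have := d0 m; lra.
have h4 : (jct m + jct m.+1 + d m) * nr a' <= jct m + jct m.+1 + d m.
  by rewrite -[leRHS]mulr1 ler_wpM2l.
rewrite natrD -natr1 /Pl01 in h1 h3 *; lra.
Qed.

(** The initial letters [enum (A m)] nearly fix the end vector; they make every index of [A m]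
    occur, since the block itself uses only three indices. *)
Lemma stage m ss x :
  nr (foldl step x (enum (A m) ++ block_word m ss) -
      core m (foldl (fun a s => Pl01 (iter s (@TA m \o @TA m) a)) (delta_mx 0 ord0) ss)) <=
  nr (x - b (m, 0%N)) + #|A m|%:R * jct m +
  (sumn ss)%:R * (6 * d m) + (size ss)%:R * (jct m + jct m.+1 + d m).
Proof.
rewrite foldl_cat; apply: le_trans (block_word_close _ _ _) _.
  by rewrite (nr1 _) // ip_delta mxE !eqxx.
have e0 : coreq m ord0 = (m, 0%N) by [].
rewrite !lerD2r /core comb_delta e0 cardE.
have : {subset enum (A m) <= A m} by move=> i; rewrite mem_enum.
elim: (enum (A m)) x => [|i s IH] x hs /=; first by rewrite mul0r addr0.
apply: le_trans (IH _ _) _; first by move=> j js; apply: hs; rewrite inE js orbT.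
have iA : i \in A m by apply: hs; rewrite mem_head.
have h1 := junction iA; have h2 := proj_lip (cL i) x (b (m, 0%N)).
have h3 := nr_tri (proj (Lsub i) (b (m, 0%N))) (step x i) (b (m, 0%N)).
rewrite -natr1 /step in h2 h3 *; lra.
Qed.

Lemma core1 m : core m (delta_mx 0 (ord1' (n m))) = b (m.+1, 0%N).
Proof. by rewrite /core comb_delta. Qed.

End BlockGeometry.

Lemma approx_meet_sub (R : realType) (V : hilbertType R) (I : finType) (L : I -> set V)
    (A B : {set I}) : A \subset B -> approx_meet L B -> approx_meet L A.
Proof.
move=> /fintype.subsetP AB hB D e e0; have [x [h1 h2 h3]] := hB D e e0.
by exists x; split=> // i /AB; exact: h3.
Qed.

(** * Choice of the tilt bounds *)

Section Tolerances.
Variables (R : realType) (eta : nat -> R) (N : nat -> nat).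
Hypothesis eta0 : forall m, 0 < eta m.

(** A stage costs at most [30 * rho m + 13 * N m * rho m] besides [eta m / 4], so 64 leaves room.
    The minimum in [theta] is needed because the errors of stage [m] involve the tilts of both
    neighbouring blocks. *)
Definition rho m : R := eta m / (64 * (N m).+1%:R).
Definition theta m : R :=
  Num.min (Num.min (rho m) 1) (Num.min (rho m.-1) (rho m.+1)).

Lemma rho_gt0 m : 0 < rho m.
Proof. by rewrite divr_gt0 // mulr_gt0 // ltr0n. Qed.

Lemma theta_gt0 m : 0 < theta m.
Proof. by rewrite !lt_min !rho_gt0 ltr01. Qed.

Lemma theta_le1 m : theta m <= 1.
Proof. by rewrite !ge_min lexx !orbT. Qed.

Lemma theta_le m : [/\ theta m <= rho m, theta m <= rho m.-1 & theta m <= rho m.+1].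
Proof. by split; rewrite !ge_min lexx ?orbT. Qed.

Lemma theta_pred_le m : theta m.-1 <= rho m.
Proof. by case: m => [|m] /=; [case: (theta_le 0) | case: (theta_le m)]. Qed.

Lemma theta_succ_le m : theta m.+1 <= rho m.
Proof. by case: (theta_le m.+1). Qed.

Lemma rho_small m : 64 * (rho m + (N m)%:R * rho m) <= eta m.
Proof.
have -> : 64 * (rho m + (N m)%:R * rho m) = rho m * (64 * (N m).+1%:R).
  by rewrite -natr1; ring.
by rewrite /rho divfK // gt_eqF // mulr_gt0 // ltr0n.
Qed.

End Tolerances.

Lemma sufficiency (R : realType) (V : hilbertType R) (J : V -> V) (sg om : R)
    (I : finType) (L : I -> set V) (W : {set {set I}}) :
  scalar_isometry J sg om -> (exists i : I, True) ->
  (forall i, csub (L i)) -> (forall i x, L i x -> L i (J x)) ->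
  (forall A, A \in W -> #|A| = 4%N) -> finset.cover W = finset.setT ->
  {in W &, forall A B, connect
     [rel C D | [&& C \in W, D \in W & (C != D) && (#|C :&: D|%SET == 3%N)]] A B} ->
  (forall A, A \in W -> approx_meet L A) ->
  exists (z0 : V) (k : nat -> I) (M : I -> set V),
    [/\ forall i N, exists n, (N <= n)%N /\ k n = i,
        forall i, [/\ csub (M i), forall x, M i x -> M i (J x) & M i `<=` L i] &
        forall z, z 0%N = z0 -> (forall n, z n.+1 = proj (M (k n)) (z n)) ->
          ~ exists l, converges z l].
Proof.
move=> hJ [i0 _] cL JL W4 covW connW apW.
have inW i : exists2 A, A \in W & i \in A.
  have : i \in finset.cover W by rewrite covW finset.in_setT.
  by move=> /bigcupP [A AW iA]; exists A.
have [|x y|A [AW Astep Arec]] := recurrent_walk connW.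
- by have [A AW _] := inW i0; exists A.
- by move=> /= /and3P[].
have T3 m : (3 <= #|A m :&: A m.+1|)%N.
  case: (Astep m) => [<-|/= /and3P[_ _ /andP[_ /eqP -> //]]].
  by rewrite finset.setIid W4.
have [c [t [p [hin hne tt tc cct]]]] := choose_roles T3.
have cT m : c m \in A m :&: A m.+1 by case: (hin m).
have tT m : t m \in A m :&: A m.+1 by case: (hin m).
have pT m : p m \in A m :&: A m.+1 by case: (hin m).
have ct m : c m != t m by case: (hne m).
have cp m : c m != p m by case: (hne m).
have tp m : t m != p m by case: (hne m).
pose half m : R := (2 ^+ m)^-1.
have half0 m : 0 < half m by rewrite invr_gt0 exprn_gt0.
have halfS m : half m.+1 = half m / 2 by rewrite /half exprS invfM mulrC.
(* The error allowed in stage [m]; these sum to one third. *)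
pose eta m := half m.+1 / 3.
have eta0 m : 0 < eta m by rewrite divr_gt0.
(* Fixed for all blocks before any tilt, so that [kap m] may depend on [N] at the neighbouring
   blocks. *)
have /choice [nN hnN] : forall m, exists nN : nat * nat, forall kap, 0 < kap -> kap <= 1 ->
    exists ABs : ('rV[R]_nN.1.+2 -> 'rV[R]_nN.1.+2) * ('rV[R]_nN.1.+2 -> 'rV[R]_nN.1.+2) *
      seq nat,
    [/\ size ABs.2 = nN.2, tilt kap ABs.1.1 ABs.1.2 &
      nr (foldl (fun x s => Pl (delta_mx 0 ord0) (delta_mx 0 (ord1' nN.1))
        (iter s (ABs.1.1 \o ABs.1.1) x)) (delta_mx 0 ord0) ABs.2 -
        delta_mx 0 (ord1' nN.1)) <= eta m / 4].
  move=> m; have [n [N hN]] := tilt_model (divr_gt0 (eta0 m) (ltr0n R 4)).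
  exists (n, N) => kap k0 k1; have [B [B' [ss h]]] := hN kap k0 k1.
  by exists (B, B', ss).
pose n m := (nN m).1; pose N m := (nN m).2.
pose kap := theta eta N.
have kap0 m : 0 < kap m by exact: theta_gt0.
(* [cid] instead of [choice], as the type of the operators depends on [m]. *)
have hABs m := cid (hnN m (kap m) (kap0 m) (theta_le1 eta N m)).
pose TA m := (sval (hABs m)).1.1; pose TB m := (sval (hABs m)).1.2.
pose ss m := (sval (hABs m)).2.
have hss m : size (ss m) = N m by case: (svalP (hABs m)).
have hT m : tilt (kap m) (TA m) (TB m) by case: (svalP (hABs m)).
have hend m : nr (foldl (fun x s => Pl (delta_mx 0 ord0) (delta_mx 0 (ord1' (n m)))
    (iter s (TA m \o TA m) x)) (delta_mx 0 ord0) (ss m) - delta_mx 0 (ord1' (n m))) <= eta m / 4.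
  by case: (svalP (hABs m)).
(* Chosen so that [d m] times the number of iterations stays below [kap m]. *)
pose tau m : R := kap m / ((n m).+2%:R * (sumn (ss m)).+1%:R).
have tau0 m : 0 < tau m by rewrite divr_gt0 // mulr_gt0 // ltr0n.
have tolpos q : 0 < near_tol tau q.
  by rewrite /near_tol; case: q.2 => // ; rewrite lt_min !tau0.
have apS q : approx_meet L (near_set A q).
  rewrite /near_set; case: q.2 => [|_]; first exact: apW.
  by apply: approx_meet_sub (apW _ (AW q.1)); exact: finset.subsetIl.
have [b [bi [bb biL bib bi1 bij]]] := near_family hJ cL JL apS tolpos.
pose M i := Lsub J A c t TA TB bi i.
have cM i : csub (M i) by exact: csub_jspan.
have JM i x : M i x -> M i (J x) by exact: (J_jspan hJ).
have sLi i : subsp (L i) by case: (cL i).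
have ML i : M i `<=` L i.
  apply: (jspan_min hJ (cL i) (JL i)) => x [m iA _ _|m l e|m a e].
  - exact: biL.
  - by apply: biL; apply: mem_near_core; rewrite -e.
  - have iT : i \in A m :&: A m.+1 by rewrite -e.
    apply: subspD => //; apply: subsp_comb => // l; apply: biL.
      exact: mem_near_core.
    exact: mem_near_aux.
pose w m := enum (A m) ++ block_word c t p m (ss m).
have w0 m : (0 < size (w m))%N by rewrite size_cat -cardE W4.
have [k [off [off0 offS hk]]] := concat_words w0.
have off_ge m : (m <= off m)%N by elim: m => // m IH; rewrite offS; have := w0 m; lia.
exists (b (0%N, 0%N)), k, M; split=> //.
  move=> i M0; have [B BW iB] := inW i; have [m [Mm eB]] := Arec B M0 BW.
  have iw : i \in enum (A m) by rewrite mem_enum eB.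
  have jw : (index i (enum (A m)) < size (w m))%N.
    by rewrite size_cat ltn_addr // index_mem.
  exists (off m + index i (enum (A m)))%N; split; first by have := off_ge m; lia.
  by rewrite (hk m _ i0 jw) nth_cat index_mem iw nth_index.
  by move=> i; split; [exact: cM | exact: JM | exact: ML].
move=> z z0 zS.
pose d m : R := (n m).+2%:R * tau m.
have dE m : d m * (sumn (ss m)).+1%:R = kap m.
  have x0 : (n m).+2%:R != 0 :> R by rewrite pnatr_eq0.
  have y0 : (sumn (ss m)).+1%:R != 0 :> R by rewrite pnatr_eq0.
  have fid (x y K : R) : x != 0 -> y != 0 -> x * (K / (x * y)) * y = K.
    by move=> hx hy; field; rewrite hx hy.
  exact: fid.
have d0 m : 0 < d m by rewrite mulr_gt0 ?ltr0n.
have dk m : d m <= kap m by rewrite -dE ler_peMr ?ler1n // ltW.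
have main m : nr (z (off m.+1) - b (m.+1, 0%N)) <= nr (z (off m) - b (m, 0%N)) + eta m.
  rewrite offS (orbit_word (P := fun i x => proj (M i) x) zS (hk m)).
  have st := stage hJ cT tT pT ct cp tp tt tc cct hT bb bib bi1 bij tau0 kap0 m (ss m) (z (off m)).
  have := nr_tri _ (foldl (fun x i => proj (M i) x) (z (off m)) (w m)) (b (m.+1, 0%N)).
  move=> /(_ (@core R V n b m (foldl (fun x s => Pl (delta_mx 0 ord0) (delta_mx 0 (ord1' (n m)))
    (iter s (TA m \o TA m) x)) (delta_mx 0 ord0) (ss m)))) tri.
  have cn := hend m; rewrite -(@core_nr R V n b bb m) /core combB in cn.
  rewrite -!/(@core R V n b m _) (@core1 R V n b m) in cn.
  apply: le_trans tri _; apply: le_trans (lerD st cn) _.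
  rewrite W4 // hss.
  have jb l : jct n kap tau l <= 3 * kap l + 3 * kap l.-1.
    by rewrite /jct -/(d l) -/(d l.-1); have := dk l; have := dk l.-1; lra.
  have r1 : kap m <= rho eta N m by case: (theta_le eta N m).
  have r2 := theta_pred_le eta N m; have r3 := theta_succ_le eta N m.
  have j1 := jb m; have j2 := jb m.+1; rewrite /= in j2.
  rewrite -/(kap m.-1) in r2; rewrite -/(kap m.+1) in r3.
  have s1 : (sumn (ss m))%:R * d m <= rho eta N m.
    apply: le_trans (_ : kap m <= _) => //; rewrite -(dE m) mulrC ler_wpM2l ?ler_nat //.
    exact: ltW.
  have s2 : (N m)%:R * (jct n kap tau m + jct n kap tau m.+1 + d m) <=
      (N m)%:R * (13 * rho eta N m).
    by rewrite ler_wpM2l //; have := dk m; lra.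
  have rs := rho_small eta N m; have rp := rho_gt0 N eta0 m.
  have np : 0 <= (N m)%:R * rho eta N m by rewrite mulr_ge0 // ltW.
  rewrite -/(d m) in s1 s2 *.
  lra.
have bound m : nr (z (off m) - b (m, 0%N)) <= 3^-1.
  suff : nr (z (off m) - b (m, 0%N)) <= 3^-1 * (1 - half m) by have := half0 m; lra.
  elim: m => [|m IH].
    by rewrite off0 z0 subrr nr0 /half expr0 invr1 subrr mulr0.
  apply: le_trans (main m) _; rewrite /eta halfS; lra.
(* A limit would put consecutive end vectors within 2/3 + 2/10 of each other, although their
   distance is the square root of 2. *)
move=> [l cvl]; have e10 : 0 < 10^-1 :> R by rewrite invr_gt0.
have [K hK] := cvl _ e10; have h1 := hK _ (off_ge K).
have h2 := hK (off K.+1); have {}h2 : nr (z (off K.+1) - l) <= 10^-1.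
  by apply: h2; have := off_ge K.+1; lia.
have h3 := bound K; have h4 := bound K.+1.
have : nr (b (K, 0%N) - b (K.+1, 0%N)) ^+ 2 = 2.
  rewrite nr_sqB !nrE !bb !eqxx.
  have -> : ((K, 0%N) == (K.+1, 0%N)) = false by apply/eqP => e; have /= := congr1 fst e; lia.
  by rewrite /= mulr0 subr0.
have g1 := nr_tri (z (off K)) (b (K, 0%N)) (b (K.+1, 0%N)).
have g2 := nr_tri l (z (off K)) (b (K.+1, 0%N)).
have g3 := nr_tri (z (off K.+1)) l (b (K.+1, 0%N)).
rewrite (nrBC (b _) (z _)) in g1; rewrite (nrBC l (z _)) in g3.
have g4 : nr (b (K, 0%N) - b (K.+1, 0%N)) <= 1 by lra.
have g5 := nr_ge0 (b (K, 0%N) - b (K.+1, 0%N)).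
have : nr (b (K, 0%N) - b (K.+1, 0%N)) ^+ 2 <= 1 by rewrite expr_le1.
lra.
Qed.

(** * Restriction of scalars *)

Section Scalars.
Variable R : realType.
Implicit Types (s : scalar_kind) (a b : R).

Definition rinj s : R -> scalars R s :=
  match s return R -> scalars R s with
  | RealScalars => id
  | ComplexScalars => fun a => (a%:C)%C
  end.
Definition rre s : scalars R s -> R :=
  match s return scalars R s -> R with
  | RealScalars => id
  | ComplexScalars => @complex.Re R
  end.
Definition junit s : scalars R s :=
  match s return scalars R s with
  | RealScalars => 1
  | ComplexScalars => ('i)%C
  end.
Definition jsg s : R := if s is RealScalars then 1 else -1.
Definition jom s : R := if s is RealScalars then 1 else 0.

Lemma rinjD s a b : rinj s (a + b) = rinj s a + rinj s b.
Proof. by case: s => //=; apply/eqP; rewrite eq_complex /= addr0 !eqxx. Qed.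

Lemma rinjM s a b : rinj s (a * b) = rinj s a * rinj s b.
Proof. by case: s => //=; apply/eqP; rewrite eq_complex /= !(mulr0, mul0r) subr0 addr0 !eqxx. Qed.

Lemma rinj1 s : rinj s 1 = 1. Proof. by case: s. Qed.

Lemma rreD s (x y : scalars R s) : rre (x + y) = rre x + rre y.
Proof. by case: s x y => //= -[a b] [c d]. Qed.

Lemma rre_rinj s a : rre (rinj s a) = a. Proof. by case: s. Qed.

Lemma rreM s a (x : scalars R s) : rre (rinj s a * x) = a * rre x.
Proof. by case: s x => //= -[b c] /=; rewrite mul0r subr0. Qed.

Lemma rre_conj s (x : scalars R s) : rre (scalar_conj x) = rre x.
Proof. by case: s x => //= -[b c]. Qed.

Lemma conjM s (x y : scalars R s) :
  scalar_conj (x * y) = scalar_conj x * scalar_conj y.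
Proof.
case: s x y => //= -[a b] [c d]; apply/eqP; rewrite eq_complex /=.
by rewrite mulrNN mulrN mulNr opprD !eqxx.
Qed.

Lemma rinj_rre s (x : scalars R s) : 0 <= x -> x = rinj s (rre x).
Proof. by case: s x => //= -[a b]; rewrite lecE /= => /andP[/eqP -> _]. Qed.

Lemma rinj_le s a b : (rinj s a <= rinj s b) = (a <= b).
Proof. by case: s => //=; rewrite lecE /= eqxx. Qed.

Lemma rinj_lt s a b : (rinj s a < rinj s b) = (a < b).
Proof. by case: s => //=; rewrite ltcE /= eqxx. Qed.

Lemma rinj0 s : rinj s 0 = 0. Proof. by case: s. Qed.

Lemma junit_conj s : scalar_conj (junit s) * junit s = 1.
Proof.
by case: s => /=; [rewrite mulr1 | apply/eqP; rewrite eq_complex /=;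
  apply/andP; split; apply/eqP; ring].
Qed.

Lemma junit_sq s : junit s * junit s = rinj s (jsg s).
Proof.
by case: s => /=; [rewrite mulr1 | apply/eqP; rewrite eq_complex /=;
  apply/andP; split; apply/eqP; ring].
Qed.

Lemma jsg_sq s : jsg s * jsg s = 1.
Proof. by case: s => /=; ring. Qed.

Lemma rre_junit s a : rre (scalar_conj (junit s) * rinj s a) = jom s * a.
Proof. by case: s => /=; ring. Qed.

Lemma scalar_decomp s (x : scalars R s) : exists a b, x = rinj s a + rinj s b * junit s.
Proof.
case: s x => [x|[a b]]; first by exists x, 0; rewrite /= mul0r addr0.
exists a, b; apply/eqP; rewrite eq_complex /=.
by apply/andP; split; apply/eqP; ring.
Qed.

Lemma scalar_eq0 s (x : scalars R s) :
  rre x = 0 -> rre (scalar_conj (junit s) * x) = 0 -> x = 0.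
Proof.
case: s x => [x //|[a b]] /= -> h; apply/eqP; rewrite eq_complex /= eqxx /=.
by apply/eqP; move: h; lra.
Qed.

End Scalars.

(** A copy of [H] that records [dot] and [Hdot] in its type, so that the real inner product can be
    attached to it. *)
Definition realified (R : realType) (s : scalar_kind)
    (H : completeNormedModType (scalars R s))
    (dot : {dot H for @scalar_conj R s}) (Hdot : norm_of_dot dot) : Type := H.

Section Realified.
Variables (R : realType) (s : scalar_kind) (H : completeNormedModType (scalars R s)).
Variables (dot : {dot H for @scalar_conj R s}) (Hdot : norm_of_dot dot).
Implicit Types (x y z : H) (a b : R).

Lemma dotC x y : dot x y = scalar_conj (dot y x).
Proof. by rewrite [LHS](@hermitian_subproof _ _ false (@scalar_conj R s) dot) expr0 mul1r. Qed.

Lemma dotDl x y z : dot (x + y) z = dot x z + dot y z.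
Proof. exact: linearDl. Qed.

Lemma dotZl (a : scalars R s) x y : dot (a *: x) y = a * dot x y.
Proof. exact: linearZl_LR. Qed.

Lemma dotZr (a : scalars R s) x y : dot x (a *: y) = scalar_conj a * dot x y.
Proof. by rewrite dotC dotZl conjM -dotC. Qed.

HB.instance Definition _ := GRing.Zmodule.copy (realified Hdot) H.

Definition rscale a (x : realified Hdot) : realified Hdot := rinj s a *: (x : H).

Lemma rscaleA a b x : rscale a (rscale b x) = rscale (a * b) x.
Proof. by rewrite /rscale rinjM scalerA. Qed.

Lemma rscale1 x : rscale 1 x = x.
Proof. by rewrite /rscale rinj1 scale1r. Qed.

Lemma rscaleDr : right_distributive rscale +%R.
Proof. by move=> a x y; rewrite /rscale scalerDr. Qed.

Lemma rscaleDl x : {morph rscale^~ x : a b / a + b}.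
Proof. by move=> a b; rewrite /rscale rinjD scalerDl. Qed.

HB.instance Definition _ := GRing.Zmodule_isLmodule.Build R (realified Hdot)
  rscaleA rscale1 rscaleDr rscaleDl.

Definition rdot (x y : realified Hdot) : R := rre (dot x y).

Lemma rdotC x y : rdot x y = rdot y x.
Proof. by rewrite /rdot dotC rre_conj. Qed.

Lemma rdotDl (x y z : realified Hdot) : rdot (x + y) z = rdot x z + rdot y z.
Proof. by rewrite /rdot dotDl rreD. Qed.

Lemma rdotZl a (x y : realified Hdot) : rdot (a *: x) y = a * rdot x y.
Proof. by rewrite /rdot dotZl rreM. Qed.

Lemma dot_self x : dot x x = rinj s (rdot x x).
Proof. by apply: rinj_rre; rewrite -Hdot exprn_ge0. Qed.

Lemma rdot_ge0 x : 0 <= rdot x x.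
Proof. by rewrite -(rinj_le s) -dot_self rinj0 -Hdot exprn_ge0. Qed.

Lemma rdot_eq0 x : rdot x x = 0 -> x = 0.
Proof.
move=> h; apply/eqP; rewrite -normr_eq0 -sqrf_eq0 Hdot dot_self h rinj0 //.
Qed.

HB.instance Definition _ := isInner.Build R (realified Hdot)
  rdotC rdotDl rdotZl rdot_ge0 rdot_eq0.

Lemma norm_nr x : `|x| = rinj s (nr (x : realified Hdot)).
Proof.
have e : `|x| = rinj s (rre `|x|) by exact: rinj_rre.
rewrite e; congr (rinj s _); apply/eqP.
have r0 : 0 <= rre `|x| by rewrite -(rinj_le s) rinj0 -e.
rewrite -(@eqrXn2 _ 2) ?nr_ge0 // nrE; apply/eqP.
have := Hdot x; rewrite e expr2 -rinjM dot_self => h.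
by have := congr1 (@rre R s) h; rewrite !rre_rinj -expr2.
Qed.

Lemma le_norm x a : (`|x| <= rinj s a) = (nr (x : realified Hdot) <= a).
Proof. by rewrite norm_nr rinj_le. Qed.

Lemma cvgn_converges (u : nat -> H) :
  cvgn u <-> exists l, converges (u : nat -> realified Hdot) l.
Proof.
split.
  move=> /cvg_ex [l /cvgrPdist_le hl]; exists l => e e0.
  have [|N _ hN] := hl (rinj s e); first by rewrite -(rinj0 R s) rinj_lt.
  by exists N => n /hN; rewrite le_norm nrBC.
move=> [l hl]; apply: (cvgP l); apply/cvgrPdist_le => e e0.
have ee : e = rinj s (rre e) by apply: rinj_rre; exact: ltW.
have [|N hN] := hl (rre e); first by rewrite -(rinj_lt s) rinj0 -ee.
by exists N => // n /hN h; rewrite /= ee le_norm nrBC.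
Qed.

Lemma realified_complete (u : nat -> realified Hdot) :
  (forall e, 0 < e -> exists N, forall m n, (N <= m)%N -> (N <= n)%N ->
    Num.sqrt (ip (u m - u n) (u m - u n)) <= e) ->
  exists l, forall e, 0 < e -> exists N, forall n, (N <= n)%N ->
    Num.sqrt (ip (u n - l) (u n - l)) <= e.
Proof.
move=> hu; suff /cvgn_converges [l hl] : cvgn (u : nat -> H) by exists l.
apply/cauchy_cvgP/cauchy_ballP => e e0.
have ee : e = rinj s (rre e) by apply: rinj_rre; exact: ltW.
have e1 : 0 < rre e by rewrite -(rinj_lt s) rinj0 -ee.
have e2 : 0 < rre e / 2 by rewrite divr_gt0.
have [N hN] := hu _ e2.
pose S : set H := [set x | exists2 n, (N <= n)%N & x = u n].
have hS : nbhs (u @ \oo : set_system H) S by exists N => // n Nn; exists n.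
exists (S, S) => // -[_ _] [/= [m Nm ->] [n Nn ->]].
rewrite -ball_normE /= norm_nr ee rinj_lt; apply: le_lt_trans (hN _ _ Nm Nn) _.
by rewrite ltr_pdivrMr // ltr_pMr // ltr1n.
Qed.

HB.instance Definition _ := isHilbert.Build R (realified Hdot) realified_complete.

Definition Jmul (x : realified Hdot) : realified Hdot := junit R s *: (x : H).

Lemma Jmul_isometry : scalar_isometry Jmul (jsg R s) (jom R s).
Proof.
split.
- move=> a x y; have -> : Jmul (a *: x + y) = junit R s *: (rinj s a *: (x : H) + y) by [].
  by rewrite scalerDr scalerA mulrC -scalerA.
- move=> x y; rewrite /ip /= /rdot dotZl dotZr mulrA (mulrC (junit R s)).
  by rewrite junit_conj mul1r.
- by move=> x; rewrite /Jmul scalerA junit_sq.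
- exact: jsg_sq.
- by move=> x; rewrite /ip /= {1}/rdot dotZr dot_self rre_junit.
Qed.

Lemma dot_eq0 x y : dot x y = 0 <->
  ip (x : realified Hdot) y = 0 /\ ip (x : realified Hdot) (Jmul y) = 0.
Proof.
split; first by move=> h; rewrite /ip /= /rdot /Jmul dotZr h mulr0 -(rinj0 R s) rre_rinj.
by move=> [h1 h2]; apply: scalar_eq0 => //; rewrite -dotZr.
Qed.

Implicit Types X : set H.

Lemma scalar_closed X : subsp (X : set (realified Hdot)) -> (forall x, X x -> X (Jmul x)) ->
  forall (a : scalars R s) x, X x -> X (a *: x).
Proof.
move=> sX JX a x xX; have [c [d ->]] := scalar_decomp a.
rewrite scalerDl -scalerA; apply: (subspD sX); first exact: (subspZ c sX).
by apply: (subspZ d sX); exact: JX.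
Qed.

Lemma adh_closed_closed X : adh_closed (X : set (realified Hdot)) <-> closed X.
Proof.
split.
  move=> hX l hl; apply: hX => e e0.
  have [|x [xX hx]] := hl (ball (l : H) (rinj s e)).
    by apply: nbhsx_ballx; rewrite -(rinj0 R s) rinj_lt.
  exists x => //; move: hx; rewrite -ball_normE /= => h.
  by rewrite -le_norm ltW.
move=> cX l hl; apply: cX => B /nbhs_ballP [e e0 he].
have ee : e = rinj s (rre e) by apply: rinj_rre; exact: ltW.
have e1 : 0 < rre e by rewrite -(rinj_lt s) rinj0 -ee.
have [x xX hx] := hl (rre e / 2) (divr_gt0 e1 (ltr0n _ 2)).
exists x; split=> //; apply: he; rewrite -ball_normE /= norm_nr ee rinj_lt.
by apply: le_lt_trans hx _; rewrite ltr_pdivrMr // ltr_pMr // ltr1n.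
Qed.

Lemma closed_subspaceP X : closed_subspace X <->
  csub (X : set (realified Hdot)) /\ (forall x, X x -> X (Jmul x)).
Proof.
split.
  move=> [[X0 XD] cX].
  have X0' : X 0 by move: X0; rewrite inE.
  have XD' (a : scalars R s) (x y : H) : X x -> X y -> X (a *: x + y).
    by move=> xX yX; have := XD a x y; rewrite !inE; exact.
  split; first split; first split=> //; first by move=> a x y; exact: XD'.
    exact/adh_closed_closed.
  by move=> x xX; rewrite -[Jmul x]addr0; exact: XD'.
move=> [[sX aX] JX]; split; last exact/adh_closed_closed.
split; first by rewrite inE; case: sX.
move=> a x y; rewrite !inE => xX yX; apply: (subspD sX) => //.
exact: scalar_closed.
Qed.

(** Real orthogonality to a [Jmul]-stable set includes orthogonality to all [Jmul x], hence
    vanishing of both parts of [dot]. *)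
Lemma orthocomplementE X : (forall x, X x -> X (Jmul x)) ->
  orthocomplement dot X = ortho (X : set (realified Hdot)).
Proof.
move=> JX; apply/seteqP; split=> y hy x xX.
  by have /dot_eq0 [] := hy x xX.
apply/dot_eq0; split; first exact: hy.
have := J_adj Jmul_isometry x y; rewrite (hy (Jmul x) (JX _ xX)) => /esym/eqP.
rewrite mulf_eq0 => /orP[/eqP h|/eqP //].
by have := jsg_sq R s; rewrite h mulr0 => /eqP; rewrite eq_sym oner_eq0.
Qed.

Lemma orth_projE X x : closed_subspace X -> orth_proj dot X x = proj (X : set (realified Hdot)) x.
Proof.
move=> /closed_subspaceP [cX JX]; rewrite /orth_proj /proj; congr (xget 0 _).
by rewrite orthocomplementE.
Qed.

Lemma subsp_combinations n (e : 'I_n -> H) :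
  subsp ([set \sum_(i < n) a i *: e i | a in [set: 'I_n -> scalars R s]] :
    set (realified Hdot)).
Proof.
split; first by exists (fun=> 0) => //; rewrite big1 // => i _; rewrite scale0r.
move=> c _ _ [a _ <-] [a' _ <-]; exists (fun i => rinj s c * a i + a' i) => //.
transitivity (rinj s c *: \sum_(i < n) a i *: e i + \sum_(i < n) a' i *: e i) => //.
rewrite scaler_sumr -big_split; apply: eq_bigr => i _ /=.
by rewrite scalerDl scalerA.
Qed.

Lemma finite_dimensional_Span X : finite_dimensional X ->
  exists D, X = Span (D : seq (realified Hdot)).
Proof.
move=> [n [e ->]].
(* Real generators need the multiples by [junit] as well; for real scalars this only repeats the
   list. *)
pose D : seq (realified Hdot) := [seq e i | i <- enum 'I_n] ++ [seq Jmul (e i) | i <- enum 'I_n].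
exists D; apply/seteqP; split.
  move=> _ [a _ <-].
  apply: (@subsp_sum _ (realified Hdot) _ _ _ xpredT (fun i => a i *: e i) (subsp_Span D)).
  move=> i _.
  have [c [d ->]] := scalar_decomp (a i); rewrite scalerDl -scalerA.
  apply: SpanD; apply: SpanZ; apply: mem_Span; rewrite mem_cat.
    by rewrite map_f ?mem_enum.
  by rewrite orbC (map_f (fun i => Jmul (e i))) ?mem_enum.
apply: (@Span_min _ (realified Hdot)); first exact: subsp_combinations.
move=> d; rewrite mem_cat => /orP[/mapP [i _ ->]|/mapP [i _ ->]].
  exists (fun j => (j == i)%:R) => //; rewrite (bigD1 i) //= eqxx scale1r big1 ?addr0 //.
  by move=> j /negbTE ->; rewrite scale0r.
exists (fun j => if j == i then junit R s else 0) => //.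
rewrite (bigD1 i) //= eqxx big1 ?addr0 // => j /negbTE ->; rewrite scale0r //.
Qed.

Lemma Span_finite_dimensional X (D : seq (realified Hdot)) :
  (forall x, X x -> X (Jmul x)) -> X = Span D -> finite_dimensional X.
Proof.
move=> JX eX; have sX : subsp (X : set (realified Hdot)) by rewrite eX; exact: subsp_Span.
exists (size D), (fun i => nth 0 D i); apply/seteqP; split.
  rewrite eX; apply: (@Span_min _ (realified Hdot)); first exact: subsp_combinations.
  move=> d dD; have id : (index d D < size D)%N by rewrite index_mem.
  exists (fun j => (j == Ordinal id)%:R) => //.
  rewrite (bigD1 (Ordinal id)) //= eqxx scale1r nth_index // big1 ?addr0 //.
  by move=> j /negbTE ->; rewrite scale0r.
move=> _ [a _ <-].
apply: (@subsp_sum _ (realified Hdot) _ _ _ xpredT (fun i => a i *: nth 0 D i) sX) => i _.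
apply: scalar_closed => //.
by rewrite eX; apply: mem_Span; exact: mem_nth.
Qed.

End Realified.

Section Translation.
Variables (R : realType) (s : scalar_kind) (H : completeNormedModType (scalars R s)).
Variables (dot : {dot H for @scalar_conj R s}) (Hdot : norm_of_dot dot).
Variables (I : finType) (L : I -> set H).
Hypothesis HL : forall i, closed_subspace (L i).
Local Notation V := (realified Hdot).
Implicit Types (A : {set I}).

Lemma closed_subspace_csub i : csub (L i : set V).
Proof. by have /(closed_subspaceP Hdot) [] := HL i. Qed.

Lemma closed_subspace_Jmul i x : (L i : set V) x -> (L i : set V) (Jmul x).
Proof. by have /(closed_subspaceP Hdot) [_] := HL i; exact. Qed.

Lemma subspace_sumE A :
  subspace_sum A (fun i => orthocomplement dot (L i)) = osum (L : I -> set V) A.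
Proof.
have E i : orthocomplement dot (L i) = ortho (L i : set V).
  by apply: orthocomplementE => x; exact: closed_subspace_Jmul.
apply/seteqP; split=> [_ [v hv <-]|_ [v hv ->]]; exists v => //.
  by move=> i iA; rewrite -E; exact: hv.
by move=> i iA; rewrite E; exact: hv.
Qed.

Lemma finite_dimensional_meet A : finite_dimensional (\bigcap_(i in [set` A]) L i) <->
  exists D, meet (L : I -> set V) A = Span D.
Proof.
split=> [|[D eD]]; first exact: (@finite_dimensional_Span _ _ _ _ Hdot).
apply: (Span_finite_dimensional _ eD) => x hx i iA.
exact: (closed_subspace_Jmul (hx i iA)).
Qed.

Lemma iterates_proj (L' : I -> set H) (k : nat -> I) (z0 : H) n :
  (forall i, closed_subspace (L' i)) ->
  iterates dot L' k z0 n.+1 = proj (L' (k n) : set V) (iterates dot L' k z0 n).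
Proof. by move=> HL'; exact: (orth_projE Hdot). Qed.

End Translation.

Theorem theorem4p1 (R : realType) (s : scalar_kind)
    (H : completeNormedModType (scalars R s))
    (dot : {dot H for @scalar_conj R s}) (Hdot : norm_of_dot dot)
    (K : nat) (K_ge4 : (4 <= K)%N)
    (L : 'I_K -> set H) (HL : forall i, closed_subspace (L i)) :
  (exists (z0 : H) (k : nat -> 'I_K) (L' : 'I_K -> set H),
     [/\ forall i N, exists n, (N <= n)%N /\ k n = i,
         forall i, closed_subspace (L' i) /\ L' i `<=` L i
       & ~ cvgn (iterates dot L' k z0)])
  <->
  (exists V : {set {set 'I_K}},
     [/\ forall A, A \in V -> #|A| = 4%N,
         finset.cover V = [set: 'I_K]%SET,
         graph_connected V (@meet_in_three 'I_K)
       & forall A, A \in V ->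
           ~ finite_dimensional (\bigcap_(i in [set` A]) L i) \/
           ~ closed (subspace_sum A (fun i => orthocomplement dot (L i)))]).
Proof.
pose V := realified Hdot; pose LV : 'I_K -> set V := L.
have cL i : csub (LV i) by exact: closed_subspace_csub.
have JL i x : LV i x -> LV i (Jmul x) by exact: closed_subspace_Jmul.
split=> [[z0 [k [L' [k_inf hL' ncv]]]]|[W [W4 covW conW badW]]].
  have cL' i : csub (L' i : set V) by apply: closed_subspace_csub => j; case: (hL' j).
  have zS n : iterates dot L' k z0 n.+1 = proj (L' (k n) : set V) (iterates dot L' k z0 n).
    by apply: iterates_proj => i; case: (hL' i).
  have ncv' : ~ exists l, converges (iterates dot L' k z0 : nat -> V) l.
    by move=> /(cvgn_converges Hdot).
  have K4 : (4 <= #|'I_K|)%N by rewrite card_ord.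
  have [W [W4 covW conW badW]] :=
    necessity K4 cL cL' (fun i => (hL' i).2) zS k_inf ncv'.
  exists W; split=> // A AW; have [h|h] := badW A AW; [left | right].
    by move=> /(finite_dimensional_meet Hdot HL).
  by rewrite (subspace_sumE Hdot HL) => /(adh_closed_closed Hdot).
(* Both alternatives for a bad set enter only through this one property. *)
have apW A : A \in W -> approx_meet LV A.
  move=> AW; apply: contrapT => /(meet_osum_of_not_approx cL) [hD hc].
  have [|] := badW A AW; apply; first exact/(finite_dimensional_meet Hdot HL).
  by rewrite (subspace_sumE Hdot HL); exact/(adh_closed_closed Hdot).
have [|z0 [k [L' [k_inf hL' ncv]]]] :=
    sufficiency (Jmul_isometry Hdot) _ cL JL W4 covW conW apW.
  by exists (Ordinal (leq_trans (ltn0Sn 3) K_ge4)).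
have cL' i : closed_subspace (L' i).
  by apply/(closed_subspaceP Hdot); case: (hL' i).
exists z0, k, L'; split=> // [i|]; first by split=> //; case: (hL' i).
move=> /(cvgn_converges Hdot); apply: ncv => // n.
exact: iterates_proj.
Qed.
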